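(* Suppose that the system $\partial_t f^0(U)+f(U)_x=(B(U)U_x)_x$ described in the context possesses a convex entropy, and that the map $\Psi: C_2\in\mathcal C\mapsto U_{II}(1)$ is proper with respect to $\mathcal C$ and $\mathcal U$ (both notions are defined in the context). Then for any data $U(0)=U_0$, $U_{II}(1)=U_{1II}$ there exists a steady profile solution, i.e. a solution $\hat U$ of $$ (f(\hat U))_x=(B(\hat U)\hat U_x)_x\ \ (0<x<1),\qquad \hat U(0)=U_0,\qquad \hat U_{II}(1)=U_{1II}. $$
   Context: Setting. States are $U=(U_I,U_{II})\in\mathcal U\subset\mathbb R^n$, with $U_I\in\mathbb R^r$, $U_{II}\in\mathbb R^{n-r}$. Here $f^0=(f^0_I,f^0_{II})$ and $f=(f_I,f_{II})$ take values in $\mathbb R^r\times\mathbb R^{n-r}$, and $B=\begin{pmatrix} 0 & 0 \\ 0 & B_{22} \end{pmatrix}$ with $B_{22}(U)\in M_{n-r}(\mathbb R)$. The matrix $df^0=\begin{pmatrix} \mathrm{Id}_r & 0 \\ (df^0_{II})_I & (df^0_{II})_{II} \end{pmatrix}$ is invertible, with $\det (df^0_{II})_{II}>0$. Throughout it is assumed that: $f$ and $B$ are smooth; for any $U$ the eigenvalues of $(df^0_{II})_{II}^{-1}B_{22}+\big((df^0_{II})_{II}^{-1}B_{22}\big)^T$ are positive; and for any $U$ the eigenvalues of $(df_I)_I(U)$ (the derivative of $f_I$ with respect to $U_I$) are real and positive. Convex entropy. The system has a convex entropy if there is an entropy/entropy flux pair $(\eta,q)$, regarded as functions of the variable $f^0$,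 such that $\frac{d^2\eta}{(df^0)^2}>0$, $\frac{d\eta}{df^0}\frac{df}{df^0}=\frac{dq}{df^0}$, and $M+M^T\ge 0$ with equality only on $\ker B$, where $M=(df^0)^T\frac{d^2\eta}{(df^0)^2}B$. Feasible set and the map $\Psi$. For fixed $U_0$ and $C_2\in\mathbb R^{n-r}$, let $U$ be the maximal solution of $$B_{22}(U)U_{II}'=f_{II}(U)-f_{II}(U_0)+B_{22}(U_0)C_2,\qquad U_{II}(0)=U_{0II},\qquad f_I(U)=f_I(U_0),$$ where $U_{0II}$ is the $II$-component of $U_0$ and $U(0)=U_0$. Consider the open set of $C_2$ for which this solution is defined on $[0,1]$ and remains in the interior of the domain $\mathcal U$. The feasible set $\mathcal C$ is the connected component of this open set that contains the parameter $C_2=0$ of the constant solution $U\equiv U_0$. For $C_2\in\mathcal C$, $\Psi(C_2)$ is the value $U_{II}(1)$ of this solution; steady profiles with right datum $U_{1II}$ correspond to solutions $C_2$ of $\Psi(C_2)=U_{1II}$. Properness. $\Psi$ is proper if the inverse image in $\mathcal C$ of a compact set of target values $U_{II}(1)$ in $\mathcal U$ (that is, of $U_{II}$-values of states in $\mathcal U$) is compact. The data $U_0$ and $U_{1II}$ are likewise understood as taken from the state domain $\mathcal U$ ($U_{1II}$ being the $II$-part of a state). *)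

(* Defs.v *)
From HB Require Import structures.
From mathcomp Require Import all_boot all_order all_algebra.
From mathcomp Require Import complex.
From mathcomp Require Import all_classical all_reals all_analysis.

Set Implicit Arguments.
Unset Strict Implicit.
Unset Printing Implicit Defensive.

Import Order.TTheory GRing.Theory Num.Theory.
Import numFieldNormedType.Exports.

Local Open Scope classical_set_scope.
Local Open Scope ring_scope.

(* States are column vectors U : 'cV_(r + m), where m stands for n - r;
   U_I = usubmx U and U_II = dsubmx U. *)

Section Calculus.
Context {R : realType}.

(* [Ck k D f]: f is of class C^k at the points of D (D is meant to be open). *)
Fixpoint Ck (V W : normedModType R) (k : nat) (D : set V) (f : V -> W) : Prop :=
  match k with
  | 0 => forall x, D x -> {for x, continuous f}
  | k'.+1 => (forall x, D x -> differentiable f x) /\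
             (forall v : V, Ck k' D ('D_v f))
  end.

Definition smooth (V W : normedModType R) (D : set V) (f : V -> W) : Prop :=
  forall k, Ck k D f.

Definition ebase n (j : 'I_n) : 'cV[R]_n := delta_mx j 0.

(* Rows are indexed by the components of f, columns by the variables; the
   library's [jacobian] is for row vectors and is the transpose of this one. *)
Definition Jac n p (f : 'cV[R]_n -> 'cV[R]_p) (x : 'cV[R]_n) : 'M[R]_(p, n) :=
  \matrix_(i, j) ('D_(ebase j) f x) i 0.

Definition grad n (g : 'cV[R]_n -> R) (x : 'cV[R]_n) : 'rV[R]_n :=
  \row_j 'D_(ebase j) g x.

Definition Hess n (g : 'cV[R]_n -> R) (x : 'cV[R]_n) : 'M[R]_n :=
  \matrix_(i, j) 'D_(ebase i) ('D_(ebase j) g) x.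

Definition qform n (A : 'M[R]_n) (v : 'cV[R]_n) : R := (v^T *m A *m v) 0 0.

(* Every complex eigenvalue of the real matrix A is real and positive. *)
Definition real_pos_spectrum n (A : 'M[R]_n) : Prop :=
  forall z : R[i], eigenvalue (map_mx (real_complex R) A) z ->
  exists a : R, z = real_complex R a /\ 0 < a.

End Calculus.

Section System.
Context {R : realType} {r m : nat}.

Local Notation state := ('cV[R]_(r + m)).

Variables (D : set state) (f0 f : state -> state) (B22 : state -> 'M[R]_m).

Definition Bmx (U : state) : 'M[R]_(r + m) := block_mx 0 0 0 (B22 U).

Definition df0 (U : state) : 'M[R]_(r + m) := Jac f0 U.

Definition df0_IIII (U : state) : 'M[R]_m := drsubmx (df0 U).

(* f^0 has the prescribed block structure, with invertible differential. *)
Definition f0_structure (U : state) : Prop :=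
  [/\ usubmx (df0 U) = row_mx 1%:M 0,
      df0 U \in unitmx
    & 0 < \det (df0_IIII U)].

Definition parabolicity (U : state) : Prop :=
  let S := invmx (df0_IIII U) *m B22 U in real_pos_spectrum (S + S^T).

Definition dfI_I (U : state) : 'M[R]_r := ulsubmx (Jac f U).

Definition entropy_pair (eta q : state -> R) : Prop :=
  [/\ Ck 2 (f0 @` D) eta, Ck 1 (f0 @` D) q
    & forall U, D U ->
        grad eta (f0 U) *m (Jac f U *m invmx (df0 U)) = grad q (f0 U)].

(* eta and q are functions of the variable w = f^0(U), so that their
   derivatives with respect to f^0 are their plain derivatives at f^0(U),
   while df/df^0 = df (df^0)^-1. *)
Definition convex_entropy : Prop :=
  exists eta q : state -> R,
    entropy_pair eta q /\
    forall U, D U ->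
      let H := Hess eta (f0 U) in
      let M := (df0 U)^T *m H *m Bmx U in
      [/\ (forall v, v != 0 -> 0 < qform H v),
          (forall v, 0 <= qform (M + M^T) v)
        & (forall v, qform (M + M^T) v = 0 -> Bmx U *m v = 0)].

(* U solves, on [0, T[,
     B22(U) U_II' = f_II(U) - f_II(U0) + B22(U0) C2,  f_I(U) = f_I(U0),
   with U(0) = U0.  At x = 0 only continuity is required: the equation then
   holds there with the one-sided derivative.  Continuity of U (and not only
   of U_II) excludes jumps between sheets of {f_I = f_I(U0)}. *)
Definition profile_solution (U0 : state) (C2 : 'cV[R]_m)
    (T : \bar R) (U : R -> state) : Prop :=
  [/\ (0 < T)%E /\ U 0 = U0,
      {within [set x : R | 0 <= x /\ (x%:E < T)%E], continuous U},
      (forall x : R, 0 <= x -> (x%:E < T)%E ->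
         D (U x) /\ usubmx (f (U x)) = usubmx (f U0))
    & (forall x : R, 0 < x -> (x%:E < T)%E ->
         derivable (fun y => dsubmx (U y)) x 1 /\
         B22 (U x) *m derive1 (fun y => dsubmx (U y)) x
           = dsubmx (f (U x)) - dsubmx (f U0) + B22 U0 *m C2)].

Definition maximal_solution (U0 : state) (C2 : 'cV[R]_m)
    (T : \bar R) (U : R -> state) : Prop :=
  profile_solution U0 C2 T U /\
  forall (T' : \bar R) (U' : R -> state),
    profile_solution U0 C2 T' U' -> (T <= T')%E ->
    (forall x : R, 0 <= x -> (x%:E < T)%E -> U' x = U x) -> (T' <= T)%E.

(* The maximal solution as a pair (T, U); T, and U on [0, T[, do not depend on
   the choice, by uniqueness for the initial value problem. *)
Definition max_sol (U0 : state) (C2 : 'cV[R]_m) : \bar R * (R -> state) :=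
  xget (0%E, cst U0)
    [set S : \bar R * (R -> state) | maximal_solution U0 C2 S.1 S.2].

Definition admissible (U0 : state) : set 'cV[R]_m :=
  [set C2 | (1%:E < (max_sol U0 C2).1)%E /\
            forall x : R, 0 <= x <= 1 -> interior D ((max_sol U0 C2).2 x)].

Definition feasible_set (U0 : state) : set 'cV[R]_m :=
  connected_component (admissible U0) 0.

Definition Psi (U0 : state) (C2 : 'cV[R]_m) : 'cV[R]_m :=
  dsubmx ((max_sol U0 C2).2 1).

Definition II_values : set 'cV[R]_m := (fun U : state => dsubmx U) @` D.

Definition Psi_proper (U0 : state) : Prop :=
  forall K : set 'cV[R]_m, K `<=` II_values -> compact K ->
    compact (feasible_set U0 `&` Psi U0 @^-1` K).

Definition steady_profile (U0 : state) (U1II : 'cV[R]_m) (U : R -> state) :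
    Prop :=
  let flux := fun x => f (U x) in
  let visc := fun x => Bmx (U x) *m derive1 U x in
  [/\ {within `[0, 1], continuous U},
      (forall x : R, 0 <= x <= 1 -> D (U x)),
      (forall x : R, 0 < x < 1 ->
         [/\ derivable U x 1, derivable flux x 1, derivable visc x 1
           & derive1 flux x = derive1 visc x]),
      U 0 = U0
    & dsubmx (U 1) = U1II].

End System.

(* Main.v *)
Require Import Defs.
From HB Require Import structures.
From mathcomp Require Import all_boot all_order all_algebra all_fingroup.
From mathcomp Require Import zify ring lra.
From mathcomp Require boolp.

(* The profile map factors as c |-> Phi(c) = U(1) |-> U_II(1), where Phi takes
   values in the sheet {f_I = f_I(U0)}, on which U |-> U_II is locally
   injective.  Zeros of maps on compact sets are counted modulo 2, by counting
   fully labelled simplices in a fine triangulation; for s on the sheet, the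
   parity of the fibre of Phi over s is then well defined, and by properness
   the set of values U_II of the states with odd fibre is open and closed.
   The fibre over U0 is odd: the entropy forces a profile with U(t) = U0 to be
   constant, so that C2 = 0 stays the only zero of U_II(t) - U0_II near 0 for
   0 < t <= 1, and as t -> 0+ the rescaled map tends to the identity. *)

Set Implicit Arguments.
Unset Strict Implicit.
Unset Printing Implicit Defensive.

Import Order.TTheory GRing.Theory Num.Theory.

(** * Fully labelled simplices on a torus *)

(** The sheet need not be a graph over U_II, so Psi(C2) = U0_II does not imply U(1) = U0: rigidity
    of closed profiles controls the fibres of Phi, not those of Psi. This is why the parity is
    attached to a state on the sheet, and why, among the parameters with the right value of U_II(1),
    only those whose Phi-value is that state are counted. Properness concerns time 1 only and gives
    no compactness for t < 1; the deformation in t is therefore carried out on a small ball around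
    C2 = 0. Counting labelled simplices, rather than preimages of regular values, asks no more of
    Psi than continuity. The properties of the count that are used are stability under small
    perturbations of the map, excision, positive rescaling, existence of a zero when the count is
    odd, and the value for the identity. *)

Section Doors.
Variable m : nat.
Implicit Types (l : 'I_m -> 'I_m.+1) (a b c : 'I_m.+1).

Definition omits l a := [forall c, (c != a) ==> [exists j, l j == c]].

(** The doors of the room-and-door count behind Sperner's lemma: the facet left after dropping
    vertex [k] carries every colour other than [a] and [b]. *)
Definition door l a b (k : 'I_m) :=
  [forall c, (c != a) && (c != b) ==> [exists j, (j != k) && (l j == c)]].

(** Covering the m colours other than [a] with m labels leaves room neither for a repetition nor for
    [a]. *)
Lemma omitsP l a : omits l a -> injective l /\ forall j, l j != a.
Proof.
move=> /forallP H.
have sub : [set~ a] \subset [set l j | j in 'I_m].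
  apply/subsetP => c; rewrite !inE => ca.
  have /implyP /(_ ca) /existsP[j /eqP <-] := H c.
  exact: imset_f.
have card_le : #|[set l j | j in 'I_m]| <= m.
  by apply: leq_trans (leq_imset_card _ _) _; rewrite card_ord.
have card_a : #|[set~ a]| = m by rewrite cardsC1 card_ord.
have E : [set~ a] = [set l j | j in 'I_m].
  by apply/eqP; rewrite eqEcard sub card_a.
split.
  have : {in 'I_m &, injective l}.
    by apply/imset_injP; rewrite -E card_a card_ord.
  by move=> inj x y; apply: inj.
move=> j; have : l j \in [set~ a] by rewrite E imset_f.
by rewrite !inE.
Qed.

Lemma doorP l a b k : a != b -> door l a b k ->
  (forall i j, i != k -> j != k -> l i = l j -> i = j) /\
  forall j, j != k -> (l j != a) && (l j != b).
Proof.
move=> ab /forallP H.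
have sub : ~: [set a; b] \subset [set l j | j in [set~ k]].
  apply/subsetP => c; rewrite !inE negb_or => ca.
  have /implyP /(_ ca) /existsP[j /andP[jk /eqP <-]] := H c.
  by apply: imset_f; rewrite !inE.
have card_le : #|[set l j | j in [set~ k]]| <= m.-1.
  by apply: leq_trans (leq_imset_card _ _) _; rewrite cardsC1 card_ord.
have card_a : #|~: [set a; b]| = m.-1.
  have := cardsC [set a; b]; rewrite cards2 ab card_ord.
  have m0 : 0 < m by apply: leq_ltn_trans (ltn_ord k).
  by move: #|_| => n; case: (m) m0 => // m' _; rewrite !addSn add0n => -[].
have E : ~: [set a; b] = [set l j | j in [set~ k]].
  by apply/eqP; rewrite eqEcard sub card_a.
split.
  have inj : {in [set~ k] &, injective l}.
    by apply/imset_injP; rewrite -E card_a cardsC1 card_ord.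
  by move=> i j ik jk; apply: inj; rewrite !inE.
move=> j jk; have : l j \in ~: [set a; b] by rewrite E imset_f // !inE.
by rewrite !inE negb_or.
Qed.

Lemma omits_door l a b : omits l a -> a != b -> exists k, door l a b k.
Proof.
move=> la ab; have [inj _] := omitsP la.
move/forallP: la => la.
have /implyP := la b; rewrite eq_sym => /(_ ab) /existsP[k /eqP lk].
exists k; apply/forallP => c; apply/implyP => /andP[ca cb].
have /implyP /(_ ca) /existsP[j /eqP lj] := la c.
apply/existsP; exists j; rewrite lj eqxx andbT.
by apply: contra cb => /eqP jk; rewrite -lj jk lk.
Qed.

Lemma doorC l a b k : door l a b k = door l b a k.
Proof. by apply: eq_forallb => c; rewrite andbC. Qed.

Lemma door_omits l a b k : a != b -> door l a b k -> l k = b ->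
  omits l a /\ forall k', door l a b k' = (k' == k).
Proof.
move=> ab dk lk; have [inj ne] := doorP ab dk.
have la : omits l a.
  apply/forallP => c; apply/implyP => ca.
  have [->|cb] := eqVneq c b; first by apply/existsP; exists k; rewrite lk.
  move/forallP: dk => /(_ c); rewrite ca cb => /existsP[j /andP[_ lj]].
  by apply/existsP; exists j.
split=> // k'; have [injl _] := omitsP la.
have [->//|kk'] := eqVneq k' k; apply/negP => dk'.
have /andP[ca cb] := ne _ kk'.
move/forallP: (dk') => /(_ (l k')); rewrite ca cb => /existsP[j /andP[jk' /eqP lj]].
by move: jk'; rewrite (injl _ _ lj) eqxx.
Qed.

(** Given a door [k], the label of [k] decides. If it is [a] or [b], the door is the only one and
    exactly one of the two omissions holds. Otherwise it repeats the label of exactly one other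
    index, these two indices are the doors, and no omission holds since [l] is not injective. *)
Lemma odd_doors l a b : a != b ->
  odd #|[set k | door l a b k]| = omits l a (+) omits l b.
Proof.
move=> ab.
case: (@existsP _ (door l a b)) => [[k dk]|nd]; last first.
  have -> : [set k | door l a b k] = set0.
    by apply/setP => k; rewrite !inE; apply/negbTE/negP => dk; apply: nd; exists k.
  rewrite cards0 /=; case: (boolP (omits l a)) => [la|_].
    by case: nd; apply: omits_door.
  case: (boolP (omits l b)) => [lb|//].
  have [|k dk] := omits_door lb (_ : b != a); first by rewrite eq_sym.
  by case: nd; exists k; rewrite doorC.
have [inj ne] := doorP ab dk.
have [lka|lka] := eqVneq (l k) a.
  have ba : b != a by rewrite eq_sym.
  have [lb dE] := door_omits ba (etrans (doorC l b a k) dk) lka.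
  have -> : [set k0 | door l a b k0] = [set k].
    by apply/setP => k'; rewrite !inE doorC dE.
  rewrite cards1 lb; case: (boolP (omits l a)) => // /omitsP[_ /(_ k)].
  by rewrite lka eqxx.
have [lkb|lkb] := eqVneq (l k) b.
  have [la dE] := door_omits ab dk lkb.
  have -> : [set k0 | door l a b k0] = [set k].
    by apply/setP => k'; rewrite !inE dE.
  rewrite cards1 la; case: (boolP (omits l b)) => // /omitsP[_ /(_ k)].
  by rewrite lkb eqxx.
have /existsP[k1 /andP[k1k /eqP lk1]] : [exists j, (j != k) && (l j == l k)].
  by move/forallP: dk => /(_ (l k)); rewrite lka lkb.
have ninj : ~ injective l by move=> injl; move: k1k; rewrite (injl _ _ lk1) eqxx.
have -> : omits l a = false by apply/negbTE/negP => /omitsP[].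
have -> : omits l b = false by apply/negbTE/negP => /omitsP[].
suff -> : [set k0 | door l a b k0] = [set k; k1] by rewrite cards2 eq_sym k1k.
apply/setP => k'; rewrite !inE; apply/idP/orP => [dk'|[/eqP->//|/eqP->]].
  have [inj' _] := doorP ab dk'.
  have [_|kk'] := eqVneq k' k; first by left.
  have [_|kk1] := eqVneq k' k1; first by right.
  have E : k1 = k by apply: inj' => //; rewrite eq_sym.
  by move: k1k; rewrite E eqxx.
apply/forallP => c; apply/implyP => cab.
move/forallP: dk => /(_ c); rewrite cab => /existsP[j /andP[jk /eqP lj]].
apply/existsP; have [jk1|jk1] := eqVneq j k1.
  by exists k; rewrite eq_sym k1k -lk1 -jk1 lj eqxx.
by exists j; rewrite jk1 lj eqxx.
Qed.

End Doors.

(** * Parity of full simplices under a change of labels *)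

Section Simplices.
Local Open Scope ring_scope.
Variables (m : nat) (V : finZmodType) (e : 'I_m.+1 -> V).
Hypothesis sum_e : \sum_i e i = 0.
Implicit Types (x : V * 'S_m.+1) (l : V -> option 'I_m.+1).

(* A pair [(v, s)] stands for the Kuhn simplex with vertices [v],
   [v + e (s 0)], [v + e (s 0) + e (s 1)], and so on.  Since the [e i] sum to
   zero, every vertex can serve as base ([turn] changes the base), so that each
   simplex is listed [m.+1] times and its parity lives modulo [m.+1 * 2]. *)
Definition vert x (j : nat) : V := x.1 + \sum_(i < m.+1 | (i < j)%N) e (x.2 i).

Definition full l x := [forall c, [exists j : 'I_m.+1, l (vert x j) == Some c]].

Definition nfull l := #|[set x | full l x]|.

Definition shiftp : 'S_m.+1 := perm (@ordS_inj m.+1).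

Definition turn x : V * 'S_m.+1 := (vert x 1, (shiftp * x.2)%g).

Lemma vert0 x : vert x 0 = x.1.
Proof. by rewrite /vert big_pred0 ?addr0. Qed.

Lemma vert_last x : vert x m.+1 = x.1.
Proof.
rewrite /vert (eq_bigl xpredT) => [|i]; last by rewrite ltn_ord.
by rewrite -[X in _ + X](reindex_inj (P := xpredT) (F := e) (@perm_inj _ x.2)) sum_e addr0.
Qed.

Lemma vertS x j : (j <= m)%N -> vert x j.+1 = vert x j + e (x.2 (inord j)).
Proof.
move=> jm; rewrite /vert -addrA; congr (_ + _).
rewrite (bigD1 (inord j)) ?inordK //= addrC; congr (_ + _).
apply: eq_bigl => i; rewrite ltnS ltn_neqAle andbC; congr (_ && _).
by rewrite -val_eqE /= inordK.
Qed.

Lemma vert_turn x j : (j <= m)%N -> vert (turn x) j = vert x j.+1.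
Proof.
elim: j => [|j IHj] jm; first by rewrite vert0.
rewrite vertS ?IHj 1?ltnW // [RHS]vertS //; congr (_ + e _).
rewrite /= permM permE; congr (x.2 _); apply/val_inj => /=.
by rewrite !inordK ?modn_small // ltnW.
Qed.

Lemma turn_inj : injective turn.
Proof.
move=> [v p] [v' p'] [E /mulgI Ep]; move: E; rewrite !vertS // !vert0 /= Ep.
by move=> /addIr ->.
Qed.

Lemma full_turn l x : full l (turn x) = full l x.
Proof.
apply: eq_forallb => c; apply/existsP/existsP => -[j lj].
  exists (ordS j); move: lj; rewrite vert_turn -1?ltnS //=.
  have [jm|] := ltnP j m; first by rewrite modn_small.
  (* Wrap-around: the last vertex of [turn x] is [vert x m.+1], the base of [x], since the steps sum
     to zero. *)
  move=> mj; have -> : j = m :> nat by apply/eqP; rewrite eqn_leq mj -ltnS ltn_ord.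
  by rewrite modnn vert0 vert_last.
exists (ord_pred j); move: lj; rewrite vert_turn -1?ltnS //.
have [j0|j0] := posnP j.
  have -> : ord_pred j = m :> nat by rewrite /= j0 add0n modn_small.
  by rewrite vert_last j0 vert0.
suff -> : ((ord_pred j).+1 = j) by [].
rewrite /= addnS /= -{1}(prednK j0) addSnnS modnDr modn_small ?prednK //.
exact: ltnW.
Qed.

Lemma vert_iter_turn x i j : (i + j <= m.+1)%N ->
  vert (iter i turn x) j = vert x (i + j).
Proof.
elim: i x => [//|i IHi] x ij; rewrite iterSr IHi ?vert_turn //.
by apply: leq_trans ij; rewrite addSn.
Qed.

Lemma full_iter_turn l x i : full l (iter i turn x) = full l x.
Proof. by elim: i => // i IHi; rewrite iterS full_turn. Qed.

Lemma card_full_vert l v (j : 'I_m.+1) :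
  #|[set x | full l x & vert x j == v]| = #|[set x | full l x & x.1 == v]|.
Proof.
case: j => j /=; elim: j => [_|j IHj jm].
  by apply: eq_card => x; rewrite !inE vert0.
rewrite -(IHj (ltnW jm)) -[RHS](card_preimset _ turn_inj).
by apply: eq_card => x; rewrite !inE full_turn vert_turn // 1?ltnW.
Qed.

Lemma full_inj l x : full l x -> injective (fun j : 'I_m.+1 => l (vert x j)).
Proof.
move=> /forallP fx.
have sub : [set Some c | c : 'I_m.+1] \subset
    [set l (vert x j) | j : 'I_m.+1].
  apply/subsetP => _ /imsetP[c _ ->].
  have /existsP[j /eqP <-] := fx c; exact: imset_f.
have : {in 'I_m.+1 &, injective (fun j : 'I_m.+1 => l (vert x j))}.
  apply/imset_injP; rewrite eqn_leq leq_imset_card /=.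
  apply: leq_trans (subset_leq_card sub).
  by rewrite card_imset ?card_ord //; apply: Some_inj.
by move=> inj i j; apply: inj.
Qed.

Lemma full_Some l x (j : 'I_m.+1) : full l x -> l (vert x j) != None.
Proof.
move=> fx; apply/negP => /eqP lj.
have /forallP H := fx; have inj := full_inj fx.
have /fin_all_exists[g gP] : forall c, exists i : 'I_m.+1, l (vert x i) = Some c.
  by move=> c; have /existsP[i /eqP] := H c; exists i.
have ginj : injective g by move=> c c' E; apply: Some_inj; rewrite -!gP E.
have [g' _ gK] := injF_bij ginj.
by have := gP (g' j); rewrite gK lj.
Qed.

(** A full simplex has distinct vertices, so it meets [v] in at most one of the m.+1 positions, and
    by turning each position contributes the same count. *)
Lemma card_full_mem l v :
  #|[set x | full l x & [exists j : 'I_m.+1, vert x j == v]]| =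
  (m.+1 * #|[set x | full l x & x.1 == v]|)%N.
Proof.
rewrite -sum1_card.
transitivity (\sum_(x : V * 'S_m.+1 | full l x) \sum_(j < m.+1 | vert x j == v) 1)%N.
  rewrite (eq_bigl (fun x => full l x && [exists j : 'I_m.+1, vert x j == v]));
    last by move=> x; rewrite inE.
  rewrite big_mkcondr; apply: eq_bigr => x fx.
  case: existsP => [[j /eqP vj]|nj]; last first.
    by rewrite big_pred0 // => j; apply/negP => vj; apply: nj; exists j.
  rewrite (big_pred1 j) // => i; apply/eqP/eqP => [vi|->//].
  by apply: (full_inj fx); rewrite vi vj.
rewrite (exchange_big_dep xpredT) //=.
rewrite (eq_bigr (fun=> #|[set x | full l x & x.1 == v]|)); last first.
  move=> j _; rewrite -(card_full_vert l v j) -sum1_card.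
  by apply: eq_bigl => x; rewrite inE.
by rewrite sum_nat_const card_ord.
Qed.

Lemma nfull_split l v :
  nfull l = (m.+1 * #|[set x | full l x & x.1 == v]| +
    #|[set x | full l x & ~~ [exists j : 'I_m.+1, vert x j == v]]|)%N.
Proof.
rewrite -card_full_mem /nfull.
rewrite -(cardsID [set x | [exists j : 'I_m.+1, vert x j == v]]).
by congr (_ + _)%N; apply: eq_card => x; rewrite !inE // andbC.
Qed.

(* Off the base vertex [v], a simplex [(v, s)] is a maximal chain of proper
   nonempty sets of indices, and transposing two consecutive entries of [s]
   moves exactly one of its vertices. *)
Definition flip (k : 'I_m) : 'S_m.+1 := tperm (widen_ord (leqnSn m) k) (lift ord0 k).

Lemma vert_flip v (s : 'S_m.+1) (k : 'I_m) j : j != k.+1 ->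
  vert (v, (flip k * s)%g) j = vert (v, s) j.
Proof.
move=> jk; rewrite /vert /=; congr (v + _).
rewrite [RHS](reindex_inj (@perm_inj _ (flip k))) /=.
apply: eq_big => [i|i _]; last by rewrite permM.
rewrite /flip; case: tpermP => [->|->|//] /=; rewrite ?/bump /= add1n;
  by rewrite [in RHS]leq_eqVlt [in LHS]leq_eqVlt; move: jk; lia.
Qed.

(** Seen from [v], a simplex is the tuple [lam s] of the labels of its other vertices, and it is
    full exactly when this tuple omits no colour but that of [v]. By [odd_doors] the two parities
    differ by the number of pairs (tuple, door); [flip k] moves only the vertex that door [k]
    discards and reverses the sign of [s], so these pairs come in twos. *)
Lemma odd_links l l' v a b :
  (forall s (j : 'I_m), vert (v, s) j.+1 != v) ->
  (forall w, w != v -> l w = l' w) -> l v = Some a -> l' v = Some b ->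
  (forall s (j : 'I_m), l (vert (v, s) j.+1) != None) ->
  odd #|[set s | full l (v, s)]| = odd #|[set s | full l' (v, s)]|.
Proof.
move=> vN ll' lv l'v lS.
(* The default [ord0] is never reached, by the hypothesis [lS]. *)
pose lam s (j : 'I_m) := odflt ord0 (l (vert (v, s) j.+1)).
have lamE s (j : 'I_m) : l (vert (v, s) j.+1) = Some (lam s j).
  by rewrite /lam; case: (l _) (lS s j).
have fullE (k : V -> option 'I_m.+1) d s : k v = Some d ->
    (forall j : 'I_m, k (vert (v, s) j.+1) = Some (lam s j)) ->
    full k (v, s) = omits (lam s) d.
  move=> kv kS; apply: eq_forallb => c; apply/existsP/implyP.
    move=> [j]; case: (unliftP ord0 j) => [i ->|-> ]; rewrite ?lift0 ?kS.
      by move=> /eqP[<-] _; apply/existsP; exists i.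
    by rewrite vert0 kv => /eqP[->]; rewrite eqxx.
  have [->|cd] := eqVneq c d; first by exists ord0; rewrite vert0 kv.
  by move=> /(_ isT) /existsP[j /eqP lj]; exists (lift ord0 j); rewrite lift0 kS lj.
have fl s : full l (v, s) = omits (lam s) a by exact: fullE.
have fl' s : full l' (v, s) = omits (lam s) b.
  by apply: fullE => // j; rewrite -ll' ?lamE.
have [ab|ab] := eqVneq a b.
  by congr (odd _); apply: eq_card => s; rewrite !inE fl fl' ab.
have oddE (P : pred 'S_m.+1) : odd #|[set s | P s]| = \big[addb/false]_s P s.
  rewrite -sum1dep_card big_mkcond (big_morph odd oddD (erefl _)).
  by apply: eq_bigr => s _; case: (P s).
apply/eqP; rewrite -[_ == _]negbK -addbN addNb addbN negbK !oddE -big_split /=.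
rewrite (eq_bigr (fun s => \big[addb/false]_k door (lam s) a b k)); last first.
  move=> s _; rewrite fl fl' -odd_doors // -sum1dep_card big_mkcond.
  rewrite (big_morph odd oddD (erefl _)).
  by apply: eq_bigr => k _; case: (door _ _ _ _).
rewrite exchange_big big1 //= => k _.
have doorf s : door (lam (flip k * s)%g) a b k = door (lam s) a b k.
  apply: eq_forallb => c; congr (_ ==> _); apply: eq_existsb => j.
  have [//|jk /=] := eqVneq j k.
  by congr (_ == _); rewrite /lam vert_flip // eqSS.
have flip_odd s : odd_perm (flip k * s)%g = ~~ odd_perm s.
  by rewrite odd_permM odd_tperm -val_eqE /= /bump add1n neq_ltn ltnSn.
rewrite (bigID (fun s : 'S_m.+1 => odd_perm s)) /=.
suff -> : \big[addb/false]_(s : 'S_m.+1 | odd_perm s) door (lam s) a b k =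
    \big[addb/false]_(s : 'S_m.+1 | ~~ odd_perm s) door (lam s) a b k.
  by rewrite addbb.
rewrite (reindex_inj (mulgI (flip k))) /=.
by apply: eq_big => s; rewrite ?flip_odd ?doorf.
Qed.

(** Only simplices through [v] can change. Each full one is listed m.+1 times, once per base, so the
    parity at base [v] becomes a congruence modulo [m.+1 * 2]. *)
Lemma nfull_update l l' v a b :
  (forall s (j : 'I_m), vert (v, s) j.+1 != v) ->
  (forall w, w != v -> l w = l' w) -> l v = Some a -> l' v = Some b ->
  (forall s (j : 'I_m), l (vert (v, s) j.+1) != None) ->
  nfull l = nfull l' %[mod m.+1 * 2].
Proof.
move=> vN ll' lv l'v lS.
have oddl := odd_links vN ll' lv l'v lS.
rewrite !(nfull_split _ v).
have baseE k : #|[set x | full k x & x.1 == v]| = #|[set s | full k (v, s)]|.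
  rewrite -(card_imset _ (_ : injective (fun s : 'S_m.+1 => (v, s)))); last first.
    by move=> s s' [].
  apply: eq_card => -[w s]; rewrite inE /=; apply/andP/imsetP.
    by move=> [fs /eqP wv]; exists s; rewrite ?inE -?wv.
  by move=> [s']; rewrite inE => fs [-> ->].
have -> : [set x | full l x & ~~ [exists j : 'I_m.+1, vert x j == v]] =
    [set x | full l' x & ~~ [exists j : 'I_m.+1, vert x j == v]].
  apply/setP => x; rewrite !inE andbC [RHS]andbC.
  apply: andb_id2l => /existsPn nv; apply: eq_forallb => c.
  by apply: eq_existsb => j; rewrite ll'.
apply/eqP; rewrite eqn_modDr !baseE -!muln_modr eqn_pmul2l //.
by rewrite !modn2 oddl.
Qed.

Lemma nfull_update_far l l' v :
  (forall w, w != v -> l w = l' w) ->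
  (forall x (j : 'I_m.+1), full l x || full l' x -> vert x j != v) ->
  nfull l = nfull l'.
Proof.
move=> ll' far; apply: eq_card => x; rewrite !inE.
suff : full l x || full l' x -> full l x = full l' x.
  by case: (full l x); case: (full l' x) => // ->.
move=> fx; apply: eq_forallb => c; apply: eq_existsb => j.
by rewrite ll' ?far.
Qed.

(** The labels are changed one vertex at a time, through labellings that mix [l] and [l']. Where the
    vertex and its link are labelled, [nfull_update] applies. An unlabelled vertex lies in no full
    simplex; a vertex with an unlabelled link point lies in none either, by the last hypothesis. *)
Lemma nfull_relabel l l' :
  (forall v s (j : 'I_m), vert (v, s) j.+1 != v) ->
  (forall v, (l v == None) = (l' v == None)) ->
  (forall k, (forall v, k v = l v \/ k v = l' v) ->
    forall x (i : 'I_m.+1) s (j : 'I_m), full k x ->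
      l (vert (vert x i, s) j.+1) != None) ->
  nfull l = nfull l' %[mod m.+1 * 2].
Proof.
move=> vN ll' H.
pose k n v := if (enum_rank v < n)%N then l' v else l v.
have kP n v : k n v = l v \/ k n v = l' v by rewrite /k; case: ifP; auto.
have kNone n v : (k n v == None) = (l v == None).
  by rewrite /k; case: ifP => // _; rewrite ll'.
have -> : l' = k #|V|.
  apply/boolp.funext => v; rewrite /k ltn_ord //.
have {1}-> : l = k 0 by [].
have : (#|V| <= #|V|)%N by [].
elim: {1 3}#|V| => [//|n IHn] nV; rewrite IHn 1?ltnW //.
pose v := enum_val (Ordinal nV).
have knn w : w != v -> k n w = k n.+1 w.
  move=> wv; rewrite /k ltnS [in RHS]leq_eqVlt.
  case: eqP => [wn|_] //=; case/eqP: wv.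
  rewrite /v -[w]enum_rankK; congr enum_val; exact: val_inj.
case Ea : (k n v) => [a|]; last first.
  congr (modn _ _); apply: (nfull_update_far (v := v)) => // x j fx.
  apply/negP => /eqP vx; case/orP: fx => /(full_Some j); rewrite vx ?Ea //.
  by rewrite kNone -(kNone n) Ea.
case Eb : (k n.+1 v) => [b|]; last first.
  by move/eqP: Eb; rewrite kNone -(kNone n) Ea.
have [/existsP[s /existsP[j ls]]|lS] := boolP
    [exists s, exists j : 'I_m, l (vert (v, s) j.+1) == None].
  congr (modn _ _); apply: (nfull_update_far (v := v)) => // x i fx.
  apply/negP => /eqP vx; case/orP: fx => fx.
    by have := H _ (kP n) x i s j fx; rewrite vx ls.
  by have := H _ (kP n.+1) x i s j fx; rewrite vx ls.
apply: (nfull_update (v := v) (a := a) (b := b)) => // s j.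
by rewrite kNone; move/existsPn: lS => /(_ s) /existsPn /(_ j).
Qed.
End Simplices.

From mathcomp Require Import all_classical all_reals all_analysis.
From mathcomp Require Import complex spectral sesquilinear.

Import numFieldNormedType.Exports.

Local Open Scope classical_set_scope.
Local Open Scope ring_scope.

(** * The maximum norm of column vectors *)

Section ColNorm.
Context {R : realType} {n : nat}.
Implicit Types x y : 'cV[R]_n.

Lemma cnorm_le x a : 0 <= a -> (forall i, `|x i 0| <= a) -> `|x| <= a.
Proof.
move=> a0 H; rewrite /Num.norm/= mx_normrE; apply/bigmax_leP; split=> // -[i j] _ /=.
by rewrite ord1.
Qed.

Lemma cnorm_lt x a : 0 < a -> (forall i, `|x i 0| < a) -> `|x| < a.
Proof.
move=> a0 H; rewrite /Num.norm/= mx_normrE; apply/bigmax_ltP; split=> // -[i j] _ /=.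
by rewrite ord1.
Qed.

Lemma cnorm_ge x i : `|x i 0| <= `|x|.
Proof. by rewrite [leRHS]/Num.norm/= mx_normrE; apply: (le_bigmax _ _ (i, ord0)). Qed.

End ColNorm.

(** * A cubical grid on the torus and its triangulation *)

Section Grid.
Context {R : realType}.
Variables (m c : nat) (h : R).
Local Notation G := 'cV['I_(c.*2).+1]_m.

Definition pt (v : G) : 'cV[R]_m := \col_i (h * ((v i 0 : nat)%:R - c%:R)).

Lemma ptE v i : pt v i 0 = h * ((v i 0 : nat)%:R - c%:R).
Proof. by rewrite mxE. Qed.

(* Steps on the torus (Z/(2c+1))^m, centred at [c] by [pt].  On a torus the
   triangulation has no boundary; labels are left undefined outside a compact
   set that does not reach around it. *)
Definition gdir (i : 'I_m.+1) : G :=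
  \col_k (inZp 1 *+ (i == k :> nat) - inZp 1 *+ (i == m :> nat)).

Lemma sum_pick (W : zmodType) (a : W) (s : 'S_m.+1) (P : pred 'I_m.+1) t :
  \sum_(i | P i) a *+ (s i == t) = a *+ P ((s^-1)%g t).
Proof.
rewrite big_mkcond (bigD1 ((s^-1)%g t)) //= permKV eqxx big1 ?addr0.
  by case: (P _).
move=> i it; case: ifP => // _; suff -> : (s i == t) = false by [].
by apply: contraNF it => /eqP <-; rewrite permK.
Qed.

Lemma sum_gdirE (s : 'S_m.+1) (P : pred 'I_m.+1) (k : 'I_m) :
  (\sum_(i | P i) gdir (s i)) k 0 =
  inZp 1 *+ P ((s^-1)%g (widen_ord (leqnSn m) k)) - inZp 1 *+ P ((s^-1)%g ord_max).
Proof.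
rewrite summxE; under eq_bigr do rewrite mxE.
by rewrite sumrB -!sum_pick; congr (_ - _).
Qed.

Lemma sum_gdir : \sum_i gdir i = 0.
Proof.
apply/colP => k; rewrite mxE.
have := sum_gdirE 1%g xpredT k; rewrite subrr => <-.
by congr (fun_of_matrix _ k 0); apply: eq_bigr => i _; rewrite perm1.
Qed.

Hypothesis c0 : (0 < c)%N.

Lemma inZp1_neq0 : inZp 1 != 0 :> 'I_(c.*2).+1.
Proof. by rewrite -val_eqE /= modn_small // ltnS -addnn addn_gt0 c0. Qed.

(** A proper nonempty part of the steps does not close up. If the diagonal step [ord_max] is not
    among them, coordinate [s ord0] is raised by one; if it is, the coordinate of the last step, not
    yet taken, is lowered by one. *)
Lemma vert_gdir_neq (v : G) s (j : 'I_m) : vert gdir (v, s) j.+1 != v.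
Proof.
rewrite /vert /= -subr_eq0 addrC addKr; apply/negP => /eqP /colP H.
have {}H k : (\sum_(i < m.+1 | (i < j.+1)%N) gdir (s i)) k 0 = 0 by rewrite H mxE.
have [maxj|maxj] := leqP (((s^-1)%g ord_max : 'I__) : nat) j; last first.
  have s0 : s ord0 != ord_max.
    by apply/negP => /eqP E; move: maxj; rewrite -E permK.
  have s0m : (s ord0 < m)%N.
    rewrite ltn_neqAle -ltnS ltn_ord andbT.
    by apply: contra s0 => /eqP E; apply/eqP/val_inj.
  have := H (Ordinal s0m); rewrite (sum_gdirE _ (fun i => (i < j.+1)%N)) ltnS.
  have -> : widen_ord (leqnSn m) (Ordinal s0m) = s ord0 by apply: val_inj.
  rewrite permK /= ltnS leqNgt maxj subr0 => /eqP.
  by rewrite (negbTE inZp1_neq0).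
have sj : s ord_max != ord_max.
  apply/negP => /eqP E; move: maxj; rewrite -{1}E permK /= => mj.
  by have := ltn_ord j; rewrite ltnNge mj.
have sjm : (s ord_max < m)%N.
  rewrite ltn_neqAle -ltnS ltn_ord andbT.
  by apply: contra sj => /eqP E; apply/eqP/val_inj.
have := H (Ordinal sjm); rewrite (sum_gdirE _ (fun i => (i < j.+1)%N)) ltnS.
have -> : widen_ord (leqnSn m) (Ordinal sjm) = s ord_max by apply: val_inj.
rewrite permK /= !ltnS maxj leqNgt ltn_ord /= sub0r => /eqP.
by rewrite oppr_eq0 (negbTE inZp1_neq0).
Qed.

(** Points from which a step of one in any coordinate, in either direction, does not wrap around the
    torus. *)
Definition inner (v : G) := forall k, (0 < v k 0%R < c.*2)%N.

(** The diagonal step is counted on the left-hand side, so that no truncated subtraction of naturals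
    occurs. *)
Lemma vert_coord (v : G) (s : 'S_m.+1) j (k : 'I_m) : inner v ->
  (vert gdir (v, s) j k 0%R + ((s^-1)%g ord_max < j) =
   v k 0%R + ((s^-1)%g (widen_ord (leqnSn m) k) < j))%N.
Proof.
move=> /(_ k) /andP[v0 vc].
rewrite /vert mxE (sum_gdirE _ (fun i => (i < j)%N)).
have E1 : (1 %% c.*2.+1 = 1)%N by rewrite modn_small // ltnS; lia.
case: (_ < j)%N; case: (_ < j)%N; rewrite ?subrr ?addr0 ?subr0 //= ?sub0r /= !E1.
  by rewrite modn_small; lia.
rewrite subn1 /= add0n modn_mod [(c.*2 %% _)%N]modn_small //.
by rewrite -{1}(prednK v0) addSnnS modnDr modn_small; lia.
Qed.

Lemma pt_vert_near (v : G) s j : 0 < h -> inner v ->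
  `|pt (vert gdir (v, s) j) - pt v| <= h.
Proof.
move=> h0 iv; apply: cnorm_le => [|k]; first exact: ltW.
rewrite mxE [X in _ + X]mxE !ptE; have := vert_coord s j k iv.
move: (nat_of_ord (vert gdir (v, s) j k 0)) (nat_of_ord (v k 0)) => a b.
move: (_ < j)%N (_ < j)%N => p q /(congr1 (fun n => n%:R : R)).
rewrite !natrD => E.
have {E}-> : a%:R = b%:R + p%:R - q%:R :> R by rewrite -E addrK.
have -> : h * (b%:R + p%:R - q%:R - c%:R) - h * (b%:R - c%:R) = h * (p%:R - q%:R).
  by ring.
rewrite normrM gtr0_norm //.
case: p => /=; case: q => /=; rewrite ?subrr ?normr0 ?mulr0 ?(ltW h0) //.
  by rewrite subr0 normr1 mulr1.
by rewrite sub0r normrN1 mulr1.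
Qed.

Lemma pt_inner (v : G) : 0 < h -> `|pt v| < h * c%:R -> inner v.
Proof.
move=> h0 vh k; have := le_lt_trans (cnorm_ge (pt v) k) vh.
rewrite mxE normrM gtr0_norm // ltr_pM2l // => H.
have := ltn_ord (v k 0); move: (nat_of_ord _) H => a + _.
rewrite ltr_norml ltrBrDr addNr ltrBlDr -natrD -addnn !ltr_nat ltr0n.
by rewrite addnn => /andP[-> ->].
Qed.

End Grid.

(** * The degree modulo 2 of a map on a compact set *)

Section Label.
Context {R : realType} {m : nat}.
Implicit Types (z : 'cV[R]_m) (K : set 'cV[R]_m) (g : 'cV[R]_m -> 'cV[R]_m).

(** Index of the first nonpositive coordinate, or m when all are positive, [find] returning the
    length on failure. A family of points that carries all labels thus has, in every coordinate,
    both a nonpositive and a positive value. *)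
Definition lab z : 'I_m.+1 := inord (find (fun i => z i 0 <= 0) (enum 'I_m)).

Lemma labE z : lab z = find (fun i => z i 0 <= 0) (enum 'I_m) :> nat.
Proof. by rewrite inordK // ltnS -[X in (_ <= X)%N]size_enum_ord find_size. Qed.

Lemma lab_le0 z (i : 'I_m) : lab z = i :> nat -> z i 0 <= 0.
Proof.
rewrite labE => E.
have h : has (fun i => z i 0 <= 0) (enum 'I_m).
  by rewrite has_find E size_enum_ord.
by have := nth_find i h; rewrite E nth_ord_enum.
Qed.

Lemma lab_gt0 z (i : 'I_m) : (i < lab z)%N -> 0 < z i 0.
Proof.
rewrite labE => E; have := before_find i E.
by rewrite nth_ord_enum ltNge => ->.
Qed.

Lemma lab_eq z z' : (forall i, (z i 0 <= 0) = (z' i 0 <= 0)) -> lab z = lab z'.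
Proof. by move=> E; rewrite /lab; congr inord; apply: eq_find. Qed.

Variables (c : nat) (h : R).
Local Notation G := 'cV['I_(c.*2).+1]_m.

Definition glab K g (v : G) : option 'I_m.+1 :=
  if `[< K (pt h v) >] then Some (lab (g (pt h v))) else None.

Definition gdeg K g := nfull (gdir (m:=m) c) (glab K g).

Hypotheses (c0 : (0 < c)%N) (h0 : 0 < h).

(** In coordinate [d] the vertex labelled [d] has a nonpositive value and the vertex labelled m a
    positive one, and all values lie within [eta] of each other. The Boolean index lets each label
    come from either of two maps, as happens along a relabelling. *)
Lemma full_small K (g : bool -> 'cV[R]_m -> 'cV[R]_m) (eta : R)
    (k : G -> option 'I_m.+1) x :
  (forall x, K x -> `|x| < h * c%:R) ->
  (forall x y s t, K x -> K y -> `|x - y| <= h * 2 -> `|g s x - g t y| <= eta) ->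
  (forall v, k v = glab K (g true) v \/ k v = glab K (g false) v) ->
  full (gdir (m:=m) c) k x ->
  forall i : 'I_m.+1, K (pt h (vert (gdir (m:=m) c) x i)) /\
    forall s, `|g s (pt h (vert (gdir (m:=m) c) x i))| <= eta.
Proof.
move=> Kb gK kg fx.
pose w i := pt h (vert (gdir (m:=m) c) x i).
have Kw (i : 'I_m.+1) : K (w i).
  have := full_Some i fx; rewrite /w.
  by case: (kg (vert (gdir c) x i)) => ->; rewrite /glab; case: asboolP.
have near (i : 'I_m.+1) : `|w i - w 0%N| <= h.
  have := pt_inner h0 (Kb _ (Kw ord0)); rewrite vert0 => iv.
  by have := pt_vert_near c0 x.2 i h0 iv; rewrite /w vert0; case: (x).
have dist (i j : 'I_m.+1) : `|w i - w j| <= h * 2.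
  have -> : w i - w j = (w i - w 0%N) - (w j - w 0%N) by rewrite opprB addrA subrK.
  by apply: le_trans (ler_normB _ _) _; rewrite mulr_natr mulr2n lerD.
have labs (d : 'I_m.+1) : exists (i : 'I_m.+1) (s : bool), lab (g s (w i)) = d.
  move/forallP: fx => /(_ d) /existsP[i /eqP E].
  case: (kg (vert (gdir (m:=m) c) x i)) => E'; move: E; rewrite E' /glab.
    by case: ifP => // _ [E]; exists i, true.
  by case: ifP => // _ [E]; exists i, false.
have eta0 : 0 <= eta.
  apply: le_trans (normr_ge0 _) (gK (w 0%N) (w 0%N) true true _ _ _) => //;
    rewrite ?subrr ?normr0; by [exact: (Kw ord0)|apply: mulr_ge0 => //; exact: ltW].
move=> i; split=> [|s]; first exact: Kw.
apply: cnorm_le => // d; rewrite ler_norml.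
have [i1 [s1 E1]] := labs (widen_ord (leqnSn m) d).
have [i2 [s2 E2]] := labs ord_max.
have p2 : 0 < g s2 (w i2) d 0 by apply: lab_gt0; rewrite E2 /=.
have p1 : g s1 (w i1) d 0 <= 0 by apply: lab_le0; rewrite E1.
have := le_trans (cnorm_ge _ d) (gK _ _ s s1 (Kw i) (Kw i1) (dist i i1)).
have := le_trans (cnorm_ge _ d) (gK _ _ s s2 (Kw i) (Kw i2) (dist i i2)).
rewrite !mxE !ler_norml -/(w i) => /andP[a1 a2] /andP[b1 b2].
by apply/andP; split; lra.
Qed.

(** A simplex that is full for mixed labels has values at most [eta] by [full_small]; the last
    hypothesis then puts the links of its vertices inside [K], as [nfull_relabel] requires. *)
Lemma gdeg_homotopy K (g : bool -> 'cV[R]_m -> 'cV[R]_m) (eta : R) :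
  (forall x, K x -> `|x| < h * c%:R) ->
  (forall x y s t, K x -> K y -> `|x - y| <= h * 2 -> `|g s x - g t y| <= eta) ->
  (forall s x y, K x -> `|g s x| <= eta -> `|y - x| <= h -> K y) ->
  gdeg K (g true) = gdeg K (g false) %[mod m.+1 * 2].
Proof.
move=> Kb gK deep; apply: nfull_relabel.
- exact: sum_gdir.
- by move=> v s j; apply: vert_gdir_neq.
- by move=> v; rewrite /glab; case: asboolP.
move=> k kg x i s j fx; have [Kx gx] := full_small Kb gK kg fx i.
rewrite /glab; case: asboolP => // nK; exfalso; apply: nK.
apply: deep (gx true) _ => //.
exact: (pt_vert_near c0 s j.+1 h0 (pt_inner h0 (Kb _ Kx))).
Qed.

(** For either domain, the vertices of a full simplex have small values and hence lie in [K'], where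
    the two labellings agree. *)
Lemma gdeg_excision K K' g (eta : R) :
  K' `<=` K -> (forall x, K x -> `|x| < h * c%:R) ->
  (forall x y, K x -> K y -> `|x - y| <= h * 2 -> `|g x - g y| <= eta) ->
  (forall x, K x -> `|g x| <= eta -> K' x) ->
  gdeg K g = gdeg K' g.
Proof.
move=> sub Kb gK deep; apply: eq_card => x; rewrite !inE.
have same (k : G -> _) : k = glab K g \/ k = glab K' g ->
    full (gdir (m:=m) c) k x ->
    forall i : 'I_m.+1, K' (pt h (vert (gdir (m:=m) c) x i)).
  move=> [] -> fx i.
    have [Kx gx] := full_small (g := fun=> g) Kb (fun x y _ _ => @gK x y) (fun=> or_introl erefl) fx i.
    exact: deep (gx true).
  by have := full_Some i fx; rewrite /glab; case: asboolP.
have glE v : K' (pt h v) -> glab K g v = glab K' g v.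
  by move=> Kv; rewrite /glab !asboolT //; apply: sub.
apply/idP/idP => fx; apply/forallP => d; move/forallP: (fx) => /(_ d) /existsP[i E];
  apply/existsP; exists i; move: E; rewrite glE //.
  by apply: (same _ _ fx); left.
by apply: (same _ _ fx); right.
Qed.

Lemma gdeg_neq0 K g (eta : R) :
  (forall x, K x -> `|x| < h * c%:R) ->
  (forall x y, K x -> K y -> `|x - y| <= h * 2 -> `|g x - g y| <= eta) ->
  gdeg K g != 0%N -> exists2 x, K x & `|g x| <= eta.
Proof.
move=> Kb gK; rewrite -lt0n => /card_gt0P[x]; rewrite inE => fx.
have [Kx gx] := full_small (g := fun=> g) Kb (fun x y _ _ => @gK x y) (fun=> or_introl erefl) fx ord0.
by eexists; [exact: Kx|exact: (gx true)].
Qed.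

End Label.

(** * The only full simplex of the identity map *)

Section IdDegree.
Context {R : realType} {m : nat}.
Variables (c : nat) (h : R) (K : set 'cV[R]_m).
Hypotheses (c1 : (1 < c)%N) (h0 : 0 < h).
Hypothesis K_near : forall x : 'cV[R]_m, `|x| <= h -> K x.
Hypothesis K_far : forall x : 'cV[R]_m, K x -> `|x| < h * c%:R.
Local Notation G := 'cV['I_(c.*2).+1]_m.
Local Notation vertex := (vert (gdir (m:=m) c)).
Local Notation lb := (glab (c:=c) h K id).

Let c0 : (0 < c)%N. Proof. exact: ltnW. Qed.

Lemma lab_first (z : 'cV[R]_m) (k : 'I_m) :
  (forall i : 'I_m, (i < k)%N -> 0 < z i 0) -> z k 0 <= 0 -> lab z = k :> nat.
Proof.
move=> zi zk; have [lk|kl|//] := ltngtP (lab z) k; last first.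
  by move: (lab_gt0 kl); rewrite ltNge zk.
have lm : (lab z < m)%N by apply: ltn_trans (ltn_ord k).
have := @lab_le0 _ _ z (Ordinal lm) erefl.
by rewrite leNgt zi.
Qed.

Lemma lab_last (z : 'cV[R]_m) : (forall i : 'I_m, 0 < z i 0) -> lab z = m :> nat.
Proof.
move=> zi; apply/eqP; rewrite eqn_leq -ltnS ltn_ord /= leqNgt; apply/negP => lm.
by have := @lab_le0 _ _ z (Ordinal lm) erefl; rewrite leNgt zi.
Qed.

Lemma pt_gt0 (v : G) i : (0 < pt h v i 0) = (c < v i 0%R)%N.
Proof. by rewrite ptE pmulr_rgt0 // subr_gt0 ltr_nat. Qed.

Lemma pt_le0 (v : G) i : (pt h v i 0 <= 0) = (v i 0%R <= c)%N.
Proof. by rewrite leNgt pt_gt0 [RHS]leqNgt. Qed.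

(** The grid point with all coordinates equal to [h]; in a full simplex of the identity it is the
    vertex labelled m. *)
Definition vone : G := \col_i inord c.+1.

Lemma voneE i : vone i 0 = c.+1 :> nat.
Proof. by rewrite mxE inordK // !ltnS -addnn; lia. Qed.

Lemma inner_vone : inner vone.
Proof. by move=> i; rewrite voneE -addnn; lia. Qed.

Lemma glab_Some v d : lb v = Some d -> lab (pt h v) = d /\ K (pt h v).
Proof. by rewrite /glab; case: asboolP => // Kv [<-]. Qed.

(** Label m makes every coordinate of the base exceed [c], while the vertex labelled [i] has
    coordinate [i] at most [c]; the two differ by at most one, which leaves [c.+1]. *)
Lemma full_base x : full (gdir (m:=m) c) lb x -> lb x.1 = Some ord_max -> x.1 = vone.
Proof.
case: x => v s fx /glab_Some /= [lv Kv]; have iv := pt_inner h0 (K_far Kv).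
apply/colP => i; apply: val_inj; rewrite /= voneE.
have vi : (c < v i 0%R)%N by rewrite -pt_gt0; apply: lab_gt0; rewrite lv /=.
move/forallP: fx => /(_ (widen_ord (leqnSn m) i)) /existsP[j /eqP].
move=> /glab_Some[lj _].
have := lab_le0 (congr1 val lj); rewrite pt_le0.
have := vert_coord c0 s j i iv.
move: vi; move: (nat_of_ord (v i 0)) (nat_of_ord (vertex (v, s) j i 0)) => a b.
by move: (_ < j)%N (_ < j)%N => [] []; lia.
Qed.

Lemma full_has_vone x : full (gdir (m:=m) c) lb x ->
  exists j : 'I_m.+1, vertex x j == vone.
Proof.
move=> fx; move/forallP: (fx) => /(_ ord_max) /existsP[i /eqP li].
exists i; apply/eqP.
have E : vertex (iter i (turn (gdir (m:=m) c)) x) 0 = vertex x i.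
  by rewrite vert_iter_turn ?addn0 // ltnW.
rewrite -E vert0; apply: full_base; first by rewrite full_iter_turn ?sum_gdir.
by rewrite -(vert0 (gdir c)) E.
Qed.

Lemma vone_coord s j i :
  (vertex (vone, s) j i 0%R <= c)%N =
  ((s^-1)%g ord_max < j)%N && ~~ ((s^-1)%g (widen_ord (leqnSn m) i) < j)%N.
Proof.
have := vert_coord c0 s j i inner_vone; rewrite voneE.
by case: (_ < j)%N; case: (_ < j)%N => /=; lia.
Qed.

(** Distinct labels force the path from [vone]. The diagonal step comes first, since otherwise the
    next vertex would still have label m. Then the coordinates are restored in increasing order: if
    coordinate [i] were restored any later, two consecutive vertices would both have label [i]. *)
Lemma full_vone_perm s : full (gdir (m:=m) c) lb (vone, s) ->
  s = perm (can_inj (@ord_predK m.+1)).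
Proof.
move=> fx; have inj := full_inj fx.
have labinj (i j : 'I_m.+1) :
    lab (pt h (vertex (vone, s) i)) = lab (pt h (vertex (vone, s) j)) -> i = j.
  move=> E; apply: inj; rewrite /=.
  have := full_Some i fx; have := full_Some j fx; rewrite /glab.
  by case: asboolP => // _ _; case: asboolP => // _ _; rewrite E.
have max0 : (s^-1)%g ord_max = ord0.
  case: (unliftP ord0 ((s^-1)%g ord_max)) => // j sj; exfalso.
  have m1 : (1 < m.+1)%N by rewrite ltnS; case: (m) j {sj} => // -[].
  suff : Ordinal m1 = ord0 by move/(congr1 val).
  apply: labinj; apply: val_inj; rewrite /= [LHS]lab_last ?[RHS]lab_last // => i;
    by rewrite pt_gt0 ltnNge vone_coord sj.
have key k : forall i : 'I_m, (i <= k)%N ->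
    (s^-1)%g (widen_ord (leqnSn m) i) = i.+1 :> nat.
  elim/ltn_ind: k => k IHk i ik.
  have IH (i' : 'I_m) : (i' < i)%N ->
      (s^-1)%g (widen_ord (leqnSn m) i') = i'.+1 :> nat.
    by move=> i'i; apply: (IHk i') => //; apply: leq_trans ik.
  have si : (i < (s^-1)%g (widen_ord (leqnSn m) i))%N.
    rewrite ltnNge; apply/negP => le.
    have [e0|e0] := posnP (nat_of_ord ((s^-1)%g (widen_ord (leqnSn m) i))).
      have : (s^-1)%g (widen_ord (leqnSn m) i) = (s^-1)%g ord_max.
        by rewrite max0; apply: val_inj.
      move=> /perm_inj /(congr1 val) /= im.
      by have := ltn_ord i; rewrite im ltnn.
    set p := nat_of_ord _ in le e0.
    have pm : (p.-1 < m)%N by have := ltn_ord i; lia.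
    have := IH (Ordinal pm); rewrite /= prednK // => /(_ le) E.
    have /perm_inj /(congr1 val) /= : (s^-1)%g (widen_ord (leqnSn m) (Ordinal pm)) =
        (s^-1)%g (widen_ord (leqnSn m) i) by apply: val_inj.
    by lia.
  have labi (j : nat) : (i < j)%N -> (j <= (s^-1)%g (widen_ord (leqnSn m) i))%N ->
      lab (pt h (vertex (vone, s) j)) = i :> nat.
    move=> ij js; apply: lab_first => [i' i'i|].
      rewrite pt_gt0 ltnNge vone_coord max0 IH //.
      by rewrite (leq_ltn_trans i'i ij) andbF.
    by rewrite pt_le0 vone_coord max0 -leqNgt js andbT; apply: leq_ltn_trans ij.
  apply/eqP; rewrite eqn_leq si andbT leqNgt; apply/negP => lt.
  have i2 : (i.+2 < m.+1)%N by apply: leq_ltn_trans lt _.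
  have i1 : (i.+1 < m.+1)%N by apply: ltnW.
  suff : Ordinal i1 = Ordinal i2 by move/(congr1 val) => /=; lia.
  by apply: labinj; apply: val_inj; rewrite /= !labi // ltnW.
apply/permP => j; rewrite permE; apply: (can_inj (permK s^-1)%g).
rewrite permK; case: (unliftP ord_max (ord_pred j)) => [i|] E; rewrite E.
  have -> : lift ord_max i = widen_ord (leqnSn m) i.
    by apply: val_inj; rewrite /= /bump leqNgt ltn_ord.
  apply: ord_inj; rewrite (key i) //.
  rewrite -[j]ord_predK E /= /bump leqNgt ltn_ord add0n modn_small //.
  by rewrite ltnS ltn_ord.
by rewrite max0 -[j]ord_predK E; apply: val_inj; rewrite /= modnn.
Qed.

Lemma full_vone_std : full (gdir (m:=m) c) lb (vone, perm (can_inj (@ord_predK m.+1))).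
Proof.
set s := perm _.
have sV (i : 'I_m.+1) : (s^-1)%g i = ordS i.
  by apply: (can_inj (permK s)); rewrite permKV permE ordSK.
have sVm : (s^-1)%g ord_max = ord0 by rewrite sV; apply: val_inj; rewrite /= modnn.
have sVw (i : 'I_m) : (s^-1)%g (widen_ord (leqnSn m) i) = i.+1 :> nat.
  by rewrite sV /= modn_small // ltnS ltn_ord.
have KP (j : nat) : K (pt h (vertex (vone, s) j)).
  apply: K_near; apply: cnorm_le => [|i]; first exact: ltW.
  have := vert_coord c0 s j i inner_vone; rewrite voneE ptE normrM gtr0_norm //.
  rewrite sVm sVw ger_pMr //; move: (nat_of_ord (vertex (vone, s) j i 0)) => a E.
  have [->|->] : a = c \/ a = c.+1.
    by case: j E => [|j] /=; [lia|case: (_ < _)%N; lia].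
    by rewrite subrr normr0.
  by rewrite -natr1 addrC addKr normr1.
apply/forallP => d; apply/existsP.
case: (unliftP ord_max d) => [i ->|->].
  exists (lift ord0 i); rewrite /glab asboolT //; apply/eqP; congr Some.
  apply: val_inj; rewrite lift0 /= [RHS]/bump leqNgt ltn_ord add0n.
  apply: lab_first => [i' i'i|].
    by rewrite pt_gt0 ltnNge vone_coord sVm sVw !ltnS i'i.
  by rewrite pt_le0 vone_coord sVm sVw !ltnS ltnn.
exists ord0; rewrite /glab asboolT //; apply/eqP; congr Some.
by apply: val_inj; apply: lab_last => i; rewrite pt_gt0 ltnNge vone_coord.
Qed.

(** One simplex, listed once for each of its m.+1 bases. *)
Lemma gdeg_id : gdeg c h K id = m.+1.
Proof.
rewrite /gdeg (nfull_split _ _ vone) ?sum_gdir //.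
rewrite [X in (_ + X)%N]eq_card0 ?addn0; last first.
  move=> x; rewrite inE; apply/negP => /andP[/full_has_vone[j vj] /existsPn /(_ j)].
  by rewrite vj.
rewrite (_ : [set x | _ & _] = [set (vone, perm (can_inj (@ord_predK m.+1)))])%SET.
  by rewrite cards1 muln1.
apply/setP => -[v s]; rewrite !inE xpair_eqE; apply/andP/andP.
  by move=> [fx /eqP /= vE]; rewrite vE eqxx; split=> //; apply/eqP/full_vone_perm; rewrite -vE.
by move=> [/eqP -> /eqP ->]; split=> //; apply: full_vone_std.
Qed.

End IdDegree.

(** * Uniform estimates on compact sets *)

Section Cover.
Context {R : realType} {V : normedModType R}.

Lemma ball_distE (x y : V) e : ball x e y <-> `|y - x| < e.
Proof. by rewrite -ball_normE /= distrC. Qed.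

Lemma near_dist (x : V) e (P : V -> Prop) : 0 < e ->
  (forall y, `|y - x| < e -> P y) -> \forall y \near x, P y.
Proof.
by move=> e0 H; apply: filterS (nbhsx_ballx x e e0) => y /ball_distE; exact: H.
Qed.

(** The common source of the uniform estimates: a property monotone in a scale [e], valid locally in
    [x] and eventually in [p], holds with one scale on all of [K]. The scale is treated as a further
    parameter tending to 0+, so that near-covering compactness applies to a product filter. *)
Lemma compact_cover_eps (K : set V) (P : Type) (F : set_system P)
    (Q : R -> P -> V -> Prop) : Filter F -> compact K ->
  (forall e e' p x, e' <= e -> Q e p x -> Q e' p x) ->
  (forall x, K x -> exists e, 0 < e /\
     \forall p \near F, forall x', K x' -> `|x' - x| < e -> Q e p x') ->
  exists2 e, 0 < e & \forall p \near F, forall x, K x -> Q e p x.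
Proof.
move=> FF /compact_near_coveringP /near_covering_withinP cK mono H.
have := cK _ (filter_prod (0:R)^'+ F) (fun i x => Q i.1 i.2 x) _.
case.
  move=> x Kx; have [e [e0 He]] := H x Kx.
  exists (ball x e, [set i | i.1 <= e /\
      forall x', K x' -> `|x' - x| < e -> Q e i.2 x']).
    split => /=; first exact: nbhsx_ballx.
    exists ([set r | r <= e], [set p | forall x', K x' -> `|x' - x| < e -> Q e p x']).
      split => //=; exact: nbhs_right_le.
    by move=> [r p] /= [].
  move=> [x' [r p]] /= [bx [re Qp]] Kx'; apply: mono re _.
  by apply: Qp => //; apply/ball_distE.
move=> [A B] /= [A0 FB] AB.
have [e [Ae e0]] : exists e, A e /\ 0 < e.
  near (0:R)^'+ => e; exists e; split; first by near: e.
  by near: e; apply: nbhs_right_gt.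
exists e => //; apply: filterS FB => p Bp x Kx.
exact: (AB (e, p) (conj Ae Bp) x Kx).
Unshelve. all: by end_near. Qed.

Lemma compact_uniform (K : set V) (Q : R -> V -> Prop) : compact K ->
  (forall e e' x, e' <= e -> Q e x -> Q e' x) ->
  (forall x, K x -> exists2 e, 0 < e &
     forall x', K x' -> `|x' - x| < e -> Q e x') ->
  exists2 e, 0 < e & forall x, K x -> Q e x.
Proof.
move=> cK mono H.
have [|e e0 He] := @compact_cover_eps K unit (globally setT) (fun e _ => Q e) _ cK
  (fun e e' _ => @mono e e').
  by move=> x /H [e e0 He]; exists e; split=> // p _; apply: He.
by exists e => //; apply: (He tt).
Qed.

End Cover.

Section ContOn.
Context {R : realType} {V W : normedModType R}.

Definition cont_on (K : set V) (g : V -> W) := forall x, K x ->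
  forall e : R, 0 < e ->
  exists2 d, 0 < d & forall x', K x' -> `|x' - x| < d -> `|g x' - g x| < e.

Lemma cont_onP K g : {within K, continuous g} <-> cont_on K g.
Proof.
rewrite subspace_continuousP; split=> H x Kx.
  move=> e e0; have /cvgrPdist_lt /(_ e e0) := H x Kx.
  rewrite near_withinE => /nbhs_ballP[d /= d0 dP].
  by exists d => // y Ky yx; rewrite distrC; apply: dP => //; apply/ball_distE.
apply/cvgrPdist_lt => e e0; rewrite near_withinE.
have [d d0 dP] := H x Kx e e0.
by apply: (near_dist d0) => y yx Ky; rewrite distrC; exact: dP.
Qed.

End ContOn.

(** * Parity of the zero count for all fine grids *)

Section OddDegree.
Context {R : realType} {m : nat}.
Local Notation E := 'cV[R]_m.
Implicit Types (K : set E) (g : E -> E).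

(** [gdeg] lists every simplex m.+1 times, so oddness is non-divisibility by [m.+1 * 2]. Instead of
    a limit over grids, it is required for every mesh below [h0] and every grid whose half-width
    [h * c] exceeds [M]. *)
Definition odd_degree K g := exists h0 M : R, 0 < h0 /\
  forall (c : nat) (h : R), 0 < h -> h < h0 -> (1 < c)%N -> M < h * c%:R ->
    ~~ (m.+1 * 2 %| gdeg c h K g)%N.

Lemma compact_norm_le K : compact K -> exists M : R, forall x, K x -> `|x| <= M.
Proof.
by move=> /compact_bounded [M [_ KM]]; exists (M + 1) => x Kx; apply: KM => //; rewrite ltrDl.
Qed.

Lemma cont_on_unif K g e : compact K -> cont_on K g -> 0 < e ->
  exists2 d, 0 < d & forall x y, K x -> K y -> `|x - y| <= d -> `|g x - g y| <= e.
Proof.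
move=> cK gK e0.
suff [d d0 Hd] : exists2 d : R, 0 < d & forall x, K x -> forall y, K y ->
    `|x - y| <= d -> `|g x - g y| <= e by exists d => // x y Kx Ky; apply: Hd.
apply: compact_uniform => // [d d' x dd' Q y Ky xy|x Kx].
  by apply: Q => //; apply: le_trans dd'.
have e20 : 0 < e / 2 by rewrite divr_gt0.
have [d d0 gd] := gK x Kx _ e20.
exists (d / 2); first by rewrite divr_gt0.
move=> x' Kx' x'x y Ky x'y.
have H1 : `|g y - g x| < e / 2.
  apply: gd => //; have -> : y - x = (x' - x) - (x' - y) by rewrite opprB [RHS]addrC addrA subrK.
  by apply: le_lt_trans (ler_normB _ _) _; lra.
have H2 : `|g x' - g x| < e / 2 by apply: gd => //; lra.
have -> : g x' - g y = (g x' - g x) - (g y - g x) by rewrite opprB addrA subrK.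
by apply: le_trans (ler_normB _ _) _; lra.
Qed.

Lemma odd_degree_congr K K' g g' :
  (exists h0 M : R, 0 < h0 /\
  forall (c : nat) (h : R), 0 < h -> h < h0 -> (1 < c)%N -> M < h * c%:R ->
    gdeg c h K g = gdeg c h K' g' %[mod m.+1 * 2]) ->
  odd_degree K g -> odd_degree K' g'.
Proof.
move=> [h0 [M [h00 H]]] [h1 [M' [h10 H']]].
exists (Num.min h0 h1), (Num.max M M'); split; first by rewrite lt_min h00.
move=> c h hp; rewrite lt_min gt_max => /andP[hh0 hh1] c1 /andP[Mh M'h].
rewrite /dvdn -H //; exact: H'.
Qed.

(** Homotopy invariance in local form. The scale [e] keeps points with small values, for either map,
    away from the boundary of [K]; [e'] is a joint modulus of continuity for both maps. Together
    they bound the mesh for [gdeg_homotopy]. *)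
Lemma odd_degree_near K (P : Type) (F : set_system P) (H : P -> E -> E) g :
  Filter F -> compact K -> cont_on K g ->
  (forall x, K x -> forall e, 0 < e -> exists2 d, 0 < d &
    \forall p \near F, forall x', K x' -> `|x' - x| < d -> `|H p x' - g x| < e) ->
  (forall x, K x -> g x = 0 -> nbhs x K) ->
  \forall p \near F, odd_degree K (H p) <-> odd_degree K g.
Proof.
move=> FF cK gK HK zero.
have [e e0 He] : exists2 e : R, 0 < e & \forall p \near F, forall x, K x ->
    (`|H p x| <= e \/ `|g x| <= e) -> forall y, `|y - x| <= e -> K y.
  apply: compact_cover_eps => // [e e' p x ee' Q Qe' y yx|x Kx].
    by apply: (Q _ _ (le_trans yx ee')); case: Qe' => ?; [left|right]; apply: le_trans ee'.
  have [gx0|gx0] := eqVneq (g x) 0.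
    have /nbhs_ballP[d /= d0 dK] := zero x Kx gx0.
    exists (d / 2); split; first by rewrite divr_gt0.
    apply: nearW => p x' Kx' x'x _ y yx'; apply: dK.
    apply/ball_distE; have -> : y - x = (y - x') + (x' - x) by rewrite addrA subrK.
    by apply: le_lt_trans (ler_normD _ _) _; lra.
  have a0 : 0 < `|g x| / 2 by rewrite divr_gt0 ?normr_gt0.
  have [d d0 Hd] := HK x Kx _ a0; have [d' d'0 gd'] := gK x Kx _ a0.
  exists (Num.min (Num.min d d') (`|g x| / 4)); split.
    by rewrite !lt_min d0 d'0 /= divr_gt0 // normr_gt0.
  apply: filterS Hd => p Hd x' Kx'; rewrite !lt_min => /andP[/andP[xd xd'] _].
  rewrite !le_min => Qe; exfalso.
  have big z : `|z - g x| < `|g x| / 2 -> `|z| <= `|g x| / 4 -> False.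
    move=> z1 z2; have : `|g x| <= `|g x - z| + `|z| by rewrite -{1}(subrK z (g x)) ler_normD.
    rewrite distrC; move: a0; lra.
  by case: Qe => /andP[_]; apply: big; [exact: Hd|exact: gd'].
have [e' e'0 He'] : exists2 e' : R, 0 < e' & \forall p \near F, forall x, K x ->
    forall y, K y -> `|x - y| <= e' -> forall s t : bool,
    `|(if s then H p else g) x - (if t then H p else g) y| <= e.
  apply: compact_cover_eps => // [d d' p x dd' Q y Ky xy|x Kx].
    by apply: Q => //; apply: le_trans dd'.
  have e20 : 0 < e / 2 by rewrite divr_gt0.
  have [d d0 Hd] := HK x Kx _ e20; have [d' d'0 gd'] := gK x Kx _ e20.
  exists (Num.min d d' / 2); split; first by rewrite divr_gt0 // lt_min d0.
  apply: filterS Hd => p Hd x' Kx' x'x y Ky x'y s t.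
  have close z : K z -> `|z - x| < Num.min d d' ->
      forall s, `|(if s then H p else g) z - g x| < e / 2.
    by move=> Kz; rewrite lt_min => /andP[zd zd'] [|]; [exact: Hd|exact: gd'].
  have := close _ Kx' _ s; have := close _ Ky _ t.
  set u := (if s then _ else _) x'; set v := (if t then _ else _) y => H1 H2.
  have {}H1 : `|v - g x| < e / 2.
    apply: H1; have -> : y - x = (x' - x) - (x' - y) by rewrite opprB [RHS]addrC addrA subrK.
    by apply: le_lt_trans (ler_normB _ _) _; lra.
  have {}H2 : `|u - g x| < e / 2.
    by apply: H2; apply: lt_le_trans x'x _; rewrite ler_pdivrMr // ler_peMr // ?ler1n // le_min !ltW.
  have -> : u - v = (u - g x) - (v - g x) by rewrite opprB addrA subrK.
  by apply: le_trans (ler_normB _ _) _; lra.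
have [M KM] := compact_norm_le cK.
apply: filterS2 He He' => p Hp Hp'.
have key : exists h0 M : R, 0 < h0 /\
  forall (c : nat) (h : R), 0 < h -> h < h0 -> (1 < c)%N -> M < h * c%:R ->
    gdeg c h K (H p) = gdeg c h K g %[mod m.+1 * 2].
  exists (Num.min e (e' / 2)), M; split; first by rewrite lt_min e0 divr_gt0.
  move=> c h h0; rewrite lt_min => /andP[he he'] c1 Mh.
  apply: (gdeg_homotopy (ltnW c1) h0 (g := fun s : bool => if s then H p else g) (eta := e)).
  - by move=> x Kx; apply: le_lt_trans (KM x Kx) Mh.
  - by move=> x y s t Kx Ky xy; apply: Hp' => //; apply: le_trans xy _; lra.
  - move=> s x y Kx gx yx; apply: (Hp x Kx _ y); first by case: s gx; [left|right].
    by apply: le_trans yx _; exact: ltW.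
split; apply: odd_degree_congr => //.
have [h0 [M' [h00 HM]]] := key; exists h0, M'; split=> // *.
by rewrite HM.
Qed.

Lemma odd_degree_excision K K' g : compact K -> K' `<=` K -> cont_on K g ->
  (forall x, K x -> g x = 0 -> nbhs x K') ->
  odd_degree K g <-> odd_degree K' g.
Proof.
move=> cK sub gK zero.
have [e e0 He] : exists2 e : R, 0 < e & forall x, K x -> `|g x| <= e -> K' x.
  apply: compact_uniform => // [e e' x ee' Q Qe'|x Kx].
    by apply: Q; apply: le_trans ee'.
  have [gx0|gx0] := eqVneq (g x) 0.
    have /nbhs_ballP[d /= d0 dK] := zero x Kx gx0.
    by exists d => // x' Kx' x'x _; apply: dK; apply/ball_distE.
  have a0 : 0 < `|g x| / 2 by rewrite divr_gt0 ?normr_gt0.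
  have [d' d'0 gd'] := gK x Kx _ a0.
  exists (Num.min d' (`|g x| / 4)); first by rewrite !lt_min d'0 /= divr_gt0 // normr_gt0.
  move=> x' Kx'; rewrite lt_min le_min => /andP[xd' _] /andP[_ z2].
  have := gd' _ Kx' xd' => z1.
  have : `|g x| <= `|g x - g x'| + `|g x'| by rewrite -{1}(subrK (g x') (g x)) ler_normD.
  by rewrite distrC; move: a0 z1 z2; lra.
have [e' e'0 He'] := cont_on_unif cK gK e0.
have [M KM] := compact_norm_le cK.
have key : exists h0 M : R, 0 < h0 /\
  forall (c : nat) (h : R), 0 < h -> h < h0 -> (1 < c)%N -> M < h * c%:R ->
    gdeg c h K g = gdeg c h K' g %[mod m.+1 * 2].
  exists (e' / 2), M; split; first by rewrite divr_gt0.
  move=> c h h0 he' c1 Mh; congr (modn _ _).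
  apply: (gdeg_excision (ltnW c1) h0 (eta := e)) => //.
    by move=> x Kx; apply: le_lt_trans (KM x Kx) Mh.
  by move=> x y Kx Ky xy; apply: He' => //; apply: le_trans xy _; lra.
split; apply: odd_degree_congr => //.
have [h0 [M' [h00 HM]]] := key; exists h0, M'; split=> // *.
by rewrite HM.
Qed.

(** [odd_degree] quantifies universally over grids, so a grid must be exhibited before anything can
    be concluded from it. *)
Lemma odd_degree_grid (h0 M : R) : 0 < h0 ->
  exists (c : nat) (h : R), [/\ 0 < h, h < h0, (1 < c)%N & M < h * c%:R].
Proof.
move=> h00; exists (Num.bound `|M / (h0 / 2)|).+2, (h0 / 2).
have h20 : 0 < h0 / 2 by rewrite divr_gt0.
split=> //; first by lra.
rewrite mulrC -ltr_pdivrMr //; apply: le_lt_trans (ler_norm _) _.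
apply: lt_trans (archi_boundP (normr_ge0 _)) _.
by rewrite ltr_nat ltnS leqnSn.
Qed.

Lemma odd_degree_zero K g : compact K -> cont_on K g -> odd_degree K g ->
  exists2 x, K x & g x = 0.
Proof.
move=> cK gK [h0 [M [h00 odd]]]; apply: contrapT => nz.
have [e e0 He] : exists2 e : R, 0 < e & forall x, K x -> ~ `|g x| <= e.
  apply: compact_uniform => // [e e' x ee' Q Qe'|x Kx].
    by apply: Q; apply: le_trans ee'.
  have gx0 : 0 < `|g x|.
    by rewrite normr_gt0; apply/eqP => gx0; apply: nz; exists x.
  have a0 : 0 < `|g x| / 2 by rewrite divr_gt0.
  have [d' d'0 gd'] := gK x Kx _ a0.
  exists (Num.min d' (`|g x| / 4)); first by rewrite !lt_min d'0 /= divr_gt0.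
  move=> x' Kx'; rewrite lt_min le_min => /andP[xd' _] /andP[_ z2].
  have := gd' _ Kx' xd' => z1.
  have : `|g x| <= `|g x - g x'| + `|g x'| by rewrite -{1}(subrK (g x') (g x)) ler_normD.
  by rewrite distrC; move: a0 z1 z2; lra.
have [e' e'0 He'] := cont_on_unif cK gK e0.
have [M' KM] := compact_norm_le cK.
have h10 : 0 < Num.min h0 (e' / 2) by rewrite lt_min h00 divr_gt0.
have [c [h [hp + c1]]] := odd_degree_grid (Num.max M M') h10.
rewrite lt_min gt_max => /andP[hh0 he'] /andP[Mh M'h].
have := odd c h hp hh0 c1 Mh => nd.
have [|||x Kx] := gdeg_neq0 (ltnW c1) hp (K := K) (g := g) (eta := e).
- by move=> x Kx; apply: le_lt_trans (KM x Kx) M'h.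
- by move=> x y Kx Ky xy; apply: He' => //; apply: le_trans xy _; lra.
- by apply: contraNN nd => /eqP ->.
exact: He.
Qed.

Lemma odd_degree_id (r : R) : 0 < r -> odd_degree [set x | `|x| <= r] id.
Proof.
move=> r0; exists r, r; split=> // c h h0 hr c1 rh.
rewrite gdeg_id //=; last 2 first.
- by move=> x xh; apply: le_trans xh _; exact: ltW.
- by move=> x xr; apply: le_lt_trans xr rh.
by apply/negP => /dvdn_leq; rewrite muln2 -addnn => /(_ isT); rewrite -[X in (_ <= X)%N]addn0 leq_add2l.
Qed.

(** Labels depend only on the signs of the coordinates. *)
Lemma odd_degree_scale K g (a : R) : 0 < a ->
  odd_degree K (fun x => a *: g x) <-> odd_degree K g.
Proof.
move=> a0; have E c h : gdeg c h K (fun x => a *: g x) = gdeg c h K g.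
  rewrite /gdeg; congr nfull; apply/funext => v; rewrite /glab; congr (if _ then Some _ else _).
  by apply: lab_eq => i; rewrite mxE pmulr_rle0.
by split; apply: odd_degree_congr; exists 1, 0; split=> // *; rewrite E.
Qed.


End OddDegree.

(** * Ordinary differential equations *)

Section VectorCalculus.
Context {R : realType} {n : nat}.
Implicit Types w : R -> 'cV[R]_n.

Lemma continuous_coord (T : topologicalType) (w : T -> 'cV[R]_n) x :
  (forall i, {for x, continuous (fun t => w t i 0)}) -> {for x, continuous w}.
Proof.
move=> wi; apply/cvgrPdist_lt => e e0.
have : \forall t \near x, forall i : 'I_n, `|w x i 0 - w t i 0| < e.
  by apply: filter_forall => i; move/cvgrPdist_lt : (wi i) => /(_ e e0).
apply: filterS => t H; apply: cnorm_lt => // i; by rewrite !mxE.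
Qed.

Lemma coord_cts (T : topologicalType) (w : T -> 'cV[R]_n) x i :
  {for x, continuous w} -> {for x, continuous (fun t => w t i 0)}.
Proof.
move=> cw; apply: (continuous_comp (g := fun M : 'cV[R]_n => M i 0) cw).
exact: coord_continuous.
Qed.

Lemma derive_coord w (x : R) i : derivable w x 1 ->
  is_derive x (1:R) (fun t : R => w t i 0) (('D_1 w x) i 0).
Proof.
move=> dw; have /derivable_mxP/(_ i 0) dwi := dw.
by apply: DeriveDef => //; rewrite derive_mx // mxE.
Qed.

Lemma is_derive_col w (x : R) (v : 'cV[R]_n) :
  (forall i, is_derive x (1:R) (fun t : R => w t i 0) (v i 0)) -> is_derive x 1 w v.
Proof.
move=> H; have dw : derivable w x 1.
  by apply/derivable_mxP => i j; rewrite ord1; exact: ex_derive.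
apply: DeriveDef => //; rewrite derive_mx //; apply/colP => i; rewrite mxE.
exact: derive_val.
Qed.

(** Mean value inequality with a scalar majorant: for each coordinate and each sign [s], the
    function [phi] minus [s] times the coordinate is nondecreasing. *)
Lemma norm_increment_le w (phi dphi : R -> R) (a b : R) : a <= b ->
  {within `[a, b], continuous w} ->
  (forall x : R, a < x < b -> derivable w x 1) ->
  (forall x : R, is_derive x 1 phi (dphi x)) ->
  (forall x, a < x < b -> `|'D_1 w x| <= dphi x) ->
  `|w b - w a| <= phi b - phi a.
Proof.
move=> ab cw dw dphiP wphi.
have cphi : {within `[a, b], continuous phi}.
  apply: derivable_within_continuous => x _; exact: ex_derive.
have cwi i : {within `[a, b], continuous (fun t => w t i 0)}.
  move=> x; apply: (@continuous_comp (subspace `[a, b]) _ _ w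
    (fun M : 'cV[R]_n => M i 0) x (cw x)).
  exact: coord_continuous.
have key (s : R) i : `|s| = 1 -> s * (w b i 0 - w a i 0) <= phi b - phi a.
  move=> s1; pose g := fun t => phi t - s * w t i 0.
  have gD x : x \in `]a, b[ -> is_derive x 1 g (dphi x - s * ('D_1 w x) i 0).
    rewrite in_itv /= => xab.
    have d1 := derive_coord i (dw _ xab).
    by apply: is_deriveB; apply: is_derive_eq; rewrite /GRing.scale /=.
  have : g a <= g b.
    apply: (ger0_derive1_ndecr (a := a) (b := b)) => //.
    - by move=> x /gD dg; exact: ex_derive.
    - move=> x xab; have dg := gD x xab; rewrite derive1E derive_val subr_ge0.
      move: xab; rewrite in_itv /= => xab.
      apply: le_trans (wphi x xab); apply: le_trans (cnorm_ge _ i).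
      by apply: le_trans (ler_norm _) _; rewrite normrM s1 mul1r.
    - move=> x; rewrite /g; apply: cvgB; first exact: cphi.
      by apply: cvgM; [exact: cvg_cst|exact: cwi].
  by rewrite /g; lra.
have phi0 : 0 <= phi b - phi a.
  rewrite subr_ge0; move: ab; rewrite le_eqVlt => /predU1P[->//|ab].
  apply: (ger0_derive1_ndecr (a := a) (b := b)) => //; try exact: ltW.
  move=> x xab; have dg := dphiP x; rewrite derive1E derive_val.
  by move: xab; rewrite in_itv /= => xab; apply: le_trans (wphi x xab).
apply: cnorm_le => // i; rewrite !mxE ler_norml.
have := key 1 i (normr1 _); have := key (-1) i (normrN1 _).
by rewrite mulN1r mul1r => h1 h2; apply/andP; split; lra.
Qed.

(** The norm is not differentiable, so the argument uses the maximum M of |w| weighted by exp(-2Lt).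
    Integrating the bound L M exp(2Lt) + k on the derivative reproduces only half of M, thanks to
    the factor 2 in the weight, plus a term at most k T. *)
Lemma gronwall w (L k T : R) : 0 < L -> 0 <= k -> 0 <= T ->
  {within `[0, T], continuous w} -> w 0 = 0 ->
  (forall x : R, 0 < x < T -> derivable w x 1 /\ `|'D_1 w x| <= L * `|w x| + k) ->
  forall x, 0 <= x <= T -> `|w x| <= 2 * k * T * expR (2 * L * T).
Proof.
move=> L0 k0 T0 cw w0 dw.
pose g := fun t : R => `|w t| * expR (- (2 * L * t)).
have cg : {within `[0, T], continuous g}.
  move=> x; rewrite /g; apply: cvgM.
    apply: (@continuous_comp (subspace `[0, T]) _ _ w (fun M : 'cV[R]_n => `|M|) x (cw x)).
    exact: norm_continuous.
  apply: continuous_subspaceT => {}x; apply: (@continuous_comp R R R (fun t => - (2 * L * t)) expR); last exact: continuous_expR.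
  by apply: cvgN; apply: cvgM => //; exact: cvg_cst.
have [c cT gc] := EVT_max T0 cg.
move: cT; rewrite in_itv /= => /andP[c0 cT].
pose M := g c.
have M0 : 0 <= M by rewrite mulr_ge0 // expR_ge0.
have wM x : 0 <= x <= T -> `|w x| <= M * expR (2 * L * x).
  move=> xT; have := gc x; rewrite in_itv /= xT => /(_ isT); rewrite -/M /g.
  by rewrite expRN ler_pdivrMr ?expR_gt0.
have wcM : `|w c| = M * expR (2 * L * c).
  by rewrite /M /g expRN mulfVK // gt_eqF // expR_gt0.
have bound : `|w c| <= M / 2 * expR (2 * L * c) + k * c - M / 2.
  pose phi := fun t : R => M / 2 * expR (2 * L * t) + k * t.
  have := @norm_increment_le w phi (fun t => L * (M * expR (2 * L * t)) + k) 0 c c0.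
  rewrite w0 subr0 /phi mulr0 expR0 !mulr1 mulr0 addr0; apply.
  - by apply: continuous_subspaceW cw; apply: subset_itvl; rewrite bnd_simp.
  - by move=> x /andP[x0 xc]; apply: (dw x _).1; rewrite x0 (lt_le_trans xc cT).
  - move=> x; apply: is_derive_eq; rewrite /GRing.scale /=.
    by field.
  - move=> x /andP[x0 xc].
    have xT : x < T by apply: lt_le_trans xc cT.
    apply: le_trans (dw x _).2 _; first by rewrite x0.
    by rewrite lerD2r ler_pM2l // wM // !ltW.
have Mk : M <= 2 * k * T.
  have e1 : 1 <= expR (2 * L * c) by rewrite -expR0 ler_expR !mulr_ge0 // ltW.
  have kc : k * c <= k * T by apply: ler_wpM2l.
  move: bound; rewrite wcM => bound.
  have : M <= M * expR (2 * L * c) by apply: ler_peMr.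
  by move: bound kc M0; set e := M * expR _; rewrite (_ : M / 2 * _ = e / 2); [lra|rewrite /e; ring].
move=> x /andP[x0 xT]; apply: le_trans (wM x _) _; first by rewrite x0.
apply: ler_pM; rewrite ?expR_ge0 //.
by rewrite ler_expR ler_wpM2l // mulr_ge0 // ltW.
Qed.

End VectorCalculus.

(** * Global solutions for a Lipschitz right-hand side *)

Section Picard.
Context {R : realType} {n : nat}.
Local Notation V := 'cV[R]_n.

Lemma scalar_primitive (h : R -> R) : continuous h ->
  exists2 P : R -> R, P 0 = 0 & forall x : R, 0 <= x -> is_derive x 1 P (h x).
Proof.
move=> ch.
(* Starting the integral at -1 makes 0 an interior point, so that the derivative there is
   two-sided. *)
pose F (x : R) : R := (\int[@lebesgue_measure R]_(t in [set` `[-1, x]]) (h t))%R.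
exists (fun x => F x - F 0); first by rewrite subrr.
move=> x x0.
have hi : (@lebesgue_measure R).-integrable `[-1, x + 1] (EFin \o h).
  apply: continuous_compact_integrable; first exact: segment_compact.
  exact: continuous_subspaceT.
have [||dF F'] := continuous_FTC1_closed (x := x) _ hi _ (ch x); first by rewrite ltrDl.
  by apply: lt_le_trans x0; rewrite oppr_lt0.
have dF' : is_derive x 1 F (h x) by apply: (DeriveDef dF); rewrite -derive1E; exact: F'.
by apply: is_derive_eq; rewrite subr0.
Qed.

Lemma primitive (h : R -> V) : continuous h ->
  exists P : R -> V, [/\ continuous P, forall x : R, x <= 0 -> P x = 0
    & forall x : R, 0 < x -> is_derive x 1 P (h x)].
Proof.
move=> ch.
have /fin_all_exists[F FP] : forall i : 'I_n, exists P : R -> R,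
    P 0 = 0 /\ forall x : R, 0 <= x -> is_derive x 1 P (h x i 0).
  move=> i; have [|P P0 dP] := @scalar_primitive (fun t => h t i 0); last by exists P.
  by move=> t; apply: coord_cts; exact: ch.
have cmax : continuous (fun x : R => Num.max 0 x).
  by move=> x; apply: continuous_max => //; exact: cvg_cst.
(* Freezing the primitive on the negative axis gives iterates that are continuous on the whole
   line. *)
exists (fun x => \col_i F i (Num.max 0 x)); split.
- move=> x; apply: continuous_coord => i.
  have -> : (fun t => (\col_i F i (Num.max 0 t)) i 0) = F i \o Num.max 0.
    by apply/funext => t; rewrite mxE.
  apply: continuous_comp; first exact: cmax.
  have mx0 : 0 <= Num.max 0 x by rewrite le_max lexx.
  apply: differentiable_continuous; apply/derivable1_diffP.
  by have dF := (FP i).2 _ mx0; exact: ex_derive.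
- by move=> x x0; apply/colP => i; rewrite !mxE max_l // (FP i).1.
move=> x x0; apply: is_derive_col => i.
have dF := (FP i).2 _ (ltW x0).
apply: near_eq_is_derive dF.
by near=> t; rewrite mxE max_r // ltW //; near: t; exact: lt_nbhsr.
Unshelve. all: by end_near. Qed.

(** In the norm weighted by exp(-2Lx) the integral operator contracts by the factor 1/2 on the whole
    half-line, so the iterates converge with no restriction on the length of the interval. *)
Lemma picard (H : R -> V -> V) (L A : R) : 0 < L -> 0 <= A ->
  (forall x u v, `|H x u - H x v| <= L * `|u - v|) ->
  (forall x, `|H x 0| <= A) ->
  (forall w : R -> V, continuous w -> continuous (fun x => H x (w x))) ->
  exists w : R -> V, [/\ continuous w, w 0 = 0
    & forall x : R, 0 < x -> is_derive x 1 w (H x (w x))].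
Proof.
move=> L0 A0 lipH bndH ctsH.
have /choice[S SP] : forall w : R -> V, exists P : R -> V, continuous w ->
   [/\ continuous P, forall x : R, x <= 0 -> P x = 0
    & forall x : R, 0 < x -> is_derive x 1 P (H x (w x))].
  move=> w; have [cw|ncw] := pselect (continuous w); last by exists w.
  by have [P] := primitive (ctsH _ cw); exists P.
pose E (x : R) := expR (2 * L * x).
have contr (u v : R -> V) (b : R) : continuous u -> continuous v -> 0 <= b ->
    (forall x : R, 0 <= x -> `|u x - v x| <= b * E x) ->
    forall x : R, 0 <= x -> `|S u x - S v x| <= b / 2 * E x.
  move=> cu cv b0 uv x x0.
  have [cSu Su0 dSu] := SP _ cu; have [cSv Sv0 dSv] := SP _ cv.
  have dw (y : R) : 0 < y -> is_derive y 1 (fun t => S u t - S v t) (H y (u y) - H y (v y)).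
    by move=> y0; exact: (is_deriveB (dSu y y0) (dSv y y0)).
  have := @norm_increment_le R n (S u - S v) (fun t => b / 2 * E t)
    (fun t => b * L * E t) 0 x x0.
  rewrite /= !fctE (Su0 0) // (Sv0 0) // !subr0 => H1; apply: le_trans (H1 _ _ _ _) _.
  - by apply: continuous_subspaceT => t; apply: cvgB; [exact: cSu|exact: cSv].
  - by move=> t /andP[t0 _]; have dt := dw t t0; exact: ex_derive.
  - by move=> t; apply: is_derive_eq; rewrite /GRing.scale /= /E; field.
  - move=> t /andP[t0 _]; have dt := dw t t0; rewrite derive_val.
    apply: le_trans (lipH _ _ _) _.
    by rewrite [b * L]mulrC -mulrA ler_pM2l // uv // ltW.
  by rewrite lerBlDr lerDl mulr_ge0 ?expR_ge0 // divr_ge0.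
(* The first iterate has derivative at most A, hence at most A exp(2Lx), whose primitive is B
   exp(2Lx). *)
pose B := A / (2 * L).
have B0 : 0 <= B by rewrite divr_ge0 // mulr_ge0 // ltW.
pose u k := iter k S (cst 0).
have cu k : continuous (u k).
  by elim: k => [|k IHk]; [move=> x; exact: cvg_cst|have [] := SP _ IHk].
have u0 k (x : R) : x <= 0 -> u k x = 0.
  by case: k => [//|k]; have [_ + _] := SP _ (cu k); apply.
have step0 (x : R) : 0 <= x -> `|u 1%N x - u 0%N x| <= B * E x.
  move=> x0; have [cS S0 dS] := SP _ (cu 0%N).
  have := @norm_increment_le R n (u 1%N) (fun t => B * E t)
    (fun t => A * E t) 0 x x0.
  rewrite [u 0%N x]/u /= subr0 (S0 0) // subr0 => H1; apply: le_trans (H1 _ _ _ _) _.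
  - by apply: continuous_subspaceT; exact: cS.
  - by move=> t /andP[t0 _]; have dt := dS t t0; exact: ex_derive.
  - move=> t; apply: is_derive_eq; rewrite /GRing.scale /= /E /B; field.
    by rewrite gt_eqF.
  - move=> t /andP[t0 _]; have dt := dS t t0; rewrite derive_val.
    apply: le_trans (bndH _) _; apply: ler_peMr => //.
    by rewrite /E -expR0 ler_expR !mulr_ge0 // ltW.
  by rewrite lerBlDr lerDl mulr_ge0 ?expR_ge0.
have step k (x : R) : 0 <= x -> `|u k.+1 x - u k x| <= B / 2 ^+ k * E x.
  elim: k x => [|k IHk] x x0; first by rewrite expr0 divr1; exact: step0.
  rewrite exprSr invfM mulrA.
  by apply: (contr (u k.+1) (u k)) => //; rewrite divr_ge0 // exprn_ge0.
have tail k j (x : R) : 0 <= x -> `|u (k + j)%N x - u k x| <= 2 * B / 2 ^+ k * E x.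
  move=> x0.
  suff : `|u (k + j)%N x - u k x| <= (2 * B / 2 ^+ k - 2 * B / 2 ^+ (k + j)) * E x.
    move=> H1; apply: le_trans H1 _; apply: ler_wpM2r; first exact: expR_ge0.
    by rewrite lerBlDr lerDl divr_ge0 ?exprn_ge0 // mulr_ge0.
  elim: j => [|j IHj]; first by rewrite addn0 !subrr normr0 mul0r.
  rewrite addnS -[_ - _](subrKA (u (k + j)%N x)).
  apply: le_trans (ler_normD _ _) _; apply: le_trans (lerD (step _ _ x0) IHj) _.
  rewrite -mulrDl ler_wpM2r ?expR_ge0 // exprSr.
  have : 2 ^+ (k + j) != 0 :> R by rewrite expf_neq0 ?pnatr_eq0.
  have : 2 ^+ k != 0 :> R by rewrite expf_neq0 ?pnatr_eq0.
  by move=> p0 p1; rewrite le_eqVlt; apply/orP; left; apply/eqP; field; apply/andP.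
have small (c e : R) : 0 <= c -> 0 < e -> \forall k \near \oo, c / 2 ^+ k < e :> R.
  move=> c0 e0; have h1 : `|2^-1 : R| < 1 by rewrite ger0_norm // invf_lt1 // ltr1n.
  have /cvgrPdist_lt /(_ e e0) := cvg_geometric c h1.
  apply: filterS => k; rewrite sub0r normrN /geometric /= ger0_norm ?exprVn //.
  by rewrite mulr_ge0 // invr_ge0 exprn_ge0.
pose w x := lim (u ^~ x @ \oo).
have ucv x : u ^~ x @ \oo --> w x.
  apply/cauchy_cvgP/cauchy_exP => e e0.
  have bn (a b : V) : `|b - a| < e -> ball a e b by rewrite -ball_normE /= distrC.
  have [x0|x0] := lerP 0 x; last first.
    by exists 0, 0%N => // k _ /=; apply: bn; rewrite u0 ?subrr ?normr0 // ltW.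
  have [k _ kP] := small (2 * B * E x) e (mulr_ge0 (mulr_ge0 (ler0n _ 2) B0) (expR_ge0 _)) e0.
  exists (u k x), k => // j /= kj; apply: bn.
  rewrite -(subnKC kj); apply: le_lt_trans (tail _ _ _ x0) _.
  by have := kP k (leqnn k); rewrite mulrAC.
have wtail k (x : R) : 0 <= x -> `|w x - u k x| <= 2 * B / 2 ^+ k * E x.
  move=> x0; have c1 : (fun j => `|u j x - u k x|) @ \oo --> `|w x - u k x|.
    by apply: cvg_norm; apply: cvgB; [exact: ucv|exact: cvg_cst].
  apply: (cvgr_to_le c1); exists k => // j /= kj.
  by rewrite -(subnKC kj); exact: tail.
have wneg (x : R) : x <= 0 -> w x = 0.
  move=> x0; apply/cvg_lim => //.
  by apply: cvg_near_cst; apply: nearW => k; exact: u0.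
have cw : continuous w.
  move=> x; apply/cvgrPdist_lt => e e0.
  have e30 : 0 < e / 3 by rewrite divr_gt0.
  pose C := expR (2 * L * (`|x| + 1)).
  have [k _ kP] := small (2 * B * C) _ (mulr_ge0 (mulr_ge0 (ler0n _ 2) B0) (expR_ge0 _)) e30.
  have close (t : R) : `|t - x| < 1 -> `|w t - u k t| < e / 3.
    move=> tx; have [t0|t0] := lerP 0 t; last first.
      by rewrite wneg ?u0 ?subrr ?normr0 // ltW.
    apply: le_lt_trans (wtail _ _ t0) _; apply: le_lt_trans (kP k (leqnn k)).
    rewrite [leRHS]mulrAC; apply: ler_wpM2l; first by rewrite divr_ge0 ?exprn_ge0 // mulr_ge0.
    rewrite /E /C ler_expR ler_wpM2l ?mulr_ge0 ?(ltW L0) //.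
    by move: tx; rewrite ltr_norml; have := ler_norm x; lra.
  have /cvgrPdist_lt /(_ _ e30) := cu k x.
  have : \forall t \near x, `|t - x| < 1.
    have := @nbhsx_ballx _ R^o x 1 ltr01; apply: filterS => t.
    by rewrite /ball /= distrC.
  apply: filterS2 => t tx ut.
  have -> : w x - w t = (w x - u k x) + (u k x - u k t) - (w t - u k t).
    by rewrite subrKA opprB subrKA.
  apply: le_lt_trans (ler_normB _ _) _.
  have := close t tx; have := close x; rewrite subrr normr0 ltr01 => /(_ isT) h1 h2.
  have := ler_normD (w x - u k x) (u k x - u k t).
  by lra.
have [cSw Sw0 dSw] := SP _ cw.
have fixw x : S w x = w x.
  have [x0|x0] := lerP 0 x; last by rewrite Sw0 ?wneg // ltW.
  apply/eqP; rewrite -subr_eq0 -normr_eq0; apply/eqP/le_anti; rewrite normr_ge0 andbT.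
  apply/ler_addgt0Pl => e e0; rewrite addr0.
  have [k _ kP] := small (2 * B * E x) e (mulr_ge0 (mulr_ge0 (ler0n _ 2) B0) (expR_ge0 _)) e0.
  have h1 : `|S w x - u k.+1 x| <= 2 * B / 2 ^+ k / 2 * E x.
    apply: contr => //; last exact: wtail.
    by rewrite divr_ge0 ?exprn_ge0 // mulr_ge0.
  have h2 := wtail k.+1 x x0.
  have := kP k (leqnn k) => h3.
  have -> : S w x - w x = (S w x - u k.+1 x) - (w x - u k.+1 x).
    by rewrite opprB subrKA.
  apply: le_trans (ler_normB _ _) _; apply: le_trans (lerD h1 h2) _.
  apply: le_trans (ltW h3); rewrite exprSr.
  have p0 : 2 ^+ k != 0 :> R by rewrite expf_neq0 ?pnatr_eq0.
  by rewrite le_eqVlt; apply/orP; left; apply/eqP; field.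
exists w; split=> //; first exact: wneg.
have -> : w = S w by apply/funext => x; rewrite fixw.
by move=> x x0; have := dSw x x0; rewrite fixw.
Qed.

End Picard.

(** * Locally Lipschitz maps and their algebra *)

Section Loclip.
Context {R : realType}.
Variables (V : normedModType R).
Implicit Types (x y z : V).

(** This regularity is preserved by the operations that build the vector field, matrix inversion
    included, and it is the one on which existence, uniqueness and stability of solutions rest. *)
Definition loclip (W : normedModType R) (f : V -> W) x := exists d L : R,
  [/\ 0 < d, 0 <= L & forall y z, `|y - x| < d -> `|z - x| < d ->
     `|f y - f z| <= L * `|y - z|].

Lemma loclip_cts (W : normedModType R) (f : V -> W) x :
  loclip f x -> {for x, continuous f}.
Proof.
move=> [d [L [d0 L0 H]]]; apply/cvgrPdist_lt => e e0.
have : \forall y \near x, `|y - x| < Num.min d (e / (L + 1)).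
  have r0 : 0 < Num.min d (e / (L + 1)) by rewrite lt_min d0 divr_gt0 // ltr_wpDl.
  by have := nbhsx_ballx x _ r0; apply: filterS => y; move/ball_distE.
apply: filterS => y; rewrite lt_min => /andP[yd].
rewrite ltr_pdivlMr ?ltr_wpDl // => ye.
apply: le_lt_trans (H x y _ yd) _; first by rewrite subrr normr0.
rewrite distrC mulrC; apply: le_lt_trans ye.
by rewrite ler_wpM2l // lerDl.
Qed.

Lemma loclip_cst (W : normedModType R) (a : W) x : loclip (fun=> a) x.
Proof. by exists 1, 0; split=> // y z _ _; rewrite subrr normr0 mul0r. Qed.

Lemma loclipD (W : normedModType R) (f g : V -> W) x :
  loclip f x -> loclip g x -> loclip (fun y => f y + g y) x.
Proof.
move=> [d [L [d0 L0 H]]] [d' [L' [d'0 L'0 H']]].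
exists (Num.min d d'), (L + L'); split; [by rewrite lt_min d0|exact: addr_ge0|].
move=> y z; rewrite !lt_min => /andP[yd yd'] /andP[zd zd'].
rewrite opprD addrACA; apply: le_trans (ler_normD _ _) _.
by rewrite mulrDl lerD ?H ?H'.
Qed.

Lemma loclipN (W : normedModType R) (f : V -> W) x :
  loclip f x -> loclip (fun y => - f y) x.
Proof.
move=> [d [L [d0 L0 H]]]; exists d, L; split=> // y z yd zd.
by rewrite -opprD normrN H.
Qed.

Lemma loclip_bounded (W : normedModType R) (f : V -> W) x : loclip f x ->
  exists d M, [/\ 0 < d, 0 <= M & forall y, `|y - x| < d -> `|f y| <= M].
Proof.
move=> [d [L [d0 L0 H]]]; exists d, (L * d + `|f x|); split=> //.
  by rewrite addr_ge0 // mulr_ge0 // ltW.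
move=> y yd; rewrite -{1}(subrK (f x) (f y)); apply: le_trans (ler_normD _ _) _.
rewrite lerD2r; apply: le_trans (H y x yd _) _; first by rewrite subrr normr0.
by rewrite ler_wpM2l // ltW.
Qed.

Lemma loclipM (f g : V -> R) x :
  loclip f x -> loclip g x -> loclip (fun y => f y * g y) x.
Proof.
move=> lf lg; have [df [Mf [df0 Mf0 Hf]]] := loclip_bounded lf.
have [dg [Mg [dg0 Mg0 Hg]]] := loclip_bounded lg.
move: lf lg => [d [L [d0 L0 H]]] [d' [L' [d'0 L'0 H']]].
exists (Num.min (Num.min d d') (Num.min df dg)), (L * Mg + Mf * L'); split.
- by rewrite !lt_min d0 d'0 df0.
- by rewrite addr_ge0 // mulr_ge0.
move=> y z; rewrite !lt_min => /andP[/andP[yd yd'] /andP[ydf ydg]].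
move=> /andP[/andP[zd zd'] /andP[zdf zdg]].
have -> : f y * g y - f z * g z = (f y - f z) * g y + f z * (g y - g z) by ring.
apply: le_trans (ler_normD _ _) _; rewrite !normrM mulrDl lerD //.
  by rewrite -mulrA [Mg * _]mulrC mulrA ler_pM // ?H ?Hg.
by rewrite -mulrA ler_pM // ?H' ?Hf.
Qed.

Lemma loclipV (f : V -> R) x : f x != 0 -> loclip f x -> loclip (fun y => (f y)^-1) x.
Proof.
move=> fx0 [d [L [d0 L0 H]]].
have a0 : 0 < `|f x| by rewrite normr_gt0.
exists (Num.min d (`|f x| / (2 * (L + 1)))), (L / (`|f x| / 2) ^+ 2); split.
- by rewrite lt_min d0 divr_gt0 // mulr_gt0 // ltr_wpDl.
- by rewrite divr_ge0 // exprn_ge0 // divr_ge0.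
have low y : `|y - x| < Num.min d (`|f x| / (2 * (L + 1))) -> `|f x| / 2 <= `|f y|.
  rewrite lt_min => /andP[yd]; rewrite ltr_pdivlMr ?mulr_gt0 ?ltr_wpDl // => ye.
  have h1 := H y x yd; rewrite subrr normr0 in h1; have {}h1 := h1 d0.
  have h2 : `|f x| <= `|f x - f y| + `|f y| by rewrite -{1}(subrK (f y) (f x)) ler_normD.
  rewrite distrC in h2.
  have h3 : L * `|y - x| <= (L + 1) * `|y - x| by rewrite ler_wpM2r // lerDl.
  by move: ye h1 h2 h3; nra.
move=> y z yd zd; have ly := low y yd; have lz := low z zd.
have y0 : f y != 0 by rewrite -normr_gt0; apply: lt_le_trans ly; rewrite divr_gt0.
have z0 : f z != 0 by rewrite -normr_gt0; apply: lt_le_trans lz; rewrite divr_gt0.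
have -> : (f y)^-1 - (f z)^-1 = - ((f y - f z) / (f y * f z)).
  by field; rewrite y0 z0.
rewrite normrN normrM normfV normrM.
move: yd zd; rewrite !lt_min => /andP[yd _] /andP[zd _].
rewrite [leRHS]mulrAC ler_pM //; first exact: H.
rewrite lef_pV2 ?posrE ?exprn_gt0 ?divr_gt0 ?mulr_gt0 ?normr_gt0 //.
by rewrite expr2 ler_pM // divr_ge0.
Qed.

Lemma loclip_sum (W : normedModType R) (I : Type) (r : seq I) (P : pred I)
    (F : I -> V -> W) x :
  (forall i, P i -> loclip (F i) x) -> loclip (fun y => \sum_(i <- r | P i) F i y) x.
Proof.
move=> H; elim: r => [|i r IHr].
  by under eq_fun do rewrite big_nil; exact: loclip_cst.
under eq_fun do rewrite big_cons; case: (boolP (P i)) => // Pi.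
by apply: loclipD => //; exact: H.
Qed.

Lemma loclip_prod (I : Type) (r : seq I) (P : pred I) (F : I -> V -> R) x :
  (forall i, P i -> loclip (F i) x) -> loclip (fun y => \prod_(i <- r | P i) F i y) x.
Proof.
move=> H; elim: r => [|i r IHr].
  by under eq_fun do rewrite big_nil; exact: loclip_cst.
under eq_fun do rewrite big_cons; case: (boolP (P i)) => // Pi.
by apply: loclipM => //; exact: H.
Qed.

Lemma loclip_mx p q (f : V -> 'M[R]_(p, q)) x :
  (forall i j, loclip (fun y => f y i j) x) -> loclip f x.
Proof.
move=> H.
have /choice[g gP] : forall ij : 'I_p * 'I_q, exists dL : R * R, [/\ 0 < dL.1, 0 <= dL.2
   & forall y z, `|y - x| < dL.1 -> `|z - x| < dL.1 ->
     `|f y ij.1 ij.2 - f z ij.1 ij.2| <= dL.2 * `|y - z|].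
  by move=> [i j]; have [d [L h]] := H i j; exists (d, L).
exists (\big[Num.min/1]_ij (g ij).1), (\sum_ij (g ij).2); split.
- by apply/bigmin_gtP; split=> // ij _; have [] := gP ij.
- by apply: sumr_ge0 => ij _; have [] := gP ij.
move=> y z yd zd.
have S0 : 0 <= (\sum_ij (g ij).2) * `|y - z|.
  by rewrite mulr_ge0 //; apply: sumr_ge0 => ij _; have [] := gP ij.
rewrite /Num.norm/= mx_normrE; apply/bigmax_leP; split=> // ij _ /=.
have [g0 g1 h] := gP ij; rewrite !mxE.
have yd1 : `|y - x| < (g ij).1 by apply: lt_le_trans yd _; exact: Order.TotalTheory.bigmin_le.
have zd1 : `|z - x| < (g ij).1 by apply: lt_le_trans zd _; exact: Order.TotalTheory.bigmin_le.
apply: le_trans (h y z yd1 zd1) _; rewrite ler_wpM2r //.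
rewrite (bigD1 ij) //= lerDl; apply: sumr_ge0 => k _; by have [] := gP k.
Qed.

Definition mloclip p q (f : V -> 'M[R]_(p, q)) x :=
  forall i j, loclip (fun y => f y i j) x.

Lemma mloclipM p q r (f : V -> 'M[R]_(p, q)) (g : V -> 'M[R]_(q, r)) x :
  mloclip f x -> mloclip g x -> mloclip (fun y => f y *m g y) x.
Proof.
move=> lf lg i j; under eq_fun do rewrite mxE.
by apply: loclip_sum => k _; apply: loclipM.
Qed.

Lemma mloclipD p q (f g : V -> 'M[R]_(p, q)) x :
  mloclip f x -> mloclip g x -> mloclip (fun y => f y + g y) x.
Proof. by move=> lf lg i j; under eq_fun do rewrite mxE; apply: loclipD. Qed.

Lemma mloclipN p q (f : V -> 'M[R]_(p, q)) x :
  mloclip f x -> mloclip (fun y => - f y) x.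
Proof. by move=> lf i j; under eq_fun do rewrite mxE; apply: loclipN. Qed.

Lemma mloclip_cst p q (a : 'M[R]_(p, q)) x : mloclip (fun=> a) x.
Proof. by move=> i j; exact: loclip_cst. Qed.

Lemma loclip_det p (f : V -> 'M[R]_p) x : mloclip f x -> loclip (fun y => \det (f y)) x.
Proof.
move=> lf; rewrite /determinant; apply: loclip_sum => s _.
by apply: loclipM; [exact: loclip_cst|apply: loclip_prod => i _; exact: lf].
Qed.

(* Agrees with [invmx] on invertible matrices, but is given by the same rational
   formula everywhere. *)
Definition adjinv p (A : 'M[R]_p) := (\det A)^-1 *: \adj A.

Lemma adjinvE p (A : 'M[R]_p) : A \in unitmx -> adjinv A = invmx A.
Proof. by move=> uA; rewrite /invmx uA. Qed.

Lemma mloclip_adjinv p (f : V -> 'M[R]_p) x :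
  \det (f x) != 0 -> mloclip f x -> mloclip (fun y => adjinv (f y)) x.
Proof.
move=> dx lf i j; rewrite /adjinv; under eq_fun do rewrite !mxE.
apply: loclipM; first by apply: loclipV => //; exact: loclip_det.
rewrite /cofactor; apply: loclipM; first exact: loclip_cst.
apply: loclip_det => i' j'; under eq_fun do rewrite !mxE.
exact: lf.
Qed.

End Loclip.

(** * Norm estimates and compact sets of vectors *)

Section MatrixNorm.
Context {R : realType}.

Lemma mx_norm_ge p q (A : 'M[R]_(p, q)) i j : `|A i j| <= `|A|.
Proof. by rewrite [leRHS]/Num.norm/= mx_normrE; apply: (le_bigmax _ _ (i, j)). Qed.

Lemma mulmx_norm_le p q (A : 'M[R]_(p, q)) (z : 'cV[R]_q) :
  `|A *m z| <= q%:R * `|A| * `|z|.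
Proof.
apply: cnorm_le => [|i]; first by rewrite !mulr_ge0.
rewrite mxE; apply: le_trans (ler_norm_sum _ _ _) _.
have -> : q%:R * `|A| * `|z| = \sum_(j < q) `|A| * `|z|.
  by rewrite sumr_const card_ord mulr_natl mulrnAl.
by apply: ler_sum => j _; rewrite normrM ler_pM // ?mx_norm_ge.
Qed.

Lemma usubmx_norm_le p q (z : 'cV[R]_(p + q)) : `|usubmx z| <= `|z|.
Proof. by apply: cnorm_le => // i; rewrite mxE; exact: cnorm_ge. Qed.

Lemma dsubmx_norm_le p q (z : 'cV[R]_(p + q)) : `|dsubmx z| <= `|z|.
Proof. by apply: cnorm_le => // i; rewrite mxE; exact: cnorm_ge. Qed.

Lemma col_norm_le p q (z : 'cV[R]_(p + q)) : `|z| <= `|usubmx z| + `|dsubmx z|.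
Proof.
apply: cnorm_le => [|i]; first by rewrite addr_ge0.
case: (split_ordP i) => k ->.
  by apply: le_trans (_ : `|usubmx z| <= _); [have := cnorm_ge (usubmx z) k; rewrite mxE|rewrite lerDl].
by apply: le_trans (_ : `|dsubmx z| <= _); [have := cnorm_ge (dsubmx z) k; rewrite mxE|rewrite lerDr].
Qed.

(** The Heine-Borel property of row vectors, carried over by the transpose, an isometry for the
    maximum norm. *)
Lemma cV_compact n (A : set 'cV[R]_n) : closed A ->
  (exists M, forall x, A x -> `|x| <= M) -> compact A.
Proof.
move=> cA [M AM].
have ctr p q : continuous (fun x : 'M[R]_(p, q) => x^T).
  move=> x; apply/(@cvgrPdist_lt R 'M[R]_(q, p) 'M[R]_(p, q) (nbhs (x : 'M[R]_(p, q)))) => e e0.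
  apply: (@near_dist R 'M[R]_(p, q) x e _ e0) => y yx.
  rewrite -linearB /=; rewrite distrC in yx; apply: le_lt_trans yx.
  rewrite [leLHS]/Num.norm/= mx_normrE; apply/bigmax_leP; split=> // -[i j] _ /=.
  by rewrite mxE; exact: mx_norm_ge.
have -> : A = trmx @` (trmx @^-1` A : set 'rV[R]_n).
  apply/seteqP; split=> x; first by move=> Ax; exists x^T; rewrite /= trmxK.
  by move=> [y Ay <-].
apply: continuous_compact; first by apply: continuous_subspaceT => x; exact: ctr.
apply: bounded_closed_compact.
  exists M; split=> [|N MN x Ax]; first exact: num_real.
  apply: le_trans (ltW MN); apply: le_trans (AM _ Ax).
  rewrite [leLHS]/Num.norm/= mx_normrE; apply/bigmax_leP; split=> // -[i j] _ /=.
  by have := mx_norm_ge x^T j i; rewrite mxE.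
by apply: preimage_closed => // x _; exact: ctr.
Qed.

Lemma closed_ball_compact n (a : 'cV[R]_n) (r : R) : compact [set x | `|x - a| <= r].
Proof.
apply: cV_compact; last first.
  by exists (r + `|a|) => x xr; rewrite -(subrK a x); apply: le_trans (ler_normD _ _) _; rewrite lerD2r.
have -> : [set x | `|x - a| <= r] = (fun x => `|x - a|) @^-1` [set t | t <= r] by [].
apply: preimage_closed; last exact: closed_le.
move=> x _; apply: loclip_cts; exists 1, 1; split=> // y z _ _.
rewrite mul1r; have -> : y - z = (y - a) - (z - a) by rewrite opprB addrA subrK.
exact: ler_dist_dist.
Qed.

End MatrixNorm.

Section ProdNorm.
Context {R : realType} {V W : normedModType R}.

Lemma prod_norm_le (p : ((V * W)%type : normedModType R)) e :
  (`|p| <= e) = (`|p.1| <= e) && (`|p.2| <= e).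
Proof. by rewrite [`|p|]prod_normE ge_max. Qed.

Lemma prod_norm_lt (p : ((V * W)%type : normedModType R)) e :
  (`|p| < e) = (`|p.1| < e) && (`|p.2| < e).
Proof. by rewrite [`|p|]prod_normE gt_max. Qed.

End ProdNorm.

Section LipschitzCompact.
Context {R : realType} {V W : normedModType R}.

(** On [K x K], pairs near the diagonal use a local constant, while pairs away from it have bounded
    values and a distance bounded below. Multiplying by [e] rather than dividing makes the estimate
    monotone in the scale. *)
Lemma lipschitz_compact (K : set V) (f : V -> W) : compact K ->
  (forall x, K x -> loclip f x) ->
  exists2 L : R, 0 < L & forall x y, K x -> K y -> `|f x - f y| <= L * `|x - y|.
Proof.
move=> cK lf.
have [||e e0 He] := @compact_uniform R (V * V)%type (K `*` K)
   (fun e p => `|f p.1 - f p.2| * e <= `|p.1 - p.2|) (compact_setX cK cK).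
- move=> e e' p ee'; apply: le_trans.
  by rewrite ler_wpM2l.
- move=> [x y] [/= Kx Ky]; have [<-|xy] := eqVneq x y.
    have [d [L [d0 L0 H]]] := lf x Kx.
    exists (Num.min d (L + 1)^-1); first by rewrite lt_min d0 invr_gt0 ltr_wpDl.
    move=> [x' y'] _; rewrite prod_norm_lt /= !lt_min => /andP[/andP[x'd _] /andP[y'd _]].
    have h1 := H x' y' x'd y'd.
    apply: le_trans (_ : `|f x' - f y'| * (L + 1)^-1 <= _).
      by rewrite ler_wpM2l // ge_min lexx orbT.
    rewrite ler_pdivrMr ?ltr_wpDl //; apply: le_trans h1 _.
    by rewrite mulrC ler_wpM2l // lerDl.
  have a0 : 0 < `|x - y| by rewrite normr_gt0 subr_eq0.
  have [d [M [d0 M0 H]]] := loclip_bounded (lf x Kx).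
  have [d' [M' [d'0 M'0 H']]] := loclip_bounded (lf y Ky).
  have MM0 : 0 < M + M' + 1 by rewrite ltr_wpDl // addr_ge0.
  exists (Num.min (Num.min d d') (Num.min (`|x - y| / 4) (`|x - y| / 2 / (M + M' + 1)))).
    by rewrite !lt_min d0 d'0 !divr_gt0.
  move=> [x' y'] _; rewrite prod_norm_lt /= !lt_min /=.
  move=> /andP[/andP[/andP[h1 _] /andP[h2 _]] /andP[/andP[_ h3] /andP[h4 _]]].
  apply: le_trans (_ : `|f x' - f y'| * (`|x - y| / 2 / (M + M' + 1)) <= _).
    by rewrite ler_wpM2l // !ge_min lexx !orbT.
  rewrite mulrA ler_pdivrMr //.
  have h5 : `|f x' - f y'| <= M + M' + 1.
    apply: le_trans (ler_normB _ _) _.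
    by have := H _ h1; have := H' _ h3; lra.
  rewrite [leRHS]mulrC; apply: ler_pM => //.
  have -> : x' - y' = (x - y) + ((x' - x) - (y' - y)).
    by rewrite opprB addrACA [x + _]addrC subrK addKr.
  have h6 := ler_normB (x - y + (x' - x - (y' - y))) (x' - x - (y' - y)).
  rewrite addrK in h6.
  by have := ler_normB (x' - x) (y' - y); lra.
exists e^-1; first by rewrite invr_gt0.
move=> x y Kx Ky; have := He (x, y) (conj Kx Ky) => /=.
by rewrite -ler_pdivlMr // mulrC.
Qed.

End LipschitzCompact.

(** * Strict differentiability of C^1 maps *)

Section StrictDiff.
Context {R : realType}.

Lemma derive_ebase n (W : normedModType R) (f : 'cV[R]_n -> W) x v :
  differentiable f x -> 'D_v f x = \sum_j v j 0 *: 'D_(ebase j) f x.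
Proof.
move=> df; rewrite deriveE //.
have {1}-> : v = \sum_j v j 0 *: ebase j.
  by rewrite {1}(matrix_sum_delta v); apply: eq_bigr => i _; rewrite big_ord1.
by rewrite linear_sum; apply: eq_bigr => j _; rewrite linearZ /= deriveE.
Qed.

Lemma derive_Jac n p (f : 'cV[R]_n -> 'cV[R]_p) x v :
  differentiable f x -> 'D_v f x = Jac f x *m v.
Proof.
move=> df; rewrite derive_ebase //; apply/colP => i.
by rewrite summxE !mxE; apply: eq_bigr => j _; rewrite !mxE mulrC.
Qed.

Lemma is_derive_comp n (W : normedModType R) (U : R -> 'cV[R]_n) (x : R)
    (g : 'cV[R]_n -> W) :
  derivable U x 1 -> differentiable g (U x) ->
  is_derive x 1 (fun t => g (U t)) ('D_('D_1 U x) g (U x)).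
Proof.
move=> /derivable1_diffP dU dg.
have dc : differentiable (g \o U) x by exact: differentiable_comp.
apply: DeriveDef; first exact/derivable1_diffP.
by rewrite !deriveE // diff_comp.
Qed.

(** Both points vary, unlike in differentiability at [s]. Along the segment from [V] to [U], the map
    minus its linearisation at [s] has a derivative controlled by the oscillation of the partial
    derivatives near [s]. *)
Lemma strict_diff n p (D : set 'cV[R]_n) (f : 'cV[R]_n -> 'cV[R]_p) s e :
  open D -> Ck 1 D f -> D s -> 0 < e ->
  exists2 d : R, 0 < d & forall U V, `|U - s| < d -> `|V - s| < d ->
    `|f U - f V - Jac f s *m (U - V)| <= e * `|U - V|.
Proof.
move=> oD [df cf] Ds e0.
(* Each of the n partial derivatives gets a share of [e]; the successor covers n = 0. *)
have eta0 : 0 < e / n.+1%:R by rewrite divr_gt0.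
have : \forall y \near s, D y /\
    forall j : 'I_n, `|'D_(ebase j) f s - 'D_(ebase j) f y| < e / n.+1%:R.
  near=> y; split; first by near: y; exact: open_nbhs_nbhs.
  near: y; apply: filter_forall => j.
  by have /cvgrPdist_lt /(_ _ eta0) := cf (ebase j) s Ds.
move=> /nbhs_ballP[d /= d0 dP]; exists d => // U V Us Vs.
pose g (t : R) := V + t *: (U - V).
have gP t : 0 < t < 1 -> D (g t) /\
    forall j : 'I_n, `|'D_(ebase j) f s - 'D_(ebase j) f (g t)| < e / n.+1%:R.
  move=> /andP[t0 t1]; apply: dP; apply/ball_distE.
  have -> : g t - s = t *: (U - s) + (1 - t) *: (V - s).
    by apply/colP => i; rewrite !mxE; ring.
  apply: le_lt_trans (ler_normD _ _) _; rewrite !normrZ (gtr0_norm t0) gtr0_norm ?subr_gt0 //.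
  have h1 : t * `|U - s| < t * d by rewrite ltr_pM2l.
  have h2 : (1 - t) * `|V - s| < (1 - t) * d by rewrite ltr_pM2l // subr_gt0.
  by have := ltrD h1 h2; rewrite (_ : t * d + (1 - t) * d = d) //; ring.
have gd (t : R) : is_derive t 1 g (U - V).
  apply: is_derive_col => i.
  have -> : (fun t : R => g t i 0) = (fun t => V i 0 + t * (U - V) i 0).
    by apply/funext => t'; rewrite !mxE.
  by apply: is_derive_eq; rewrite /GRing.scale /= !mxE; ring.
pose w (t : R) := f (g t) - t *: (Jac f s *m (U - V)).
have wd (t : R) : D (g t) ->
    is_derive t 1 w ('D_(U - V) f (g t) - Jac f s *m (U - V)).
  move=> Dg; have dg := gd t.
  have d1 := is_derive_comp (ex_derive) (df _ Dg); rewrite derive_val in d1.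
  have d2 : is_derive t 1 (fun t : R => t *: (Jac f s *m (U - V))) (Jac f s *m (U - V)).
    apply: is_derive_col => i.
    have -> : (fun t : R => (t *: (Jac f s *m (U - V))) i 0) =
        (fun t => t * (Jac f s *m (U - V)) i 0).
      by apply/funext => t'; rewrite mxE.
    by apply: is_derive_eq; rewrite /GRing.scale /=; ring.
  exact: is_deriveB.
have Dg t : 0 <= t <= 1 -> D (g t).
  move=> t01; apply: (dP _ _).1; apply/ball_distE.
  have -> : g t - s = t *: (U - s) + (1 - t) *: (V - s).
    by apply/colP => i; rewrite !mxE; ring.
  apply: le_lt_trans (ler_normD _ _) _; rewrite !normrZ.
  move: t01 => /andP[t0 t1].
  rewrite (ger0_norm t0) ger0_norm ?subr_ge0 //.
  have h1 : t * `|U - s| <= t * Num.max `|U - s| `|V - s|.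
    by rewrite ler_wpM2l // le_max lexx.
  have h2 : (1 - t) * `|V - s| <= (1 - t) * Num.max `|U - s| `|V - s|.
    by rewrite ler_wpM2l ?subr_ge0 // le_max lexx orbT.
  have h3 : Num.max `|U - s| `|V - s| < d by rewrite gt_max Us.
  by move: h1 h2 h3; set M := Num.max _ _; nra.
have -> : f U - f V - Jac f s *m (U - V) = w 1 - w 0.
  rewrite /w /g !scale0r !scale1r subr0 addr0 addrC.
  by rewrite [V + _]addrC subrK addrC addrAC.
have -> : e * `|U - V| = e * `|U - V| * 1 - e * `|U - V| * 0 by rewrite mulr1 mulr0 subr0.
apply: (@norm_increment_le _ _ w (fun t => e * `|U - V| * t) (fun=> e * `|U - V|)) => //.
- apply: derivable_within_continuous => t; rewrite in_itv /= => t01.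
  by have dw := wd t (Dg t t01); exact: ex_derive.
- move=> t /andP[t0 t1]; have dw := wd t (Dg t _); apply: ex_derive; apply: dw.
  by rewrite !ltW.
- by move=> t; apply: is_derive_eq; rewrite /GRing.scale /= mulr1.
move=> t t01; have [Dgt close] := gP t t01.
have dw := wd t Dgt; rewrite derive_val.
rewrite derive_Jac; last exact: df.
rewrite -mulmxBl; apply: cnorm_le => [|i]; first by rewrite mulr_ge0 // ltW.
rewrite mxE; apply: le_trans (ler_norm_sum _ _ _) _.
apply: (@le_trans _ _ (\sum_(j < n) e / n.+1%:R * `|U - V|)).
  apply: ler_sum => j _; rewrite normrM ler_pM // ?cnorm_ge //.
  apply: le_trans (ltW (close j)); rewrite distrC.
  by have := cnorm_ge ('D_(ebase j) f (g t) - 'D_(ebase j) f s) i; rewrite !mxE.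
rewrite sumr_const card_ord -mulrnAl ler_wpM2r // -mulr_natr mulrAC.
by rewrite ler_pdivrMr // ler_wpM2l ?(ltW e0) // ler_nat.
Unshelve. all: by end_near. Qed.

Lemma Ck1_loclip n p (D : set 'cV[R]_n) (f : 'cV[R]_n -> 'cV[R]_p) s :
  open D -> Ck 1 D f -> D s -> loclip f s.
Proof.
move=> oD cf Ds; have [d d0 H] := strict_diff oD cf Ds ltr01.
exists d, (1 + n%:R * `|Jac f s|); split=> // y z yd zd.
have -> : f y - f z = (f y - f z - Jac f s *m (y - z)) + Jac f s *m (y - z).
  by rewrite subrK.
apply: le_trans (ler_normD _ _) _; rewrite mulrDl lerD //; first exact: H.
exact: mulmx_norm_le.
Qed.

Lemma loclip_coord (V : normedModType R) p q (f : V -> 'M[R]_(p, q)) x :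
  loclip f x -> mloclip f x.
Proof.
move=> [d [L [d0 L0 H]]] i j; exists d, L; split=> // y z yd zd.
apply: le_trans (H y z yd zd).
by have := mx_norm_ge (f y - f z) i j; rewrite !mxE.
Qed.

Lemma Ck1_mloclip n p q (D : set 'cV[R]_n) (f : 'cV[R]_n -> 'M[R]_(p, q)) s :
  open D -> Ck 1 D f -> D s -> mloclip f s.
Proof.
move=> oD [df cf] Ds i j.
(* One entry viewed as a column of height one, to which [Ck1_loclip] applies. *)
pose g (U : 'cV[R]_n) : 'cV[R]_1 := const_mx (f U i j).
have dfij x : D x -> differentiable (fun U => f U i j) x.
  move=> Dx; apply: (@differentiable_comp _ _ _ _ f (fun M : 'M[R]_(p, q) => M i j)).
    exact: df.
  exact: differentiable_coord.
have dg x : D x -> differentiable g x.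
  move=> Dx; pose k := (fun t : R => const_mx t : 'cV[R]_1).
  apply: (@differentiable_comp _ _ _ _ (fun U => f U i j) k); first exact: dfij.
  apply/derivable1_diffP.
  have dk : is_derive (f x i j) 1 k (const_mx 1).
    apply: is_derive_col => i'.
    by rewrite /k mxE; under eq_fun do rewrite mxE; exact: is_derive_id.
  exact: ex_derive.
have Dgv v x : D x -> 'D_v g x = const_mx (('D_v f x) i j).
  move=> Dx; rewrite derive_mx; last exact/diff_derivable/dg.
  rewrite (derive_mx (M := f)); last exact/diff_derivable/df.
  apply/matrixP => a b; rewrite !mxE.
  by congr ('D_v _ x); apply/funext => U; rewrite mxE.
have g1 : Ck 1 D g.
  split=> // v x Dx.
  have cfx : {for x, continuous (fun y => ('D_v f y) i j)}.
    apply: (@continuous_comp _ _ _ ('D_v f) (fun M : 'M[R]_(p, q) => M i j)).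
      exact: cf.
    exact: coord_continuous.
  apply: continuous_coord => k.
  have E : \forall y \near x, ('D_v f y) i j = ('D_v g y) k 0.
    by near=> y; rewrite Dgv ?mxE //; near: y; exact: open_nbhs_nbhs.
  apply: cvg_trans (near_eq_cvg E) _.
  by rewrite Dgv // mxE.
have := loclip_coord (Ck1_loclip oD g1 Ds) 0 0.
by under eq_fun do rewrite mxE.
Unshelve. all: by end_near. Qed.

End StrictDiff.

Section Clamp.
Context {R : realType}.

Definition clamp (a b t : R) : R := Num.max a (Num.min b t).

Lemma clamp_id a b t : a <= t <= b -> clamp a b t = t.
Proof. by move=> /andP[at_ tb]; rewrite /clamp min_r // max_r. Qed.

Lemma clamp_itv a b t : a <= b -> a <= clamp a b t <= b.
Proof. by move=> ab; rewrite /clamp le_max lexx /= ge_max ab ge_min lexx. Qed.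

Lemma clamp_lip a b s t : `|clamp a b s - clamp a b t| <= `|s - t|.
Proof.
have w (x y : R) : x <= y -> `|clamp a b x - clamp a b y| <= `|x - y|.
  move=> xy; have -> : `|x - y| = y - x by rewrite distrC ger0_norm ?subr_ge0.
  rewrite /clamp ler_norml.
  by case: (lerP b x) => ?; case: (lerP b y) => ?; case: (lerP a b) => ?;
    case: (lerP a x) => ?; case: (lerP a y) => ?; apply/andP; split; lra.
by have [st|st] := orP (le_total s t); [|rewrite (distrC (clamp a b s)) (distrC s)]; exact: w.
Qed.

Definition vclamp n (d : R) (w : 'cV[R]_n) : 'cV[R]_n := \col_i clamp (- d) d (w i 0).

Lemma vclamp_id n d (w : 'cV[R]_n) : `|w| <= d -> vclamp d w = w.
Proof.
move=> wd; apply/colP => i; rewrite mxE clamp_id //.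
by rewrite -ler_norml; apply: le_trans (cnorm_ge _ _) wd.
Qed.

Lemma vclamp_le n d (w : 'cV[R]_n) : 0 <= d -> `|vclamp d w| <= d.
Proof.
move=> d0; apply: cnorm_le => // i; rewrite mxE ler_norml; apply: clamp_itv; lra.
Qed.

Lemma vclamp_lip n d (v w : 'cV[R]_n) : `|vclamp d v - vclamp d w| <= `|v - w|.
Proof.
apply: cnorm_le => // i; rewrite !mxE; apply: le_trans (clamp_lip _ _ _ _) _.
by have := cnorm_ge (v - w) i; rewrite !mxE.
Qed.

End Clamp.

Lemma pair_continuous (T U V : topologicalType) (f : T -> U) (g : T -> V) x :
  {for x, continuous f} -> {for x, continuous g} ->
  {for x, continuous (fun y => (f y, g y))}.
Proof. by move=> cf cg; exact: (cvg_pair cf cg). Qed.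

(** * Uniqueness and dependence on the parameter *)

Section ODE.
Context {R : realType} {n m : nat}.
Variables (D : set 'cV[R]_n) (G : 'cV[R]_n * 'cV[R]_m -> 'cV[R]_n).
Hypothesis D_open : open D.
Hypothesis G_lip : forall U c, D U -> loclip G (U, c).

Definition ode_sol (c : 'cV[R]_m) (T : R) (U : R -> 'cV[R]_n) :=
  [/\ {within `[0, T], continuous U}, forall x, 0 <= x <= T -> D (U x)
    & forall x : R, 0 < x < T -> is_derive x 1 U (G (U x, c))].

Lemma orbit_compact T (U : R -> 'cV[R]_n) : {within `[0, T], continuous U} ->
  compact (U @` `[0, T]).
Proof. by move=> cU; apply: continuous_compact => //; exact: segment_compact. Qed.

Lemma ode_unique c T U1 U2 : 0 <= T -> ode_sol c T U1 -> ode_sol c T U2 ->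
  U1 0 = U2 0 -> forall x, 0 <= x <= T -> U1 x = U2 x.
Proof.
move=> T0 [c1 D1 d1] [c2 D2 d2] U12.
pose K := (U1 @` `[0, T] `|` U2 @` `[0, T]) `*` [set c].
have cK : compact K.
  by apply: compact_setX; [apply: compactU; exact: orbit_compact|exact: compact_set1].
have [|L L0 lipG] := lipschitz_compact cK (f := G).
  move=> [U c'] [/= + ->] => -[] [x xT <-]; apply: G_lip.
    by apply: D1; rewrite /= in_itv in xT.
  by apply: D2; rewrite /= in_itv in xT.
have dw (x : R) : 0 < x < T ->
    is_derive x 1 (fun t => U1 t - U2 t) (G (U1 x, c) - G (U2 x, c)).
  by move=> xT; exact: (is_deriveB (d1 x xT) (d2 x xT)).
move=> x xT; apply/eqP; rewrite -subr_eq0 -normr_le0.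
have := @gronwall _ _ (fun t => U1 t - U2 t) L 0 T L0 (lexx _) T0.
rewrite mulr0 !mul0r; apply => //; last 2 first.
- by rewrite U12 subrr.
- move=> y yT; have dy := dw y yT; split; first exact: ex_derive.
  rewrite derive_val addr0.
  have yT' : 0 <= y <= T by case/andP: yT => y0 y1; rewrite !ltW.
  have h := lipG (U1 y, c) (U2 y, c).
  apply: le_trans (h _ _) _.
  + by split=> //=; left; exists y; rewrite //= in_itv.
  + by split=> //=; right; exists y; rewrite //= in_itv.
  rewrite ler_wpM2l ?(ltW L0) // prod_norm_le /= lexx /=.
  by rewrite subrr normr0.
by move=> t; apply: cvgB; [exact: c1|exact: c2].
Qed.

(** The unknown is the difference [w] from the reference solution. Truncating [w] at radius [d]
    makes its equation globally Lipschitz, so [picard] applies; Gronwall's inequality then gives |w|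
    <= C |c - c0| <= d, so that the truncation was never active. Existence on the whole of [0, T]
    and Lipschitz dependence on [c] come out together. *)
Lemma ode_stable c0 T U0 : 0 <= T -> ode_sol c0 T U0 ->
  exists d C : R, [/\ 0 < d, 0 <= C & forall c, `|c - c0| < d ->
    exists U, [/\ ode_sol c T U, U 0 = U0 0 &
      forall x, 0 <= x <= T -> `|U x - U0 x| <= C * `|c - c0|]].
Proof.
move=> T0 [cU DU dU].
pose O := U0 @` `[0, T]; have cO : compact O by exact: orbit_compact.
have OP x : 0 <= x <= T -> O (U0 x) by move=> xT; exists x; rewrite //= in_itv.
have [d d0 dD] : exists2 d : R, 0 < d & forall z, O z -> forall y, `|y - z| <= d -> D y.
  apply: compact_uniform => // [e e' z ee' Q y yz|z [x xT <-]].
    by apply: Q; apply: le_trans ee'.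
  have Dx : D (U0 x) by apply: DU; rewrite /= in_itv in xT.
  have /nbhs_ballP[e /= e0 eD] : nbhs (U0 x) D by exact: open_nbhs_nbhs.
  exists (e / 2); first by rewrite divr_gt0.
  move=> z' _ z'x y yz; apply: eD; apply/ball_distE.
  have -> : y - U0 x = (y - z') + (z' - U0 x) by rewrite addrA subrK.
  by apply: le_lt_trans (ler_normD _ _) _; lra.
(* The closed tube of radius [d] around the orbit, compact as the image of a compact product. *)
pose N := (fun p : 'cV[R]_n * 'cV[R]_n => p.1 + p.2) @` (O `*` [set z | `|z - 0| <= d]).
have cN : compact N.
  apply: continuous_compact; last by apply: compact_setX => //; exact: closed_ball_compact.
  by apply: continuous_subspaceT => p; apply: cvgD; [exact: cvg_fst|exact: cvg_snd].
have ND z : N z -> D z.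
  by move=> [[a b] [/= Oa]]; rewrite subr0 => bd <-; apply: (dD a Oa); rewrite addrC addKr.
pose K := N `*` [set c : 'cV[R]_m | `|c - c0| <= 1].
have cK : compact K by apply: compact_setX => //; exact: closed_ball_compact.
have [|L L0 lipG] := lipschitz_compact cK (f := G).
  by move=> [U c'] [/= NU _]; apply: G_lip; exact: ND.
pose C := 2 * L * T * expR (2 * L * T).
have C0 : 0 <= C by rewrite !mulr_ge0 ?expR_ge0 // ltW.
have C1 : 0 < C + 1 by rewrite ltr_wpDl.
exists (Num.min 1 (d / (C + 1))), C; split=> //; first by rewrite lt_min ltr01 divr_gt0.
move=> c; rewrite lt_min => /andP[cc1 ccd].
(* Extends the reference solution by constants, since [picard] works with continuous data on the
   whole line. *)
pose V x := U0 (clamp 0 T x).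
have cl x : 0 <= clamp 0 T x <= T by exact: clamp_itv.
have VO x : O (V x) by exact: OP.
have cV : continuous V.
  move=> x; apply/cvgrPdist_lt => e e0.
  have /cont_onP cU' := cU.
  have [|b b0 bP] := cU' (clamp 0 T x) _ e e0; first by rewrite /= in_itv; exact: cl.
  apply: (@near_dist R R^o x b _ b0) => y yx; rewrite distrC; apply: bP; first by rewrite /= in_itv; exact: cl.
  by apply: le_lt_trans yx; exact: clamp_lip.
have VN x z : `|z| <= d -> N (V x + z).
  by move=> zd; exists (V x, z) => //; split=> //=; rewrite subr0.
pose H x w := G (V x + vclamp d w, c) - G (V x, c0).
have d0' := ltW d0.
have KV x w : K (V x + vclamp d w, c).
  by split=> /=; [apply: VN; exact: vclamp_le|exact: ltW].
have lipH x u v : `|H x u - H x v| <= L * `|u - v|.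
  rewrite /H opprB addrA subrK; apply: le_trans (lipG _ _ (KV _ _) (KV _ _)) _.
  rewrite ler_wpM2l ?(ltW L0) // prod_norm_le /= subrr normr0 normr_ge0 andbT.
  by rewrite opprD addrACA subrr add0r; exact: vclamp_lip.
have v0 : vclamp d (0 : 'cV[R]_n) = 0 by rewrite vclamp_id // normr0.
have bndH x : `|H x 0| <= L * `|c - c0|.
  have KV0 : K (V x, c0).
    by split=> /=; [rewrite -[V x]addr0; apply: VN; rewrite normr0|rewrite subrr normr0].
  apply: le_trans (lipG _ _ (KV _ _) KV0) _.
  rewrite ler_wpM2l ?(ltW L0) // prod_norm_le /= v0 addr0 subrr normr0 lexx andbT.
  exact: normr_ge0.
have ctsH w : continuous w -> continuous (fun x => H x (w x)).
  move=> cw x; apply: cvgB.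
    apply: (@continuous_comp _ _ _ (fun x => (V x + vclamp d (w x), c)) G).
      apply: pair_continuous; last exact: cvg_cst.
      apply: cvgD; first exact: cV.
      apply: (@continuous_comp _ _ _ w (vclamp d)); first exact: cw.
      apply: loclip_cts; exists 1, 1; split=> // y z _ _.
      by rewrite mul1r; exact: vclamp_lip.
    by apply: loclip_cts; apply: G_lip; apply: ND; have [] := KV x (w x).
  apply: (@continuous_comp _ _ _ (fun x => (V x, c0)) G).
    by apply: pair_continuous; [exact: cV|exact: cvg_cst].
  apply: loclip_cts; apply: G_lip; apply: ND; rewrite -[V x]addr0; apply: VN.
  by rewrite normr0.
have [w [cw w0 dw]] := picard L0 (mulr_ge0 (ltW L0) (normr_ge0 (c - c0))) lipH bndH ctsH.
have wC x : 0 <= x <= T -> `|w x| <= C * `|c - c0|.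
  move=> xT.
  have -> : C * `|c - c0| = 2 * (L * `|c - c0|) * T * expR (2 * L * T) by rewrite /C; ring.
  apply: (gronwall L0) => //; first by rewrite mulr_ge0 // ltW.
    exact: continuous_subspaceT.
  move=> y /andP[y0 yT]; have dy := dw y y0; split; first exact: ex_derive.
  rewrite derive_val -[H y (w y)](subrK (H y 0)).
  apply: le_trans (ler_normD _ _) _; rewrite lerD //.
  by apply: le_trans (lipH _ _ _) _; rewrite subr0.
have wd x : 0 <= x <= T -> `|w x| <= d.
  move=> xT; apply: le_trans (wC x xT) _.
  move: ccd; rewrite ltr_pdivlMr // => /ltW; apply: le_trans.
  by rewrite mulrC ler_wpM2l // lerDl.
have Vx x : 0 <= x <= T -> V x = U0 x by move=> xT; rewrite /V clamp_id.
exists (fun x => V x + w x); split.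
- split.
  + by apply: continuous_subspaceT => x; apply: cvgD; [exact: cV|exact: cw].
  + by move=> x xT; apply: ND; apply: VN; exact: wd.
  + move=> x /andP[x0 xT]; have xT' : 0 <= x <= T by rewrite !ltW.
    have dV : is_derive x 1 V (G (U0 x, c0)).
      apply: (@near_eq_is_derive _ _ _ U0); last by apply: dU; rewrite x0.
      near=> y; rewrite Vx //; apply/andP; split; apply: ltW; near: y.
        exact: lt_nbhsr.
      exact: lt_nbhsl.
    apply: is_derive_eq (is_deriveD dV (dw x x0)) _.
    by rewrite /H Vx // vclamp_id ?wd // addrC subrK.
- by rewrite w0 addr0 Vx // lexx.
- by move=> x xT; rewrite Vx // addrC addKr; exact: wC.
Unshelve. all: by end_near. Qed.

End ODE.

(** * The system *)

Section Spectra.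
Local Open Scope sesquilinear_scope.
Context {R : realType}.

Lemma pos_spectrum_unitmx n (A : 'M[R]_n) : real_pos_spectrum A -> A \in unitmx.
Proof.
move=> sA; apply/negPn/negP => nuA.
have : eigenvalue (map_mx (real_complex R) A) 0.
  by rewrite /eigenvalue /eigenspace raddf0 subr0 kermx_eq0 row_free_unit map_unitmx.
by move=> /sA [a [[<-]]]; rewrite ltxx.
Qed.

(** The complexified matrix is Hermitian, hence unitarily diagonalisable; in an eigenbasis the form
    is a sum of the |y_j|^2 with positive weights, which vanishes only at zero. *)
Lemma pos_spectrum_sym_posdef n (A : 'M[R]_n) (v : 'cV[R]_n) :
  A^T = A -> real_pos_spectrum A -> qform A v = 0 -> v = 0.
Proof.
move=> symA sA qv.
pose C := R[i]; pose rc := real_complex R.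
pose Ac : 'M[C]_n := map_mx rc A.
have rcconj (a : R) : Num.conj (rc a) = rc a by exact: conjc_real.
have Ach : Ac ^t* = Ac.
  by apply/matrixP => i j; rewrite !mxE rcconj -[in RHS]symA mxE.
have /orthomx_spectralP AcE : Ac \is normalmx by apply/normalmxP; rewrite Ach.
pose P := spectralmx Ac; pose sp := spectral_diag Ac.
have Pu : P \in unitmx by exact: spectral_unit.
have PU : P \is unitarymx by exact: spectral_unitarymx.
have spE i : exists a : R, sp 0 i = rc a /\ 0 < a.
  apply: sA; apply/eigenvalueP; exists (row i P).
    rewrite -row_mul -/Ac AcE -/P -/sp !mulmxA mulmxV // mul1mx.
    by rewrite row_mul row_diag_mx -scalemxAl -rowE.
  apply/negP => /eqP r0.
  have : row i (P *m invmx P) = 0 by rewrite row_mul r0 mul0mx.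
  rewrite mulmxV // => /rowP/(_ i); rewrite !mxE eqxx => /eqP.
  by rewrite oner_eq0.
pose x : 'rV[C]_n := map_mx rc v^T.
pose y := x *m P ^t*.
have xE : x = y *m P by rewrite /y -invmx_unitary // mulmxKV.
have q0 : (y *m diag_mx sp *m y ^t*) 0 0 = 0.
  have -> : y ^t* = P *m x^T.
    rewrite /y trmx_mul map_mxM trmxCK; congr (_ *m _).
    by apply/matrixP => i j; rewrite !mxE; exact: rcconj.
  have -> : y *m diag_mx sp *m (P *m x^T) = x *m Ac *m x^T.
    by rewrite AcE invmx_unitary // !mulmxA.
  have -> : x *m Ac *m x^T = map_mx rc (v^T *m A *m v).
    by rewrite !map_mxM /x map_trmx trmxK.
  by rewrite mxE -/(qform A v) qv.
have y0 : y = 0.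
  apply/rowP => i; rewrite [RHS]mxE; apply/eqP; rewrite -normr_eq0.
  have sum0 : \sum_j sp 0 j * `|y 0 j| ^+ 2 = 0.
    rewrite -[RHS]q0 mxE; apply: eq_bigr => j _.
    by rewrite mul_mx_diag !mxE normCK mulrA [sp 0 j * _]mulrC.
  have pos j : 0 <= sp 0 j * `|y 0 j| ^+ 2.
    have [a [-> a0]] := spE j; rewrite mulr_ge0 ?exprn_ge0 //.
    by rewrite /rc lecE /= eqxx ltW.
  move/eqP: sum0; rewrite psumr_eq0 // => /allP /(_ i (mem_index_enum _)) /=.
  have [a [-> a0]] := spE i; rewrite mulf_eq0 expf_eq0 /= => /orP[|//].
  by move=> /eqP [a00]; move: a0; rewrite a00 ltxx.
have : x = 0 by rewrite xE y0 mul0mx.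
move=> /rowP x0; apply/colP => i; have := x0 i; rewrite !mxE => -[].
by [].
Qed.

(** A kernel vector of [B22 U] is also killed by S, the product of the inverse of [df0_IIII] with
    [B22], so the definite form of S + S^T vanishes on it. *)
Lemma parabolic_unitmx r m (f0 : 'cV[R]_(r + m) -> 'cV[R]_(r + m))
    (B22 : 'cV[R]_(r + m) -> 'M[R]_m) U :
  f0_structure f0 U -> parabolicity f0 B22 U -> B22 U \in unitmx.
Proof.
move=> [_ _ det0] par.
rewrite -unitmx_tr -row_free_unit -kermx_eq0; apply/eqP/row_matrixP => i.
rewrite row0; set w := row i _.
have Bw : B22 U *m w^T = 0.
  have : w *m (B22 U)^T = 0 by rewrite /w -row_mul mulmx_ker row0.
  by move/(congr1 trmx); rewrite trmx_mul trmxK trmx0.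
apply: trmx_inj; rewrite trmx0.
apply: (pos_spectrum_sym_posdef (A := invmx (df0_IIII f0 U) *m B22 U +
   (invmx (df0_IIII f0 U) *m B22 U)^T)) => //.
  by rewrite linearD /= trmxK addrC.
rewrite /qform mulmxDr mulmxDl -!mulmxA Bw !mulmx0 add0r.
by rewrite trmx_mul !mulmxA -trmx_mul Bw trmx0 !mul0mx mxE.
Qed.

End Spectra.

Section DeriveEps.
Context {R : realType} {n : nat}.

Lemma is_derive_eps (w : R -> 'cV[R]_n) (x : R) v :
  is_derive x 1 w v <->
  forall e, 0 < e -> exists2 d, 0 < d & forall y : R, `|y - x| < d ->
    `|w y - w x - (y - x) *: v| <= e * `|y - x|.
Proof.
split=> [[dw dE] e e0|H].
  have : h^-1 *: (w (h *: 1 + x) - w x) @[h --> (0 : R)^'] --> v.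
    by rewrite -dE; exact: dw.
  move=> /cvgrPdist_lt /(_ e e0) /nbhs_ballP[d /= d0 dP].
  exists d => // y yx; have [->|yx0] := eqVneq y x.
    by rewrite !subrr scale0r subrr !normr0 mulr0.
  have h0 : y - x != 0 by rewrite subr_eq0.
  have := dP (y - x); rewrite /ball /= sub0r normrN => /(_ yx h0).
  rewrite /GRing.scale /= mulr1 subrK => H.
  have -> : w y - w x - (y - x) *: v = - (y - x) *: (v - (y - x)^-1 *: (w y - w x)).
    by rewrite scalerBr scalerA mulNr divff // scaleN1r opprK scaleNr addrC.
  by rewrite normrZ normrN mulrC ler_pM2r ?normr_gt0 // ltW.
have cv : h^-1 *: (w (h *: 1 + x) - w x) @[h --> (0 : R)^'] --> v.
  apply/cvgrPdist_le => e e0; have [d d0 dP] := H e e0.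
  apply/nbhs_ballP; exists d => //= h; rewrite /ball /= sub0r normrN => hd h0.
  have := dP (h + x); rewrite addrK => /(_ hd) H1.
  rewrite /GRing.scale /= mulr1.
  have -> : v - h^-1 *: (w (h + x) - w x) = (- h^-1) *: (w (h + x) - w x - h *: v).
    by rewrite [RHS]scalerBr scalerA mulNr mulVf // scaleN1r opprK scaleNr addrC.
  by rewrite normrZ normrN normfV mulrC ler_pdivrMr ?normr_gt0.
apply: DeriveDef; first by apply/cvg_ex; exists v.
by apply/cvg_lim.
Qed.

Lemma is_derive_usub p q (w : R -> 'cV[R]_(p + q)) (x : R) v :
  is_derive x 1 w v -> is_derive x 1 (fun y => usubmx (w y)) (usubmx v).
Proof.
move=> [dw <-]; apply: is_derive_col => i; rewrite mxE.
under eq_fun do rewrite mxE; exact: derive_coord.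
Qed.

Lemma is_derive_dsub p q (w : R -> 'cV[R]_(p + q)) (x : R) v :
  is_derive x 1 w v -> is_derive x 1 (fun y => dsubmx (w y)) (dsubmx v).
Proof.
move=> [dw <-]; apply: is_derive_col => i; rewrite mxE.
under eq_fun do rewrite mxE; exact: derive_coord.
Qed.

End DeriveEps.

(** * The profile equation as an ordinary differential equation *)

Section System.
Context {R : realType} {r m : nat}.
Local Notation state := 'cV[R]_(r + m).
Variables (D : set state) (f : state -> state) (B22 : state -> 'M[R]_m).
Hypotheses (D_open : open D) (f_smooth : smooth D f) (B_smooth : smooth D B22).
Hypothesis A_unit : forall U, D U -> dfI_I f U \in unitmx.
Hypothesis B_unit : forall U, D U -> B22 U \in unitmx.
Variable U0 : state.
Hypothesis U0_in : D U0.

Definition visc_rhs (p : state * 'cV[R]_m) : 'cV[R]_m :=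
  dsubmx (f p.1) - dsubmx (f U0) + B22 U0 *m p.2.

(* Differentiating f_I(U) = f_I(U0) turns the constrained profile equation into
   an ordinary differential equation for the whole state. *)
Definition vfield (p : state * 'cV[R]_m) : state :=
  let V := adjinv (B22 p.1) *m visc_rhs p in
  col_mx (- (adjinv (dfI_I f p.1) *m (ursubmx (Jac f p.1) *m V))) V.

Lemma Jac_usub (U v : state) : usubmx (Jac f U *m v) =
  dfI_I f U *m usubmx v + ursubmx (Jac f U) *m dsubmx v.
Proof.
by rewrite -mul_usub_mx -[usubmx (Jac f U)]hsubmxK -{1}[v]vsubmxK mul_row_col.
Qed.

Lemma f_C1 : Ck 1 D f. Proof. exact: f_smooth. Qed.

Lemma mloclip_Jac U : D U -> mloclip (Jac f) U.
Proof.
move=> DU i j; under eq_fun do rewrite mxE.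
have H : Ck 1 D ('D_(ebase j) f) by have [_ /(_ (ebase j))] := f_smooth 2.
exact: (loclip_coord (Ck1_loclip D_open H DU) i 0).
Qed.

Lemma mloclip_fst (W : normedModType R) p q (g : state -> 'M[R]_(p, q)) U (c : W) :
  mloclip g U -> mloclip (fun z : state * W => g z.1) (U, c).
Proof.
move=> lg i j; have [d [L [d0 L0 H]]] := lg i j.
exists d, L; split=> // y z; rewrite !prod_norm_lt => /andP[yd _] /andP[zd _].
apply: le_trans (H _ _ yd zd) _; rewrite ler_wpM2l //.
by have := prod_norm_le (y - z) `|y - z|; rewrite lexx => /esym/andP[].
Qed.

Lemma mloclip_snd (W : normedModType R) p (U : W) (c : 'cV[R]_p) :
  mloclip (fun z : W * 'cV[R]_p => z.2) (U, c).
Proof.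
move=> i j; exists 1, 1; split=> // y z _ _; rewrite mul1r ord1.
have := prod_norm_le (y - z) `|y - z|; rewrite lexx => /esym/andP[_ h].
by apply: le_trans h; have := cnorm_ge (y - z).2 i; rewrite !mxE.
Qed.

Lemma loclip_vfield U c : D U -> loclip vfield (U, c).
Proof.
move=> DU; apply: loclip_mx.
have lf := loclip_coord (Ck1_loclip D_open f_C1 DU).
have lV : mloclip (fun p : state * 'cV[R]_m => adjinv (B22 p.1) *m visc_rhs p) (U, c).
  apply: mloclipM.
    apply: mloclip_adjinv; first by rewrite -unitfE -unitmxE B_unit.
    apply: (mloclip_fst (g := B22)).
    by apply: Ck1_mloclip D_open _ DU; exact: B_smooth.
  apply: mloclipD; last by apply: mloclipM; [exact: mloclip_cst|exact: mloclip_snd].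
  apply: mloclipD; last exact: mloclip_cst.
  apply: (mloclip_fst (g := fun U => dsubmx (f U))) => i j.
  under eq_fun do rewrite mxE; exact: lf.
move=> i j; case: (split_ordP i) => k ->; under eq_fun do
  rewrite /vfield ?col_mxEu ?col_mxEd; last exact: lV.
apply: mloclipN; apply: mloclipM.
  apply: mloclip_adjinv; first by rewrite -unitfE -unitmxE A_unit.
  apply: (mloclip_fst (g := dfI_I f)) => a b.
  under eq_fun do rewrite /dfI_I /ulsubmx 2!mxE; exact: mloclip_Jac.
apply: mloclipM; last exact: lV.
apply: (mloclip_fst (g := fun U => ursubmx (Jac f U))) => a b.
under eq_fun do rewrite /ursubmx 2!mxE; exact: mloclip_Jac.
Qed.

(** A quantitative form of the uniqueness part of the implicit function theorem. Equality of f_I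
    turns strict differentiability into [A] (U - V)_I + [Bm] (U - V)_II = 0 up to a small error, and
    [A] is invertible. *)
Lemma sheet s : D s -> exists d C : R, [/\ 0 < d, 0 <= C & forall U V,
  `|U - s| < d -> `|V - s| < d -> usubmx (f U) = usubmx (f V) ->
  `|U - V| <= C * `|dsubmx U - dsubmx V|].
Proof.
move=> Ds; pose A := dfI_I f s; pose Bm := ursubmx (Jac f s).
pose a := r%:R * `|invmx A|; pose b := m%:R * `|Bm|.
have a0 : 0 <= a by rewrite mulr_ge0.
have b0 : 0 <= b by rewrite mulr_ge0.
have a1 : 0 < 2 * (a + 1) by rewrite mulr_gt0 // ltr_wpDl.
(* With this tolerance the error, amplified by [a], is at most half of |U - V| and can be
   absorbed. *)
have [|d d0 dP] := strict_diff (e := (2 * (a + 1))^-1) D_open f_C1 Ds.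
  by rewrite invr_gt0.
exists d, (2 * a * b + 2); split=> //; first by rewrite addr_ge0 // !mulr_ge0.
move=> U V Us Vs fUV; have := dP U V Us Vs; set E := _ - _ *m _ => EP.
have uE : usubmx E = - (A *m usubmx (U - V) + Bm *m dsubmx (U - V)).
  have uB (x y : state) : usubmx (x - y) = usubmx x - usubmx y by exact: linearB.
  by rewrite /E !uB fUV subrr add0r Jac_usub !uB.
have UI : usubmx (U - V) = - (invmx A *m (usubmx E + Bm *m dsubmx (U - V))).
  by rewrite uE opprD addrNK mulmxN opprK mulKmx // A_unit.
have h1 : `|usubmx (U - V)| <= a * (`|E| + b * `|dsubmx (U - V)|).
  rewrite UI normrN; apply: le_trans (mulmx_norm_le _ _) _.
  rewrite ler_wpM2l //; apply: le_trans (ler_normD _ _) _.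
  by rewrite lerD ?usubmx_norm_le // mulmx_norm_le.
have h2 := col_norm_le (U - V).
have h3 : (a + 1) * `|E| <= `|U - V| / 2.
  move: EP; rewrite [leRHS]mulrC ler_pdivlMr // => H.
  by rewrite ler_pdivlMr //; apply: le_trans H; rewrite le_eqVlt; apply/orP; left; apply/eqP; ring.
have e0 := normr_ge0 E.
rewrite -linearB /=; move: h1 h2 h3 e0; nra.
Qed.


(** U is known to be continuous, and only U_II to be differentiable. Continuity keeps nearby values
    in one patch of the sheet, where [sheet] bounds the increments of U_I by those of U_II; strict
    differentiability of f then identifies the derivative of U_I. *)
Lemma profile_ode c (T : \bar R) U T0 : profile_solution D f B22 U0 c T U ->
  0 < T0 -> (T0%:E < T)%E -> ode_sol D vfield c T0 U.
Proof.
move=> [[_ U00] cU DU dU] T00 T0T.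
have ltT (x : R) : x <= T0 -> (x%:E < T)%E.
  by move=> xT; apply: le_lt_trans T0T; rewrite lee_fin.
have cU0 : {within `[0, T0], continuous U}.
  apply: continuous_subspaceW cU => x; rewrite /= in_itv /= => /andP[x0 xT].
  by split=> //; exact: ltT.
have DU0 x : 0 <= x <= T0 -> D (U x).
  by move=> /andP[x0 xT]; have [] := DU x x0 (ltT x xT).
split=> // x /andP[x0 xT]; apply/is_derive_eps => e e0.
have Ds : D (U x) by apply: DU0; rewrite !ltW.
have [dII eqII] := dU x x0 (ltT x (ltW xT)).
pose vII := 'D_1 (fun y => dsubmx (U y)) x.
have vE : vfield (U x, c) =
    col_mx (- (invmx (dfI_I f (U x)) *m (ursubmx (Jac f (U x)) *m vII))) vII.
  rewrite /vfield /= !adjinvE ?A_unit ?B_unit //.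
  have -> : invmx (B22 (U x)) *m visc_rhs (U x, c) = vII.
    by rewrite /visc_rhs /= -eqII derive1E mulKmx // B_unit.
  by [].
pose A := dfI_I f (U x); pose Bm := ursubmx (Jac f (U x)).
pose a := r%:R * `|invmx A|; pose b := m%:R * `|Bm|.
have a0 : 0 <= a by rewrite mulr_ge0.
have b0 : 0 <= b by rewrite mulr_ge0.
have [d1 [C [d10 C0 sh]]] := sheet Ds.
pose k := a * C * (1 + `|vII|).
have k0 : 0 <= k by rewrite !mulr_ge0 // addr_ge0.
(* Half of [e] pays for the linearisation of f, amplified by [k], and half for that of U_II,
   amplified by [a * b + 1]. The bound 1 in [e2] limits the increment of U_II to (1 + |vII|) |t|. *)
pose e1 := e / (2 * (k + 1)); pose e2 := Num.min 1 (e / (2 * (a * b + 1))).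
have ab0 : 0 <= a * b by rewrite mulr_ge0.
have e10 : 0 < e1 by rewrite divr_gt0 // mulr_gt0 // ltr_wpDl.
have e20 : 0 < e2 by rewrite lt_min ltr01 divr_gt0 // mulr_gt0 // ltr_wpDl.
have [d2 d20 sd] := strict_diff D_open f_C1 Ds e10.
have isII : is_derive x 1 (fun y => dsubmx (U y)) vII by apply: DeriveDef.
have [d3 d30 H3] := (is_derive_eps _ _ _).1 isII e2 e20.
have /cont_onP cU0' := cU0.
have xI : x \in `[0, T0] by rewrite in_itv /= !ltW.
have dm0 : 0 < Num.min d1 d2 by rewrite lt_min d10.
have [d4 d40 H4] := cU0' x xI _ dm0.
exists (Num.min (Num.min d3 d4) (Num.min x (T0 - x))).
  by rewrite !lt_min d30 d40 x0 subr_gt0.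
move=> y; rewrite !lt_min => /andP[/andP[yd3 yd4] /andP[yx yT]].
have yI : 0 <= y <= T0.
  by move: yx yT; rewrite !ltr_norml; lra.
have := H4 y; rewrite /= in_itv => /(_ yI yd4); rewrite lt_min => /andP[Uy1 Uy2].
have fE : usubmx (f (U y)) = usubmx (f (U x)).
  case/andP: yI => y0 yT0; have [_ ->] := DU y y0 (ltT y yT0).
  by have [_ ->] := DU x (ltW x0) (ltT x (ltW xT)).
have xx d : 0 < d -> `|U x - U x| < d by rewrite subrr normr0.
have sh1 := sh _ _ Uy1 (xx _ d10) fE.
have sd1 := sd _ _ Uy2 (xx _ d20).
have pII := H3 y yd3.
set t := y - x in pII *; set P := dsubmx (U y) - dsubmx (U x) - t *: vII in pII.
set E := _ - _ *m _ in sd1.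
have uB (u v : state) : usubmx (u - v) = usubmx u - usubmx v by exact: linearB.
have dB (u v : state) : dsubmx (u - v) = dsubmx u - dsubmx v by exact: linearB.
have uE : usubmx E = - (A *m usubmx (U y - U x) + Bm *m dsubmx (U y - U x)).
  by rewrite /E !uB fE subrr add0r Jac_usub !uB.
have hII : `|dsubmx (U y) - dsubmx (U x)| <= (1 + `|vII|) * `|t|.
  have -> : dsubmx (U y) - dsubmx (U x) = P + t *: vII by rewrite /P subrK.
  apply: le_trans (ler_normD _ _) _; rewrite normrZ mulrDl mul1r [`|t| * _]mulrC lerD //.
  by apply: le_trans pII _; rewrite -[leRHS]mul1r ler_wpM2r // ge_min lexx.
have pI : usubmx (U y - U x - t *: vfield (U x, c)) = - (invmx A *m (usubmx E + Bm *m P)).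
  rewrite uE /P mulmxBr -dB opprD addrA addrNK -opprD mulmxN opprK mulmxDr.
  rewrite mulKmx ?A_unit // vE !uB; congr (_ + _).
  rewrite linearZ /= col_mxKu scalerN opprK.
  by rewrite -!scalemxAr.
have hI : `|usubmx (U y - U x - t *: vfield (U x, c))| <= a * (`|E| + b * `|P|).
  rewrite pI normrN; apply: le_trans (mulmx_norm_le _ _) _.
  rewrite ler_wpM2l //; apply: le_trans (ler_normD _ _) _.
  by rewrite lerD ?usubmx_norm_le // mulmx_norm_le.
have PE : dsubmx (U y - U x - t *: vfield (U x, c)) = P.
  by rewrite !dB /P vE linearZ /= col_mxKd.
apply: le_trans (col_norm_le _) _; rewrite PE.
have hE : `|E| <= e1 * (C * ((1 + `|vII|) * `|t|)).
  apply: le_trans sd1 _; rewrite ler_wpM2l ?(ltW e10) //.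
  by apply: le_trans sh1 _; rewrite ler_wpM2l.
have aE : a * `|E| <= e / 2 * `|t|.
  apply: le_trans (ler_wpM2l a0 hE) _.
  have -> : a * (e1 * (C * ((1 + `|vII|) * `|t|))) = e1 * k * `|t| by rewrite /k; ring.
  rewrite ler_wpM2r // /e1 mulrAC ler_pdivrMr ?mulr_gt0 ?ltr_wpDl //.
  by move: e0 k0; nra.
have bP : (a * b + 1) * `|P| <= e / 2 * `|t|.
  have abp : 0 < a * b + 1 by rewrite ltr_wpDl.
  apply: le_trans (ler_wpM2l (ltW abp) pII) _; rewrite mulrA ler_wpM2r //.
  rewrite mulrC -ler_pdivlMr // -mulrA -invfM /e2.
  by rewrite ge_min lexx orbT.
by move: hI aE bP; rewrite mulrDr !mulrDl mul1r mulrA; lra.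
Qed.

(** [vfield] is tangent to the level sets of f_I, so f_I is constant along its trajectories. *)
Lemma ode_profile c T0 U : 0 < T0 -> ode_sol D vfield c T0 U -> U 0 = U0 ->
  profile_solution D f B22 U0 c T0%:E U.
Proof.
move=> T00 [cU DU dU] U00.
have fc x : 0 <= x <= T0 -> usubmx (f (U x)) = usubmx (f U0).
  move=> /andP[x0 xT].
  pose w y := usubmx (f (U y)).
  have dw (y : R) : 0 < y < x -> is_derive y 1 w 0.
    move=> /andP[y0 yx].
    have yT : 0 < y < T0 by rewrite y0 (lt_le_trans yx xT).
    have yT' : 0 <= y <= T0 by case/andP: yT => ? ?; rewrite !ltW.
    have dUy := dU y yT; have df : differentiable f (U y) by apply: f_C1.1; exact: DU.
    have dU' : derivable U y 1 by exact: ex_derive.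
    have := is_derive_usub (is_derive_comp dU' df).
    rewrite derive_val derive_Jac // Jac_usub /vfield col_mxKu col_mxKd mulmxN.
    have uA : dfI_I f (U y) \in unitmx by apply: A_unit; exact: DU.
    by rewrite adjinvE // mulKVmx // addNr.
  apply/eqP; rewrite -subr_eq0 -normr_le0 -U00.
  have := @norm_increment_le R r w (fun=> 0) (fun=> 0) 0 x x0.
  rewrite subrr; apply.
  - move=> y.
    have cU' : {within `[0, x], continuous U}.
      by apply: continuous_subspaceW cU; apply: subset_itvl; rewrite bnd_simp.
    apply/cont_onP: y => y yI e e0; have /cont_onP cU'' := cU'.
    have Dy : D (U y).
      move: yI; rewrite /= in_itv /= => /andP[y0 yx]; apply: DU.
      by rewrite y0 (le_trans yx xT).
    have cf : {for U y, continuous f} by apply: loclip_cts; exact: Ck1_loclip D_open f_C1 Dy.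
    have /cvgrPdist_lt /(_ e e0) /nbhs_ballP[d /= d0 dP] := cf.
    have [d' d'0 H'] := cU'' y yI d d0.
    exists d' => // z zI zy; have /ball_distE /dP := H' z zI zy.
    rewrite distrC => fz; apply: le_lt_trans fz.
    by rewrite -linearB /= usubmx_norm_le.
  - by move=> y yx; have dwy := dw y yx; exact: ex_derive.
  - by move=> y yx; have dwy := dw y yx; rewrite derive_val normr0.
split.
- by rewrite lte_fin.
- apply: continuous_subspaceW cU => x /= [x0]; rewrite lte_fin in_itv /= x0 /=.
  exact: ltW.
- move=> x x0; rewrite lte_fin => xT; have xT' : 0 <= x <= T0 by rewrite x0 ltW.
  by split; [exact: DU|exact: fc].
- move=> x x0; rewrite lte_fin => xT.
  have xT' : 0 < x < T0 by rewrite x0.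
  have dx := is_derive_dsub (dU x xT'); split; first exact: ex_derive.
  have uB : B22 (U x) \in unitmx by apply: B_unit; apply: DU; rewrite !ltW.
  by rewrite derive1E derive_val /vfield col_mxKd adjinvE // mulKVmx.
Qed.

End System.

Lemma ereal_between (R : realType) (x : R) (T : \bar R) : (x%:E < T)%E ->
  exists2 z : R, x < z & (z%:E < T)%E.
Proof.
case: T => [t||//]; last by move=> _; exists (x + 1); rewrite ?ltry // ltrDl.
by rewrite lte_fin => xt; exists ((x + t) / 2); rewrite ?lte_fin; lra.
Qed.

(** * Maximal solutions and admissible parameters *)

Section Maximal.
Context {R : realType} {r m : nat}.
Local Notation state := 'cV[R]_(r + m).
Variables (D : set state) (f : state -> state) (B22 : state -> 'M[R]_m).
Hypotheses (D_open : open D) (f_smooth : smooth D f) (B_smooth : smooth D B22).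
Hypothesis A_unit : forall U, D U -> dfI_I f U \in unitmx.
Hypothesis B_unit : forall U, D U -> B22 U \in unitmx.
Variable U0 : state.
Hypothesis U0_in : D U0.

Local Notation psol := (profile_solution D f B22 U0).
Local Notation fld := (vfield f B22 U0).
Local Notation msol := (max_sol D f B22 U0).
Local Notation adm := (admissible D f B22 U0).

Let fld_lip U c : D U -> loclip fld (U, c).
Proof. exact: (loclip_vfield D_open f_smooth B_smooth A_unit B_unit). Qed.

Lemma psol_agree c T1 U1 T2 U2 : psol c T1 U1 -> psol c T2 U2 ->
  forall x : R, 0 <= x -> (x%:E < T1)%E -> (x%:E < T2)%E -> U1 x = U2 x.
Proof.
move=> s1 s2 x; rewrite le_eqVlt => /predU1P[<-|x0] xT1 xT2.
  by case: s1 s2 => [[_ ->] _ _ _] [[_ ->] _ _ _].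
have o1 := profile_ode D_open f_smooth A_unit B_unit s1 x0 xT1.
have o2 := profile_ode D_open f_smooth A_unit B_unit s2 x0 xT2.
apply: (ode_unique fld_lip (ltW x0) o1 o2); last by rewrite (ltW x0) lexx.
by case: s1 s2 => [[_ ->] _ _ _] [[_ ->] _ _ _].
Qed.

(** The union of all solutions: the existence time is the supremum, and the value at [x] is read off
    any solution that lives beyond [x], consistently by [psol_agree]. *)
Lemma maximal_exists c T1 U1 : psol c T1 U1 ->
  exists S, maximal_solution D f B22 U0 c S.1 S.2.
Proof.
move=> s1.
pose T := ereal_sup [set T' | exists U', psol c T' U'].
have Tub T' U' : psol c T' U' -> (T' <= T)%E.
  by move=> s'; apply: ereal_sup_ubound; exists U'.
pose S x := xget (0%E, cst U0) [set S : \bar R * (R -> state) |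
  psol c S.1 S.2 /\ (x%:E < S.1)%E].
pose U x := (S x).2 x.
have UE T' U' x : psol c T' U' -> 0 <= x -> (x%:E < T')%E -> U x = U' x.
  move=> s' x0 xT'; rewrite /U /S; case: xgetP => [[T2 U2] _ /= [s2 xT2]|].
    exact: psol_agree s2 s' x x0 xT2 xT'.
  by move=> /(_ (T', U')) /= H; case: H.
have loc (x : R) : 0 <= x -> (x%:E < T)%E -> exists T' U', psol c T' U' /\ (x%:E < T')%E.
  move=> x0 xT; have [T' [U' s'] xT'] := ereal_sup_gt xT.
  by exists T', U'.
exists (T, U); split=> /=; last by move=> T' U' s' _ _; exact: Tub s'.
have T10 : (0 < T1)%E by case: s1 => [[]].
split.
- split; first by apply: lt_le_trans T10 _; exact: Tub s1.
  by rewrite (UE _ _ 0 s1) //; case: s1 => [[]].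
- apply/cont_onP => x [x0 xT] e e0.
  have [T' [U' [s' xT']]] := loc x x0 xT.
  have [z xz zT'] := ereal_between xT'.
  have [_ /cont_onP cU' _ _] := s'.
  have [d d0 H] := cU' x (conj x0 xT') e e0.
  exists (Num.min d (z - x)); first by rewrite lt_min d0 subr_gt0.
  move=> y [y0 yT]; rewrite lt_min => /andP[yd yz].
  have yT' : (y%:E < T')%E.
    by apply: le_lt_trans zT'; rewrite lee_fin; move: yz; rewrite ltr_norml; lra.
  by rewrite !(UE _ _ _ s') //; apply: H.
- move=> x x0 xT; have [T' [U' [s' xT']]] := loc x x0 xT.
  by rewrite (UE _ _ _ s') //; case: s' => _ _ + _; apply.
- move=> x x0 xT; have [T' [U' [s' xT']]] := loc x (ltW x0) xT.
  have [z xz zT'] := ereal_between xT'.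
  have E : \forall y \near x, dsubmx (U' y) = dsubmx (U y).
    near=> y; congr dsubmx; apply/esym/(UE T').
    - exact: s'.
    - by apply: ltW; near: y; exact: lt_nbhsr.
    - by apply: le_lt_trans zT'; rewrite lee_fin ltW //; near: y; exact: lt_nbhsl.
  have [_ _ _ /(_ x x0 xT')[d1 eq1]] := s'.
  split; first exact: near_eq_derivable E d1.
  by rewrite derive1E -(near_eq_derive _ E) -derive1E (UE _ _ _ s') // ltW.
Unshelve. all: by end_near. Qed.

Lemma msol_agree c T U : psol c T U ->
  [/\ psol c (msol c).1 (msol c).2, (T <= (msol c).1)%E &
   forall x : R, 0 <= x -> (x%:E < T)%E -> (msol c).2 x = U x].
Proof.
move=> s; have [S0 S0P] := maximal_exists s.
have : maximal_solution D f B22 U0 c (msol c).1 (msol c).2.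
  exact: (xgetPex (0%E, cst U0) (ex_intro (fun S : \bar R * (R -> state) =>
    maximal_solution D f B22 U0 c S.1 S.2) S0 S0P)).
move=> [sm maxm].
have Tm : (T <= (msol c).1)%E.
  rewrite leNgt; apply/negP => mT.
  have := maxm T U s (ltW mT); rewrite leNgt mT => H.
  suff : false by []; apply: H => x x0 xm.
  exact: (psol_agree s sm x0 (lt_trans xm mT) xm).
split=> // x x0 xT; apply: (psol_agree sm s x0 _ xT).
exact: lt_le_trans xT Tm.
Qed.

Lemma adm_ode c : adm c -> exists2 T : R, 1 < T &
  ode_sol D fld c T (msol c).2 /\ (msol c).2 0 = U0.
Proof.
move=> [m1 _].
have [[T U] /= sT] : exists S, psol c S.1 S.2.
  (* Without any solution [max_sol] would return its default, whose existence time 0 is not beyond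
     1. *)
  apply: contrapT => nS; move: m1; rewrite /max_sol; case: xgetP => [S _ [sS _]|_].
    by case: nS; exists S.
  by rewrite /= lte_fin ltr10.
have [sm _ _] := msol_agree sT.
have [T1 T11 T1m] := ereal_between m1; exists T1 => //.
have T10 : 0 < T1 by apply: lt_trans T11.
split; first exact: (profile_ode D_open f_smooth A_unit B_unit sm T10 T1m).
by case: sm => [[]].
Qed.

Lemma ode_adm c (T : R) U : 1 < T -> ode_sol D fld c T U -> U 0 = U0 ->
  adm c /\ forall x, 0 <= x <= 1 -> (msol c).2 x = U x.
Proof.
move=> T1 sU UU0; have T0 : 0 < T by apply: lt_trans T1.
have s := ode_profile D_open f_smooth A_unit B_unit T0 sU UU0.
have [sm Tm E] := msol_agree s.
have E1 x : 0 <= x <= 1 -> (msol c).2 x = U x.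
  by move=> /andP[x0 x1]; apply: E => //; rewrite lte_fin (le_lt_trans x1).
split=> //; split; first by apply: lt_le_trans Tm; rewrite lte_fin.
move=> x x01; rewrite E1 //; apply: open_nbhs_nbhs; split=> //.
have [_ DU _] := sU; apply: DU; case/andP: x01 => -> x1 /=.
exact: le_trans x1 (ltW T1).
Qed.

Lemma adm_stable c0 : adm c0 -> exists d C : R, [/\ 0 < d, 0 <= C &
  forall c, `|c - c0| < d -> adm c /\
    forall x, 0 <= x <= 1 -> `|(msol c).2 x - (msol c0).2 x| <= C * `|c - c0|].
Proof.
move=> /adm_ode[T T1 [sU UU0]]; have T0 : 0 < T by apply: lt_trans T1.
have [d [C [d0 C0 H]]] := ode_stable D_open fld_lip (ltW T0) sU.
exists d, C; split=> // c cd; have [U [sc U00 Ucl]] := H c cd.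
have [admc E] := ode_adm T1 sc (etrans U00 UU0).
split=> // x x01; rewrite E //; apply: Ucl.
by case/andP: x01 => -> x1 /=; exact: le_trans x1 (ltW T1).
Qed.

Lemma adm0 : adm 0 /\ forall x, 0 <= x <= 1 -> (msol 0).2 x = U0.
Proof.
apply: (@ode_adm 0 2 (cst U0)) => //; first by rewrite ltr1n.
split=> // [|x _].
  by apply: continuous_subspaceT => x; exact: cvg_cst.
have -> : fld (cst U0 x, 0) = 0.
  rewrite /vfield /visc_rhs /= subrr mulmx0 addr0 !mulmx0 oppr0.
  exact: col_mx0.
exact: is_derive_cst.
Qed.

Lemma adm_props c : adm c ->
  [/\ (msol c).2 0 = U0, {within `[0, 1], continuous (msol c).2},
      forall x, 0 <= x <= 1 -> D ((msol c).2 x),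
      forall x, 0 <= x <= 1 -> usubmx (f ((msol c).2 x)) = usubmx (f U0)
    & forall t, 0 < t <= 1 -> ode_sol D fld c t (msol c).2].
Proof.
move=> /adm_ode[T T1 [sU UU0]]; have T0 : 0 < T by apply: lt_trans T1.
have [cU DU dU] := sU.
have s := ode_profile D_open f_smooth A_unit B_unit T0 sU UU0.
have xT x : 0 <= x <= 1 -> 0 <= x <= T.
  by case/andP => -> x1 /=; exact: le_trans x1 (ltW T1).
have sub t : t <= T -> {within `[0, t], continuous (msol c).2}.
  by move=> tT; apply: continuous_subspaceW cU; apply: subset_itvl; rewrite bnd_simp.
split=> //; first exact/sub/ltW.
- by move=> x x01; apply: DU; exact: xT.
- move=> x /andP[x0 x1]; case: s => _ _ /(_ x x0) + _.
  by rewrite lte_fin => /(_ (le_lt_trans x1 T1)) [].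
- move=> t /andP[t0 t1]; have tT := le_trans t1 (ltW T1).
  split; first exact: sub.
    by move=> x /andP[x0 xt]; apply: DU; rewrite x0 (le_trans xt tT).
  by move=> x /andP[x0 xt]; apply: dU; rewrite x0 (lt_le_trans xt tT).
Qed.

End Maximal.

Lemma is_derive_bigsum (R : realType) n (g : 'I_n -> R -> R) (dg : 'I_n -> R) (x : R) :
  (forall j, is_derive x 1 (g j) (dg j)) ->
  is_derive x 1 (fun y => \sum_j g j y) (\sum_j dg j).
Proof.
move=> H; have -> : (fun y => \sum_j g j y) = \sum_j g j by apply/funext => y; rewrite fct_sumE.
exact: is_derive_sum.
Qed.

(** * Rigidity of closed profiles *)

Section Entropy.
Context {R : realType} {r m : nat}.
Local Notation state := 'cV[R]_(r + m).
Variables (D : set state) (f0 f : state -> state) (B22 : state -> 'M[R]_m).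
Hypotheses (f0_C1 : Ck 1 D f0) (f_smooth : smooth D f).
Hypothesis B_unit : forall U, D U -> B22 U \in unitmx.
Hypothesis f0_unit : forall U, D U -> df0 f0 U \in unitmx.
Hypothesis entropy : convex_entropy D f0 f B22.
Variable U0 : state.
Hypothesis U0_in : D U0.

(* With b = B(U)U' and w = f^0(U), the derivative of (d eta/dw) b - q(w) along a
   profile is the dissipation U'^T M U' >= 0; on a closed profile it integrates
   to zero, so that b vanishes identically. *)
Lemma closed_profile_trivial c (t : R) U : 0 < t ->
  ode_sol D (vfield f B22 U0) c t U -> U 0 = U0 -> U t = U0 ->
  (forall x, 0 <= x <= t -> usubmx (f (U x)) = usubmx (f U0)) -> c = 0.
Proof.
move=> t0 [cU DU dU] U00 Ut0 fI.
have [eta [q [[eta2 q1 flux] diss]]] := entropy.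
have [etad /(_ _) etaC1] := eta2.
have [qd _] := q1.
pose n := (r + m)%N.
(* The quantity b, written through the integrated equation, is a function of the state alone. Hence
   so is [g], and on a closed profile [phi] takes the same value at both ends. *)
pose bb (u : state) : state := f u - f U0 + col_mx 0 (B22 U0 *m c).
pose g (u : state) : R := \sum_j 'D_(ebase j) eta (f0 u) * bb u j 0 - q (f0 u).
have df0 u : D u -> differentiable f0 u by exact: f0_C1.1.
have df u : D u -> differentiable f u by exact: (f_smooth 1).1.
have dbb u j : D u -> differentiable (fun u => bb u j 0) u.
  move=> Du; apply: (@differentiable_comp _ _ _ _ bb (fun M : state => M j 0)).
    by apply: differentiableD; [apply: differentiableB; [exact: df|]|]; exact: differentiable_cst.
  exact: differentiable_coord.
have deta u j : D u -> differentiable ('D_(ebase j) eta) (f0 u).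
  by move=> Du; apply: (etaC1 (ebase j)).1; exists u.
have dg u : D u -> differentiable g u.
  move=> Du; apply: differentiableB.
    have -> : (fun u => \sum_j 'D_(ebase j) eta (f0 u) * bb u j 0) =
        \sum_j (fun u => 'D_(ebase j) eta (f0 u) * bb u j 0).
      by apply/funext => y; rewrite fct_sumE.
    apply: differentiable_sum => j; apply: differentiableM; last exact: dbb.
    by apply: (@differentiable_comp _ _ _ _ f0 ('D_(ebase j) eta)); [exact: df0|exact: deta].
  by apply: (@differentiable_comp _ _ _ _ f0 q); [exact: df0|apply: qd; exists u].
pose phi x := g (U x).
have cphi : {within `[0, t], continuous phi}.
  apply: within_continuous_comp cU => _ /set_mem[x + <-]; rewrite /= in_itv => xt.
  by apply: differentiable_continuous; apply: dg; exact: DU.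
pose V x := vfield f B22 U0 (U x, c).
have bV x : 0 < x < t -> bb (U x) = Bmx B22 (U x) *m V x.
  move=> /andP[x0 xt]; have xt' : 0 <= x <= t by rewrite !ltW.
  rewrite /Bmx /V /vfield mul_block_col !mul0mx !add0r /= adjinvE; last first.
    by apply: B_unit; exact: DU.
  rewrite mulKVmx; last by apply: B_unit; exact: DU.
  rewrite /bb -[f (U x) - f U0]vsubmxK linearB /= fI // subrr add_col_mx addr0.
  by rewrite /visc_rhs /= linearB.
pose M x := (Defs.df0 f0 (U x))^T *m Hess eta (f0 (U x)) *m Bmx B22 (U x).
have dphi (x : R) : 0 < x < t -> is_derive x 1 phi (qform (M x) (V x)).
  move=> xt; have xt' : 0 <= x <= t by case/andP: xt => ? ?; rewrite !ltW.
  have Dx := DU x xt'; have dUx := dU x xt.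
  have dU' : derivable U x 1 by exact: ex_derive.
  have UV : 'D_1 U x = V x by rewrite derive_val.
  pose w y := f0 (U y).
  have dw := is_derive_comp dU' (df0 _ Dx); rewrite UV derive_Jac in dw; last exact: df0.
  have dw' : derivable w x 1 by exact: ex_derive.
  have dwE : 'D_1 w x = Jac f0 (U x) *m V x by rewrite derive_val.
  have deta' j : is_derive x 1 (fun y => 'D_(ebase j) eta (w y))
      (\sum_i (Jac f0 (U x) *m V x) i 0 * Hess eta (w x) i j).
    apply: is_derive_eq (is_derive_comp dw' (deta _ j Dx)) _.
    by rewrite dwE derive_ebase; [apply: eq_bigr => i _; rewrite [Hess _ _ _ _]mxE|exact: deta].
  have dq' : is_derive x 1 (fun y => q (w y)) ((grad q (w x) *m (Jac f0 (U x) *m V x)) 0 0).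
    have qdx : differentiable q (w x) by apply: qd; exists (U x).
    apply: is_derive_eq (is_derive_comp dw' qdx) _.
    by rewrite dwE derive_ebase // mxE; apply: eq_bigr => i _; rewrite [grad _ _ _ _]mxE mulrC.
  have db j : is_derive x 1 (fun y => bb (U y) j 0) ((Jac f (U x) *m V x) j 0).
    have dff := is_derive_comp dU' (df _ Dx); rewrite UV derive_Jac in dff; last exact: df.
    have dbU : is_derive x 1 (fun y => bb (U y)) (Jac f (U x) *m V x).
      apply: is_derive_eq; by rewrite subr0 addr0.
    have := derive_coord j (@ex_derive _ _ _ _ _ _ _ dbU).
    by rewrite derive_val.
  apply: is_derive_eq (is_deriveB (is_derive_bigsum (fun j => is_deriveM (deta' j) (db j))) dq') _.
  (* Compatibility of entropy and flux: the derivative of q cancels the term in which b is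
     differentiated. *)
  have -> : grad q (w x) *m (Jac f0 (U x) *m V x) =
      grad eta (w x) *m (Jac f (U x) *m V x).
    rewrite -(flux _ Dx) -!mulmxA; congr (_ *m (_ *m _)).
    by rewrite mulKmx //; exact: f0_unit.
  rewrite big_split /=; set S1 := \sum_(i < _) _; set S2 := \sum_(i < _) _.
  have -> : S1 = (grad eta (w x) *m (Jac f (U x) *m V x)) 0 0.
    by rewrite mxE; apply: eq_bigr => j _; rewrite !mxE.
  rewrite addrAC subrr add0r.
  have -> : qform (M x) (V x) = ((Jac f0 (U x) *m V x)^T *m Hess eta (w x) *m bb (U x)) 0 0.
    by rewrite /qform /M bV // trmx_mul !mulmxA.
  rewrite mxE; apply: eq_bigr => j _; rewrite mulrC; congr (_ * _).
  by rewrite [RHS]mxE; apply: eq_bigr => i _; rewrite [X in _ = X * _]mxE.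
have qM x : 0 < x < t -> 0 <= qform (M x) (V x) /\
    (qform (M x) (V x) = 0 -> bb (U x) = 0).
  move=> xt; have xt' : 0 <= x <= t by case/andP: xt => ? ?; rewrite !ltW.
  have [_ pos ker] := diss (U x) (DU x xt').
  have E : qform (M x + (M x)^T) (V x) = qform (M x) (V x) *+ 2.
    rewrite /qform mulmxDr mulmxDl mxE mulr2n; congr (_ + _).
    by rewrite -[in LHS](trmxK (V x)) -!trmx_mul mxE mulmxA trmxK.
  split; first by have := pos (V x); rewrite E pmulrn_lge0.
  by move=> q0; rewrite bV //; apply: ker; rewrite E q0 mul0rn.
have phic x : 0 <= x <= t -> phi x = phi 0.
  move=> /andP[x0 xt].
  have mono y z : 0 <= y -> y <= z -> z <= t -> phi y <= phi z.
    apply: (ger0_derive1_ndecr (a := 0) (b := t)) => //.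
      by move=> s; rewrite in_itv /= => st; have ds := dphi s st; exact: ex_derive.
    move=> s; rewrite in_itv /= => st; have ds := dphi s st.
    by rewrite derive1E derive_val; have [] := qM s st.
  have pt : phi t = phi 0 by rewrite /phi U00 Ut0.
  by apply/le_anti; rewrite -{1}pt !mono.
have b0 x : 0 < x < t -> bb (U x) = 0.
  move=> xt; apply: (qM x xt).2.
  have dx := dphi x xt; rewrite -[LHS](@derive_val _ _ _ _ _ _ _ dx).
  rewrite -(near_eq_derive (f := cst (phi 0))) ?derive_cst //.
  case/andP: xt => x0 xt; near=> y; rewrite /= phic //.
  by apply/andP; split; apply: ltW; near: y; [exact: lt_nbhsr|exact: lt_nbhsl].
(* The dissipation yields b = 0 at interior points; continuity carries this to [U0], where b has the
   components 0 and [B22 U0 *m c]. *)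
have bU0 : bb U0 = 0.
  have cb : {within `[0, t], continuous (bb \o U)}.
    apply: within_continuous_comp cU => _ /set_mem[x + <-]; rewrite /= in_itv => xt.
    apply: differentiable_continuous.
    by apply: differentiableD; [apply: differentiableB; [by apply: df; exact: DU|]|]; exact: differentiable_cst.
  have /cont_onP cb' := cb.
  apply/eqP; rewrite -normr_le0; apply/ler_addgt0Pl => e e0; rewrite addr0.
  have I0 : 0 \in `[0, t] by rewrite in_itv /= lexx ltW.
  have [d d0 H] := cb' 0 I0 e e0.
  pose y := Num.min d t / 2.
  have m0 : 0 < Num.min d t by rewrite lt_min d0.
  have md : Num.min d t <= d by rewrite ge_min lexx.
  have mt : Num.min d t <= t by rewrite ge_min lexx orbT.
  have yt : 0 < y < t by rewrite /y; apply/andP; split; lra.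
  have yI : y \in `[0, t] by rewrite in_itv /=; case/andP: yt => ? ?; rewrite !ltW.
  have := H y yI; rewrite subr0 gtr0_norm; last by case/andP: yt.
  rewrite /= b0 // U00 sub0r normrN => Hy; apply: ltW; apply: Hy.
  by rewrite /y; lra.
move: bU0; rewrite /bb subrr add0r => /(congr1 dsubmx); rewrite col_mxKd linear0.
by move=> Bc; rewrite -[c](mulKmx (B_unit U0_in)) Bc mulmx0.
Unshelve. all: by end_near. Qed.

End Entropy.

(** * Surjectivity by counting fibres *)

(** The points of [S] that satisfy [Q] and those that do not both form relatively open sets. *)
Lemma connected_locally_constant (T : topologicalType) (S : set T) (Q : T -> Prop) :
  connected S -> (forall x, S x -> \forall y \near x, S y -> (Q y <-> Q x)) ->
  forall x y, S x -> S y -> Q x -> Q y.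
Proof.
move=> cS loc x y Sx Sy Qx.
suff : S `&` [set z | Q z] = S by move=> E; have : S y by []; rewrite -E => -[].
apply: cS; first by exists x.
- exists ([set z | S z -> Q z]°); first exact: open_interior.
  apply/seteqP; split=> z [Sz Qz]; split=> //.
    by apply: filterS (loc z Sz) => w H Sw; apply/H.
  by have /(_ Sz) := interior_subset Qz.
- exists (~` ([set z | S z -> ~ Q z]°)); first exact/open_closedC/open_interior.
  apply/seteqP; split=> z [Sz Qz]; split=> //.
    by move=> /interior_subset /(_ Sz); apply.
  apply: contrapT => nQz; apply: Qz.
  by apply: filterS (loc z Sz) => w H Sw Qw; apply: nQz; apply/H.
Qed.

Opaque odd_degree.

Section Surjectivity.
Context {R : realType} {n m : nat}.
Variables (X : set 'cV[R]_m) (Phi : 'cV[R]_m -> 'cV[R]_n).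
Variables (S : set 'cV[R]_n) (prj : 'cV[R]_n -> 'cV[R]_m) (Y : set 'cV[R]_m).
Hypothesis Phi_cont : forall x, X x -> forall e, 0 < e -> exists2 d, 0 < d &
  forall x', `|x' - x| < d -> X x' /\ `|Phi x' - Phi x| < e.
Hypothesis Phi_S : forall x, X x -> S (Phi x).
Hypothesis prj_lip : forall u v, `|prj u - prj v| <= `|u - v|.
Hypothesis prj_inj : forall s, S s -> exists d C : R, [/\ 0 < d, 0 <= C &
  forall u v, S u -> S v -> `|u - s| < d -> `|v - s| < d ->
    `|u - v| <= C * `|prj u - prj v|].
Hypothesis Y_open : open Y.
Hypothesis Y_conn : connected Y.
Hypothesis prj_Y : forall s, S s -> Y (prj s).
Hypothesis Phi_proper : forall K, K `<=` Y -> compact K ->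
  compact (X `&` (prj \o Phi) @^-1` K).

Local Notation Psi := (fun x => prj (Phi x)).

(* On such a K, a zero count of Psi - prj s is a count of the points of the
   fibre of Phi over s. *)
Definition isolating (K : set 'cV[R]_m) s := [/\ K `<=` X, compact K,
  forall x, X x -> Phi x = s -> nbhs x K
  & forall x, K x -> Psi x = prj s -> Phi x = s].

Definition odd_fibre s := S s /\
  exists2 K, isolating K s & odd_degree K (fun x => Psi x - prj s).

Lemma Psi_cont_on K y : K `<=` X -> cont_on K (fun x => Psi x - y).
Proof.
move=> KX x Kx e e0; have [d d0 H] := Phi_cont (KX _ Kx) e0.
exists d => // x' Kx' x'x; rewrite opprB addrA subrK.
by apply: le_lt_trans (prj_lip _ _) _; have [] := H x' x'x.
Qed.

(** Excision reduces both counts to the intersection of [K] and [K'], a neighbourhood of every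
    zero. *)
Lemma isolating_indep K K' s : isolating K s -> isolating K' s ->
  odd_degree K (fun x => Psi x - prj s) -> odd_degree K' (fun x => Psi x - prj s).
Proof.
move=> [KX cK Kn Ks] [K'X cK' K'n K's] oK.
have zero L x : L `<=` X -> (forall x, L x -> Psi x = prj s -> Phi x = s) ->
    L x -> Psi x - prj s = 0 -> nbhs x (K `&` K').
  move=> LX Ls Lx /subr0_eq /(Ls _ Lx) xs.
  by apply: filterI; [apply: Kn|apply: K'n] => //; exact: LX.
have h1 := (odd_degree_excision cK (@subIsetl _ K K') (Psi_cont_on _ KX) (fun x => @zero K x KX Ks)).1 oK.
by apply: (odd_degree_excision cK' (@subIsetr _ K K') (Psi_cont_on _ K'X) (fun x => @zero K' x K'X K's)).2.
Qed.

(** [K] gathers the parameters with Psi within [rho] of [prj s] and Phi within d/2 of [s]; it is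
    compact by properness. The same [K] isolates the fibres over all states of the sheet near [s],
    which makes the parity locally constant. *)
Lemma isolating_local s : S s -> exists K (eta C : R), [/\ 0 < eta, 0 <= C,
  forall s', S s' -> `|s' - s| < eta -> isolating K s',
  forall y, `|y - prj s| < eta ->
    (odd_degree K (fun x => Psi x - y) <-> odd_degree K (fun x => Psi x - prj s))
  & forall x, K x -> `|Phi x - s| <= C * `|Psi x - prj s|].
Proof.
move=> Ss; have [d [C [d0 C0 inj]]] := prj_inj Ss.
have /nbhs_ballP[e /= e0 eY] : nbhs (prj s) Y.
  by apply: open_nbhs_nbhs; split=> //; exact: prj_Y.
(* As C rho < d/2, the injectivity estimate sharpens |Phi x - s| <= d/2 on [K] to a strict
   inequality, so the cut at d/2 creates no zeros on the boundary. The bound e/2 keeps the closed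
   ball of targets inside [Y], where properness applies. *)
pose rho := Num.min (e / 2) (d / (4 * (C + 1))).
have C1 : 0 < 4 * (C + 1) by rewrite mulr_gt0 // ltr_wpDl.
have rho0 : 0 < rho by rewrite lt_min !divr_gt0.
have Crho : C * rho < d / 2.
  have h : rho * (4 * (C + 1)) <= d by rewrite -ler_pdivlMr // /rho ge_min lexx orbT.
  by move: h rho0 d0 C0; nra.
pose P := X `&` (prj \o Phi) @^-1` [set y | `|y - prj s| <= rho].
have cP : compact P.
  apply: Phi_proper; last exact: closed_ball_compact.
  move=> y /= yr; apply: eY; apply/ball_distE; apply: le_lt_trans yr _.
  rewrite /rho gt_min; apply/orP; left; lra.
pose K := P `&` [set x | `|Phi x - s| <= d / 2].
have KX : K `<=` X by move=> x [[]].
have injK x : K x -> `|Phi x - s| <= C * `|Psi x - prj s|.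
  move=> [[Xx _] /= xs]; apply: inj => //; first exact: Phi_S; last by rewrite subrr normr0.
  by apply: le_lt_trans xs _; lra.
have Knbhs x : X x -> `|Phi x - s| < d / 2 -> `|Psi x - prj s| < rho -> nbhs x K.
  move=> Xx h1 h2.
  have [|d' d'0 H] := Phi_cont Xx (e := Num.min (d / 2 - `|Phi x - s|) (rho - `|Psi x - prj s|)).
    by rewrite lt_min !subr_gt0 h1.
  apply: (@near_dist _ _ x d' K d'0) => x' /H[Xx']; rewrite lt_min => /andP[h3 h4].
  split; first split=> //=.
    have -> : Psi x' - prj s = (Psi x' - Psi x) + (Psi x - prj s) by rewrite addrA subrK.
    apply: le_trans (ler_normD _ _) _.
    by have := prj_lip (Phi x') (Phi x); lra.
  rewrite /=; have -> : Phi x' - s = (Phi x' - Phi x) + (Phi x - s) by rewrite addrA subrK.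
  by apply: le_trans (ler_normD _ _) _; lra.
have cK : compact K.
  apply: (subclosed_compact _ cP); last by move=> x [].
  move=> x clx.
  have Px : P x.
    have cl := compact_closed (@norm_hausdorff _ _) cP; apply: cl.
    by move=> B /clx [z [[Pz _] Bz]]; exists z.
  split=> //=; rewrite leNgt; apply/negP => gt.
  have [|d' d'0 H] := Phi_cont Px.1 (e := `|Phi x - s| - d / 2); first by rewrite subr_gt0.
  have [z [[_ /= zs] zx]] := clx _ (nbhsx_ballx x _ d'0).
  move/ball_distE: zx => /H[_] h.
  have : `|Phi x - s| <= `|Phi x - Phi z| + `|Phi z - s|.
    by have := ler_normD (Phi x - Phi z) (Phi z - s); rewrite addrA subrK.
  by rewrite (distrC (Phi x) (Phi z)); lra.
have zeros x y : K x -> `|y - prj s| < rho -> Psi x - y = 0 -> nbhs x K.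
  move=> Kx yr /subr0_eq xy.
  have h : `|Psi x - prj s| < rho by rewrite xy.
  apply: Knbhs => //; first exact: KX.
  apply: le_lt_trans (injK x Kx) _; apply: le_lt_trans Crho.
  by rewrite ler_wpM2l // ltW.
have [e1 e10 He1] : exists2 e1 : R, 0 < e1 & forall y, `|y - prj s| < e1 ->
   (odd_degree K (fun x => Psi x - y) <-> odd_degree K (fun x => Psi x - prj s)).
  have : \forall y \near prj s,
     (odd_degree K (fun x => Psi x - y) <-> odd_degree K (fun x => Psi x - prj s)).
    apply: (@odd_degree_near R m K _ (nbhs (prj s)) (fun y x => Psi x - y)) => //.
    - exact: Psi_cont_on.
    - move=> x Kx e' e'0; have e'2 : 0 < e' / 2 by rewrite divr_gt0.
      have [d' d'0 H] := Psi_cont_on (prj s) KX Kx e'2.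
      exists d' => //; apply: (@near_dist _ _ (prj s) _ _ e'2) => y ys x' Kx' x'x.
      have -> : Psi x' - y - (Psi x - prj s) = (Psi x' - prj s - (Psi x - prj s)) - (y - prj s).
        by apply/colP => i; rewrite !mxE; ring.
      apply: le_lt_trans (ler_normB _ _) _; have := H x' Kx' x'x; lra.
    - by move=> x Kx; apply: zeros => //; rewrite subrr normr0.
  move=> /nbhs_ballP[e1 /= e10 He1]; exists e1; first exact: e10.
  by move=> y /ball_distE ys; exact: He1.
exists K, (Num.min e1 (Num.min rho (d / 2))), C; split; last exact: injK.
- by rewrite 2!lt_min e10 rho0 divr_gt0.
- exact: C0.
- move=> s' Ss'; rewrite 2!lt_min => /andP[_ /andP[s'r s'd]]; split=> //.
    move=> x Xx xs; apply: Knbhs => //; rewrite xs //.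
    exact: le_lt_trans (prj_lip _ _) s'r.
  move=> x Kx xs; apply/eqP; rewrite -subr_eq0 -normr_le0.
  have -> : 0 = C * `|prj (Phi x) - prj s'| by rewrite xs subrr normr0 mulr0.
  apply: inj => //; first exact/Phi_S/KX.
    by apply: le_lt_trans (proj2 Kx) _; lra.
  by apply: lt_trans s'd _; lra.
- by move=> y; rewrite lt_min => /andP[ye1 _]; exact: He1.
Qed.

Lemma odd_fibre_local s : S s -> exists2 eta, 0 < eta & forall s', S s' ->
  `|s' - s| < eta -> (odd_fibre s' <-> odd_fibre s).
Proof.
move=> Ss; have [K [eta [C [eta0 C0 iso odd _]]]] := isolating_local Ss.
exists eta; first exact: eta0.
move=> s' Ss' s's; have is1 := iso s' Ss' s's.
have is0 : isolating K s by apply: iso => //; rewrite subrr normr0.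
have oo := odd (prj s') (le_lt_trans (prj_lip _ _) s's).
split=> -[_ [K' iK' oK']].
  split; [exact: Ss|exists K; first exact: is0].
  exact: (oo.1 (isolating_indep iK' is1 oK')).
split; [exact: Ss'|exists K; first exact: is1].
exact: (oo.2 (isolating_indep iK' is0 oK')).
Qed.

Lemma odd_fibre_nonempty s : odd_fibre s -> exists2 x, X x & Phi x = s.
Proof.
move=> [_ [K [KX cK _ Ks] oK]].
have [x Kx /subr0_eq x0] := odd_degree_zero cK (Psi_cont_on _ KX) oK.
by exists x; [exact: KX|exact: Ks].
Qed.

(** Openness needs a state over each nearby value [y']: the odd count supplies a parameter there,
    whose state [Phi x] is close to [s] and hence has odd fibre too. For closedness, a state with
    odd fibre is attained; if none lies over [y], compactness keeps the projections of the attained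
    ones at a positive distance from [y]. *)
Lemma odd_fibre_surjective s0 : odd_fibre s0 ->
  forall y, Y y -> exists x, X x /\ Psi x = y.
Proof.
move=> odd0 y Yy.
pose B y := exists2 s, odd_fibre s & prj s = y.
suff : B y.
  by move=> [s /odd_fibre_nonempty[x Xx xs] sy]; exists x; rewrite xs sy.
have Bs0 : B (prj s0) by exists s0.
apply: (connected_locally_constant Y_conn _ (prj_Y odd0.1) Yy Bs0) => {Bs0 Yy} {}y Yy.
have [By|nBy] := pselect (B y).
  have [s os sy] := By; have Ss := os.1.
  have [K [eta [C [eta0 C0 iso odd inj]]]] := isolating_local Ss.
  have [eta' eta'0 Hloc] := odd_fibre_local Ss.
  have is0 : isolating K s by apply: iso => //; rewrite subrr normr0.
  have oK : odd_degree K (fun x => Psi x - prj s).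
    by have [_ [K' iK' oK']] := os; exact: isolating_indep iK' is0 oK'.
  have [KX cK _ _] := is0.
  have e0 : 0 < Num.min eta (eta' / (C + 1)) by rewrite lt_min eta0 divr_gt0 // ltr_wpDl.
  apply: (near_dist e0) => y'; rewrite lt_min -sy => /andP[h1 h2] _; split=> _; first by exists s.
  have [x Kx /subr0_eq xy'] := odd_degree_zero cK (Psi_cont_on _ KX) ((odd y' h1).2 oK).
  exists (Phi x); last exact: xy'.
  refine ((Hloc _ (Phi_S (KX _ Kx)) _).2 os).
  apply: le_lt_trans (inj x Kx) _; rewrite xy'.
  move: h2; rewrite ltr_pdivlMr ?ltr_wpDl // => h2; apply: le_lt_trans h2.
  by rewrite mulrC ler_wpM2l // lerDl.
have /nbhs_ballP[e /= e0 eY] : nbhs y Y by exact: open_nbhs_nbhs.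
pose P := X `&` (prj \o Phi) @^-1` [set y' | `|y' - y| <= e / 2].
have cP : compact P.
  apply: Phi_proper; last exact: closed_ball_compact.
  by move=> y' /= yr; apply: eY; apply/ball_distE; apply: le_lt_trans yr _; lra.
have [d d0 Hd] : exists2 d : R, 0 < d & forall x, P x -> odd_fibre (Phi x) -> d <= `|Psi x - y|.
  apply: compact_uniform => // [d d' x dd' Q o|x Px].
    by apply: le_trans dd' _; exact: Q.
  have [xy|xy] := eqVneq (Psi x) y.
    have [eta eta0 H] := odd_fibre_local (Phi_S Px.1).
    have [d d0 Hd] := Phi_cont Px.1 eta0.
    exists d; first exact: d0.
    move=> x' Px' /Hd[_ h] o; exfalso; apply: nBy; exists (Phi x); last exact: xy.
    exact: ((H _ (Phi_S Px'.1) h).1 o).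
  have a0 : 0 < `|Psi x - y| / 2 by rewrite divr_gt0 // normr_gt0 subr_eq0.
  have [d d0 Hd] := Phi_cont Px.1 a0.
  exists (Num.min d (`|Psi x - y| / 2)); first by rewrite lt_min d0.
  move=> x' Px'; rewrite lt_min => /andP[/Hd[_ h] _] _.
  rewrite ge_min; apply/orP; right.
  have h2 := le_lt_trans (prj_lip _ _) h.
  have := ler_normD (Psi x - Psi x') (Psi x' - y); rewrite addrA subrK.
  by rewrite distrC in h2; lra.
have m0 : 0 < Num.min d (e / 2) by rewrite lt_min d0 divr_gt0.
apply: (near_dist m0) => y'; rewrite lt_min => /andP[y'd y'e] _; split=> [By'|/nBy//]; exfalso.
have [s os sy'] := By'; have [x Xx xs] := odd_fibre_nonempty os.
have Px : P x by split=> //=; rewrite xs sy' ltW.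
by have := Hd x Px; rewrite xs sy' leNgt y'd => /(_ os).
Qed.

End Surjectivity.

(** * The feasible set *)

Section Feasible.
Context {R : realType} {r m : nat}.
Local Notation state := 'cV[R]_(r + m).
Variables (D : set state) (f0 f : state -> state) (B22 : state -> 'M[R]_m).
Hypotheses (D_open : open D) (f_smooth : smooth D f) (B_smooth : smooth D B22).
Hypothesis f0_C1 : Ck 1 D f0.
Hypothesis A_unit : forall U, D U -> dfI_I f U \in unitmx.
Hypothesis B_unit : forall U, D U -> B22 U \in unitmx.
Hypothesis f0_unit : forall U, D U -> df0 f0 U \in unitmx.
Hypothesis entropy : convex_entropy D f0 f B22.
Variable U0 : state.
Hypothesis U0_in : D U0.

Local Notation fld := (vfield f B22 U0).
Local Notation adm := (admissible D f B22 U0).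
Local Notation X := (feasible_set D f B22 U0).

Let Us c := (max_sol D f B22 U0 c).2.
Let Phi c := Us c 1.
Let S := [set s : state | D s /\ usubmx (f s) = usubmx (f U0)].

Lemma feasible_adm c : X c -> adm c.
Proof. exact: connected_component_sub. Qed.


(** Admissibility persists on a ball, and the segment from [c0] to a point of the ball is connected,
    so that point lies in the same component. *)
Lemma feasible_stable c0 : X c0 -> exists d C : R, [/\ 0 < d, 0 <= C &
  forall c, `|c - c0| < d -> X c /\
    forall x, 0 <= x <= 1 -> `|Us c x - Us c0 x| <= C * `|c - c0|].
Proof.
move=> Xc0; have [d [C [d0 C0 H]]] :=
  adm_stable D_open f_smooth B_smooth A_unit B_unit (feasible_adm Xc0).
exists d, C; split=> // c cd; split; last by have [] := H c cd.
pose seg (t : R) := c0 + t *: (c - c0).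
have cseg : continuous seg.
  move=> t; apply: cvgD; first exact: cvg_cst.
  by apply: cvgZr_tmp.
have segA : seg @` `[0, 1] `<=` adm.
  move=> _ [t + <-]; rewrite /= in_itv /= => /andP[t0 t1].
  suff h : `|seg t - c0| < d by have [] := H _ h.
  rewrite /seg addrC addKr normrZ ger0_norm //.
  by apply: le_lt_trans cd; rewrite ler_piMl.
have segC : connected (seg @` `[0, 1]).
  by apply: connected_continuous_connected; [exact: segment_connected|exact: continuous_subspaceT].
have seg0 : (seg @` `[0, 1]) c0.
  by exists 0; rewrite /= ?in_itv /= ?lexx ?ler01 // /seg scale0r addr0.
have seg1 : (seg @` `[0, 1]) c.
  by exists 1; rewrite /= ?in_itv /= ?lexx ?ler01 // /seg scale1r addrC subrK.
have cc : connected_component adm c0 c by exact: (connected_component_max seg0 segA segC).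
exact: (connected_component_trans Xc0 cc).
Qed.

Lemma feasible0 : X 0.
Proof.
apply: connected_component_refl.
by have [] := adm0 D_open f_smooth B_smooth A_unit B_unit U0_in.
Qed.

Lemma Us0 x : 0 <= x <= 1 -> Us 0 x = U0.
Proof. by have [_] := adm0 D_open f_smooth B_smooth A_unit B_unit U0_in; apply. Qed.

Let props c (Xc : X c) :=
  adm_props D_open f_smooth B_smooth A_unit B_unit (feasible_adm Xc).

Lemma feasible_rigid c t : X c -> 0 < t <= 1 -> Us c t = U0 -> c = 0.
Proof.
move=> Xc t01 Ut; have [U00 cU DU fU sol] := props Xc.
have [t0 t1] := andP t01.
apply: (closed_profile_trivial f0_C1 f_smooth B_unit f0_unit entropy U0_in t0 (sol t t01)) => //.
by move=> x /andP[x0 xt]; apply: fU; rewrite x0 (le_trans xt t1).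
Qed.

Lemma near_right_subset (P : R -> Prop) (d : R) : 0 < d ->
  (forall t, 0 < t < d -> P t) -> \forall t \near (0 : R)^'+, P t.
Proof.
move=> d0 H; near=> t; apply: H; apply/andP; split; near: t.
  exact: nbhs_right_gt.
exact: nbhs_right_lt.
Unshelve. all: by end_near. Qed.

(* As t -> 0+ the rescaled time-t maps converge to the identity, because
   B22(U0) U_II'(0) = B22(U0) C2. *)
Lemma rescaled_limit c e : X c -> 0 < e -> exists2 d : R, 0 < d &
  \forall t \near (0 : R)^'+, forall c', `|c' - c| < d ->
    `|t^-1 *: (dsubmx (Us c' t) - dsubmx U0) - c| < e.
Proof.
move=> Xc e0; have e20 : 0 < e / 2 by rewrite divr_gt0.
have lf : loclip fld (U0, c).
  exact: (loclip_vfield D_open f_smooth B_smooth A_unit B_unit).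
have fE : dsubmx (fld (U0, c)) = c.
  rewrite /vfield col_mxKd /= adjinvE ?B_unit // /visc_rhs /= subrr add0r.
  by rewrite mulKmx // B_unit.
have /cvgrPdist_lt /(_ _ e20) /nbhs_ballP[d1 /= d10 H1] := loclip_cts lf.
have [d2 [C [d20 C0 H2]]] := feasible_stable Xc.
have [U00 /cont_onP cU _ _ _] := props Xc.
have d12 : 0 < d1 / 2 by rewrite divr_gt0.
have I0 : 0 \in `[0, 1 : R] by rewrite in_itv /= lexx ler01.
have [d3 d30 H3] := cU 0 I0 _ d12.
have C1 : 0 < 2 * (C + 1) by rewrite mulr_gt0 // ltr_wpDl.
exists (Num.min (Num.min d1 d2) (d1 / (2 * (C + 1)))).
  by rewrite !lt_min d10 d20 divr_gt0.
have m0 : 0 < Num.min 1 d3 by rewrite lt_min ltr01.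
apply: (near_right_subset m0) => t /andP[t0]; rewrite lt_min => /andP[t1 td3] c'.
rewrite !lt_min => /andP[/andP[cd1 cd2] cC].
have [Xc' close] := H2 c' cd2.
have [U00' cU' _ _ sol'] := props Xc'.
have [|cUt _ dUt] := sol' t; first by rewrite t0 ltW.
(* The derivative of [w] is the deviation of the II-part of the field from its value [c] at
   [(U0, c)], small for short times and [c'] near [c]. *)
pose w s := dsubmx (Us c' s) - s *: c.
have dw (s : R) : 0 < s < t -> is_derive s 1 w (dsubmx (fld (Us c' s, c')) - c).
  move=> st; have d1' := is_derive_dsub (dUt s st).
  have d2' : is_derive s 1 (fun s : R => s *: c) c.
    apply: is_derive_col => i.
    have -> : (fun s : R => (s *: c) i 0) = (fun s => s * c i 0).
      by apply/funext => s'; rewrite mxE.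
    by apply: is_derive_eq; rewrite /GRing.scale /=; ring.
  exact: is_deriveB.
have := @norm_increment_le R m w (fun s => e / 2 * s) (fun=> e / 2) 0 t (ltW t0).
rewrite mulr0 subr0 => H.
have {}H : `|w t - w 0| <= e / 2 * t.
  apply: H.
  - have cZ : {within `[0, t], continuous (fun s : R => s *: c)}.
      by apply: continuous_subspaceT => s; apply: cvgZr_tmp.
    have cd : {within `[0, t], continuous (dsubmx \o Us c')}.
      apply: within_continuous_comp cUt => _ /set_mem[x _ <-].
      apply: loclip_cts; exists 1, 1; split=> // y z _ _; rewrite mul1r.
      by rewrite -linearB; exact: dsubmx_norm_le.
    by move=> s; apply: cvgB; [exact: cd|exact: cZ].
  - by move=> s st; have ds := dw s st; exact: ex_derive.
  - by move=> s; apply: is_derive_eq; rewrite /GRing.scale /= mulr1.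
  - move=> s st; have ds := dw s st; rewrite derive_val -[X in _ - X]fE -linearB /=.
    apply: le_trans (dsubmx_norm_le _) _; rewrite distrC; apply: ltW; apply: H1.
    apply/ball_distE; rewrite prod_norm_lt /= cd1 andbT.
    have s01 : 0 <= s <= 1 by case/andP: st => s0 st; rewrite ltW //= ltW // (lt_trans st).
    have h1 := close s s01.
    have h2 : `|Us c s - U0| < d1 / 2.
      rewrite -U00; apply: H3; first by rewrite /= in_itv.
      case/andP: st => s0 st; rewrite subr0 gtr0_norm //; exact: lt_trans st td3.
    have -> : Us c' s - U0 = (Us c' s - Us c s) + (Us c s - U0) by rewrite addrA subrK.
    apply: le_lt_trans (ler_normD _ _) _.
    have h3 : C * `|c' - c| <= d1 / 2.
      by move: cC; rewrite ltr_pdivlMr // => cC; have := normr_ge0 (c' - c); move: cC C0; nra.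
    by lra.
have wE : w t - w 0 = t *: (t^-1 *: (dsubmx (Us c' t) - dsubmx U0) - c).
  rewrite /w scale0r subr0 [Us c' 0]U00' scalerBr scalerA divff ?gt_eqF // scale1r.
  by rewrite addrAC.
move: H; rewrite wE normrZ gtr0_norm // mulrC ler_pM2r // => H.
by apply: le_lt_trans H _; lra.
Qed.

(** The ball [K] is so small that its profiles stay in the patch of the sheet around [U0] where U_II
    determines U; there U_II(t) = U0_II gives U(t) = U0, and rigidity applies. Connectedness of
    [t0, 1] carries the parity from a small time t0, where the rescaled map is close to the
    identity, to time 1. *)
Lemma odd_fibre_base : odd_fibre X Phi S dsubmx U0.
Proof.
have [d [C [d0 C0 H]]] := feasible_stable feasible0.
have [d1 [C1 [d10 C10 sh]]] := sheet D_open f_smooth A_unit U0_in.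
have Cp : 0 < 2 * (C + 1) by rewrite mulr_gt0 // ltr_wpDl.
pose rho := Num.min (d / 2) (d1 / (2 * (C + 1))).
have rho0 : 0 < rho by rewrite lt_min !divr_gt0.
have rhod : rho < d by rewrite /rho gt_min; apply/orP; left; lra.
have Crho : C * rho < d1.
  have h : rho * (2 * (C + 1)) <= d1 by rewrite -ler_pdivlMr // /rho ge_min lexx orbT.
  by move: h rho0 d10 C0; nra.
pose K := [set c : 'cV[R]_m | `|c| <= rho].
have KH c : K c -> X c /\ forall x, 0 <= x <= 1 -> `|Us c x - U0| < d1.
  move=> Kc; have cd : `|c - 0| < d by rewrite subr0 (le_lt_trans Kc).
  have [Xc h] := H c cd; split=> // x x01.
  have := h x x01; rewrite Us0 // subr0 => h'.
  apply: le_lt_trans h' _; apply: le_lt_trans Crho.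
  by rewrite ler_wpM2l.
have rigid c x : K c -> 0 < x <= 1 -> dsubmx (Us c x) = dsubmx U0 -> c = 0.
  move=> Kc x01 e; have [Xc close] := KH c Kc.
  have x01' : 0 <= x <= 1 by case/andP: x01 => x0 ->; rewrite ltW.
  apply: (feasible_rigid Xc x01); apply/eqP; rewrite -subr_eq0 -normr_le0.
  have -> : 0 = C1 * `|dsubmx (Us c x) - dsubmx U0| by rewrite e subrr normr0 mulr0.
  apply: sh; [exact: close|by rewrite subrr normr0|].
  by have [_ _ _ fU _] := props Xc; exact: fU.
have K0 : nbhs (0 : 'cV[R]_m) K by apply: (@near_dist _ _ _ _ K rho0) => y; rewrite subr0 => /ltW.
have cK : compact K.
  have -> : K = [set c | `|c - 0| <= rho] by apply/seteqP; split=> c; rewrite /K /= subr0.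
  exact: closed_ball_compact.
pose g t c := dsubmx (Us c t) - dsubmx U0.
have gcont t c : 0 <= t <= 1 -> K c -> forall e, 0 < e -> exists2 d : R, 0 < d &
    forall t' c', 0 <= t' <= 1 -> `|t' - t| < d -> `|c' - c| < d -> `|g t' c' - g t c| < e.
  move=> t01 Kc e e0; have [Xc _] := KH c Kc.
  have [d2 [C2 [d20 C20 H2]]] := feasible_stable Xc.
  have [_ /cont_onP cU _ _ _] := props Xc.
  have e2 : 0 < e / 2 by rewrite divr_gt0.
  have It : `[0, 1]%classic t by rewrite /= in_itv.
  have [d3 d30 H3] := cU t It _ e2.
  have C2p : 0 < 2 * (C2 + 1) by rewrite mulr_gt0 // ltr_wpDl.
  exists (Num.min d2 (Num.min d3 (e / (2 * (C2 + 1))))); first by rewrite !lt_min d20 d30 divr_gt0.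
  move=> t' c' t'01; rewrite !lt_min => /and3P[_ td3 _] /and3P[cd2 _ cC].
  have [_ /(_ t' t'01) h1] := H2 c' cd2.
  have h2 : `|Us c t' - Us c t| < e / 2 by apply: H3; rewrite //= in_itv.
  have h3 : C2 * `|c' - c| <= e / 2.
    by move: cC; rewrite ltr_pdivlMr // => cC; have := normr_ge0 (c' - c); move: cC C20; nra.
  have -> : g t' c' - g t c = dsubmx (Us c' t' - Us c t).
    by apply/colP => i; rewrite !mxE; ring.
  apply: le_lt_trans (dsubmx_norm_le _) _.
  have -> : Us c' t' - Us c t = (Us c' t' - Us c t') + (Us c t' - Us c t) by rewrite addrA subrK.
  by apply: le_lt_trans (ler_normD _ _) _; lra.
have cg t : 0 <= t <= 1 -> cont_on K (g t).
  move=> t01 c Kc e e0; have [d' d'0 Hd] := gcont t c t01 Kc e e0.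
  by exists d' => // c' _ cc'; apply: Hd => //; rewrite subrr normr0.
have odd1 : odd_degree K (g 1).
  have lim0 : \forall t \near 0^'+,
      odd_degree K (fun c => t^-1 *: g t c) <-> odd_degree K id.
    apply: (@odd_degree_near R m K _ 0^'+ (fun t c => t^-1 *: g t c)) => //.
    - by move=> c _ e e0; exists e.
    - move=> c Kc e e0; have e2 : 0 < e / 2 by rewrite divr_gt0.
      have [d' d'0 Hd] := rescaled_limit (KH c Kc).1 e0.
      exists d'; first exact: d'0.
      by apply: filterS Hd => t Ht c' _; exact: Ht.
    - by move=> c _ ->.
  have in01 : \forall t \near (0 : R)^'+, 0 < t < 1.
    exact: (@near_right_subset (fun t => 0 < t < 1) 1 ltr01).
  have [t0 [/andP[t00 t01] o0]] : exists t, 0 < t < 1 /\ odd_degree K (g t).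
    have [t [E t01]] := filter_ex (filterI lim0 in01).
    exists t; split; first exact: t01.
    apply: (odd_degree_scale K (g t) _).1; last exact: (E.2 (odd_degree_id rho0)).
    by rewrite invr_gt0; case/andP: t01.
  have I0 : `[t0, 1]%classic t0 by rewrite /= in_itv /= lexx ltW.
  have I1 : `[t0, 1]%classic (1 : R) by rewrite /= in_itv /= lexx ltW.
  have sub01 t : `[t0, 1]%classic t -> 0 < t <= 1.
    by rewrite /= in_itv /= => /andP[h ->]; rewrite andbT (lt_le_trans t00).
  have sub01' t : `[t0, 1]%classic t -> 0 <= t <= 1.
    by move=> /sub01/andP[h ->]; rewrite ltW.
  apply: (@connected_locally_constant _ `[t0, 1] (fun t => odd_degree K (g t))
    (@segment_connected _ _ _) _ t0 1 I0 I1 o0) => t It.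
  have : \forall t' \near within `[t0, 1] (nbhs t),
      odd_degree K (g t') <-> odd_degree K (g t).
    apply: odd_degree_near cK (cg t (sub01' t It)) _ _ => [c Kc e e0|c Kc /subr0_eq gc].
      have [d' d'0 Hd] := gcont t c (sub01' t It) Kc e e0.
      exists d'; first exact: d'0.
      rewrite near_withinE; apply: (@near_dist _ _ t _ _ d'0) => t' tt' It' c' _ cc'.
      exact: Hd (sub01' t' It') tt' cc'.
    by rewrite (rigid c t Kc (sub01 t It) gc).
  by rewrite near_withinE.
have Phi0 : Phi 0 = U0 by apply: Us0; rewrite ler01 lexx.
have lt01 : 0 < (1 : R) <= 1 by rewrite ltr01 lexx.
split; first by split.
exists K; last exact: odd1.
split=> [c /KH[]//|//|c Xc cU|c Kc cU].
  by rewrite (feasible_rigid Xc lt01 cU).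
by rewrite (rigid c 1 Kc lt01 cU).
Qed.

Lemma feasible_surjective y : connected D -> Psi_proper D f B22 U0 -> II_values D y ->
  exists2 c, X c & Psi D f B22 U0 c = y.
Proof.
move=> D_conn proper Yy.
have dsub_cts : continuous (@dsubmx R r m 1).
  move=> u; apply: loclip_cts; exists 1, 1; split=> // a b _ _; rewrite mul1r.
  by rewrite -linearB; exact: dsubmx_norm_le.
suff [c [Xc cy]] : exists c, X c /\ dsubmx (Phi c) = y by exists c.
apply: (odd_fibre_surjective _ _ _ _ _ _ _ _ odd_fibre_base Yy).
- move=> c Xc e e0; have [d [C [d0 C0 H]]] := feasible_stable Xc.
  have Cp : 0 < C + 1 by rewrite ltr_wpDl.
  exists (Num.min d (e / (C + 1))); first by rewrite lt_min d0 divr_gt0.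
  move=> c'; rewrite lt_min => /andP[cd cC]; have [Xc' h] := H c' cd.
  split; first exact: Xc'.
  have h1 : `|Us c' 1 - Us c 1| <= C * `|c' - c| by apply: h; rewrite ler01 lexx.
  apply: le_lt_trans h1 _; move: cC; rewrite ltr_pdivlMr // => cC.
  by have := normr_ge0 (c' - c); move: cC; nra.
- move=> c Xc; have [_ _ DU fU _] := props Xc.
  by split; [apply: DU|apply: fU]; rewrite ler01 lexx.
- by move=> u v; rewrite -linearB; exact: dsubmx_norm_le.
- move=> s [Ds _]; have [d [C [d0 C0 sh]]] := sheet D_open f_smooth A_unit Ds.
  by exists d, C; split=> // u v [_ fu] [_ fv] us vs; apply: sh => //; rewrite fu fv.
(* A small change of the II-part alone keeps a state in the open set [D]. *)
- rewrite openE => _ [s Ds <-].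
  have /nbhs_ballP[e /= e0 eD] : nbhs s D by exact: open_nbhs_nbhs.
  apply: (@near_dist _ _ _ _ (II_values D) e0) => y' ys.
  exists (col_mx (usubmx s) y'); last by rewrite col_mxKd.
  apply: eD; apply/ball_distE; apply: le_lt_trans ys.
  rewrite -{2}[s]vsubmxK opp_col_mx add_col_mx subrr.
  by apply: le_trans (col_norm_le _) _; rewrite col_mxKu col_mxKd normr0 add0r.
- apply: connected_continuous_connected D_conn _.
  exact: continuous_subspaceT.
- by move=> s [Ds _]; exists s.
- exact: proper.
Qed.

(** On the open interval the viscous flux equals the integrated right-hand side, which involves U
    but not U'. It is therefore differentiable, with the derivative of [f] along the profile, and
    U'' is never formed. *)
Lemma feasible_profile c : X c ->
  steady_profile D f B22 U0 (Psi D f B22 U0 c) (max_sol D f B22 U0 c).2.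
Proof.
move=> Xc; have [U00 cU DU fI sol] := props Xc.
split=> // x x01.
have [|_ _ dU] := sol 1; first by rewrite ltr01 lexx.
pose V y := fld (Us c y, c).
have dUV (y : R) : 0 < y < 1 -> is_derive y 1 (Us c) (V y) by exact: dU.
have ieq01 (y : R) : 0 < y < 1 -> 0 <= y <= 1 by case/andP=> ? ?; rewrite !ltW.
have Dx := DU x (ieq01 x x01).
have df : differentiable f (Us c x) by exact: (f_smooth 1).1.
have dUx : derivable (Us c) x 1 by have h := dUV x x01; exact: ex_derive.
have dflux := is_derive_comp dUx df.
pose rhs y := f (Us c y) - f U0 + col_mx 0 (B22 U0 *m c).
have drhs : is_derive x 1 rhs ('D_('D_1 (Us c) x) f (Us c x)).
  by apply: is_derive_eq; rewrite subr0 addr0.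
have visc_rhsE (y : R) : 0 < y < 1 -> Bmx B22 (Us c y) *m derive1 (Us c) y = rhs y.
  move=> y01; have := dUV y y01; have Dy := DU y (ieq01 y y01) => dUy.
  rewrite derive1E derive_val /Bmx /V /vfield mul_block_col !mul0mx !add0r /=.
  rewrite adjinvE ?B_unit // mulKVmx ?B_unit //.
  rewrite /rhs -[f (Us c y) - f U0]vsubmxK linearB /= [usubmx (f _)]fI ?ieq01 // subrr add_col_mx addr0.
  by rewrite /visc_rhs /= linearB.
have dvisc : is_derive x 1 (fun y => Bmx B22 (Us c y) *m derive1 (Us c) y)
    ('D_('D_1 (Us c) x) f (Us c x)).
  apply: near_eq_is_derive drhs.
  have : x \in `]0, 1[ by rewrite in_itv.
  move=> /near_in_itvoo; apply: filterS => y; rewrite in_itv => /visc_rhsE ->.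
  by [].
split; first exact: dUx.
- exact: (@ex_derive _ _ _ _ _ _ _ dflux).
- exact: (@ex_derive _ _ _ _ _ _ _ dvisc).
- by rewrite !derive1E (@derive_val _ _ _ _ _ _ _ dflux) (@derive_val _ _ _ _ _ _ _ dvisc).
Qed.

End Feasible.

Theorem corollary2p13 (R : realType) (r m : nat)
  (D : set 'cV[R]_(r + m))
  (f0 f : 'cV[R]_(r + m) -> 'cV[R]_(r + m))
  (B22 : 'cV[R]_(r + m) -> 'M[R]_m)
  (D_open : open D) (D_connected : connected D)
  (f0_C1 : Ck 1 D f0) (f_smooth : smooth D f) (B_smooth : smooth D B22)
  (f0_str : forall U, D U -> f0_structure f0 U)
  (B_parabolic : forall U, D U -> parabolicity f0 B22 U)
  (dfI_I_pos : forall U, D U -> real_pos_spectrum (dfI_I f U))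
  (entropy : convex_entropy D f0 f B22)
  (U0 : 'cV[R]_(r + m)) (U0_in : D U0)
  (proper : Psi_proper D f B22 U0)
  (U1II : 'cV[R]_m) (U1II_in : II_values D U1II) :
  exists U : R -> 'cV[R]_(r + m), steady_profile D f B22 U0 U1II U.
Proof.
have A_unit U : D U -> dfI_I f U \in unitmx.
  by move=> DU; apply: pos_spectrum_unitmx; exact: dfI_I_pos.
have B_unit U : D U -> B22 U \in unitmx.
  by move=> DU; apply: parabolic_unitmx (f0_str U DU) (B_parabolic U DU).
have f0_unit U : D U -> df0 f0 U \in unitmx by move=> /f0_str[].
have [c Xc <-] := feasible_surjective D_open f_smooth B_smooth f0_C1 A_unit B_unit
  f0_unit entropy U0_in D_connected proper U1II_in.
exists (max_sol D f B22 U0 c).2.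
exact: (feasible_profile D_open f_smooth B_smooth A_unit B_unit Xc).
Qed.
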